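(* Let $N\ge 1$, let $X=\mathbb{P}^N$, let $z\in\mathbb{C}^*$, let $q_0\in\mathbb{C}^*$ with $|q_0|<1$, and put $q(t)=q_0^t$ for $t\in(0,1]$. Let $\widetilde{J^{K\mathrm{th}}}$ and $\widetilde{J^{\mathrm{coh}}}$ be the small $K$-theoretical and cohomological $J$-functions of $\mathbb{P}^N$ (defined in the context). Then: (i) The $q$-pullback by $\varphi_{q,z}:Q\mapsto\left(\frac{z}{1-q}\right)^{N+1}Q$ of the $q$-difference system associated to the $q$-difference equation $$\left[(1-q^{Q\partial_Q})^{N+1}-Q\right]f(Q)=0$$ satisfied by $\widetilde{J^{K\mathrm{th}}}$ is confluent, and its limit is the differential system associated to the differential equation $$\left[(zQ\partial_Q)^{N+1}-Q\right]f(Q)=0$$ satisfied by $\widetilde{J^{\mathrm{coh}}}$. (ii) Let $\gamma:K(\mathbb{P}^N)\otimes\mathbb{Q}\to H^*(\mathbb{P}^N;\mathbb{Q})$ be the ring isomorphism defined by $\gamma(1-P^{-1})=H$ (extended $\mathbb{C}$-linearly), and let $\mathrm{confluence}(\widetilde{J^{K\mathrm{th}}})$ be the result of confluence applied to the solution $\widetilde{J^{K\mathrm{th}}}$ (the limit defined in the context). Then this limit exists for every $Q\in\mathbb{C}^*\setminus(-1)q_0^{\mathbb{R}}$ and $$\gamma\left(\mathrm{confluence}(\widetilde{J^{K\mathrm{th}}})(z,Q)\right)=\widetilde{J^{\mathrm{coh}}}(z,Q).$$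
   Context: **Basic notation.** Fix a logarithm $\log q_0$ and put $q_0^s=\exp(s\log q_0)$ for $s\in\mathbb{R}$; $q_0^{\mathbb{R}}=\{q_0^s: s\in\mathbb{R}\}$ and $(-1)q_0^{\mathbb{R}}=\{-q_0^s\}$. For $0<|q|<1$, $(q^{Q\partial_Q}f)(Q)=f(qQ)$ and $\delta_q=\frac{q^{Q\partial_Q}-\mathrm{Id}}{q-1}$. $(x;q)_d=\prod_{r=0}^{d-1}(1-q^rx)$. $\log Q$ denotes the branch on the simply connected set $\mathbb{C}^*\setminus(-1)q_0^{\mathbb{R}}$ with $\log 1=0$. **$q$-logarithm.** $\theta_q(Q)=\sum_{d\in\mathbb{Z}}q^{d(d-1)/2}Q^d$ and $\ell_q(Q)=-Q\theta_q'(Q)/\theta_q(Q)$, a meromorphic function on $\mathbb{C}^*$ with $\ell_q(qQ)=\ell_q(Q)+1$. For a nonnegative integer $a$, $\binom{\ell_q(Q)}{a}=\frac1{a!}\prod_{r=0}^{a-1}(\ell_q(Q)-r)$. **Rings.** $P=\mathcal{O}(1)\in K(\mathbb{P}^N)=\mathbb{Z}[P,P^{-1}]/((1-P^{-1})^{N+1})$; $H=c_1(\mathcal{O}(1))\in H^*(\mathbb{P}^N;\mathbb{Q})=\mathbb{Q}[H]/(H^{N+1})$. **$J$-functions.** $$\widetilde{J^{K\mathrm{th}}}(q,Q)=P^{-\ell_q(Q)}\sum_{d\ge0}\frac{Q^d}{(qP^{-1};q)_d^{N+1}},\qquad P^{-\ell_q(Q)}=\sum_{k\ge0}(-1)^k\binom{\ell_q(Q)}{k}(1-P^{-1})^k,$$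 $$\widetilde{J^{\mathrm{coh}}}(z,Q)=Q^{H/z}\sum_{d\ge0}\frac{Q^d}{\prod_{r=1}^d(H+rz)^{N+1}},\qquad Q^{H/z}=\exp\left(\tfrac{H}{z}\log Q\right),$$ where inverses are taken using that $1-P^{-1}$ and $H$ are nilpotent. Define functions $J_b(q,Q)$, $0\le b\le N$, by $\sum_{d\ge0}\frac{Q^d}{(qP^{-1};q)_d^{N+1}}=\sum_{b=0}^NJ_b(q,Q)(1-P^{-1})^b$. **Associated systems.** The $q$-difference equation is identified with the system $\delta_qX=B_qX$ for $X=(f,\delta_qf,\dots,\delta_q^Nf)^T$, where $B_q$ is the companion matrix with $1$'s on the superdiagonal, lower left entry $Q/(1-q)^{N+1}$ and zeros elsewhere; equivalently $q^{Q\partial_Q}X=A_qX$ with $A_q=\mathrm{Id}+(q-1)B_q$. The differential equation is identified with $Q\partial_QX=\widetilde BX$ for $X=(f,Q\partial_Qf,\dots,(Q\partial_Q)^Nf)^T$, where $\widetilde B$ is the companion matrix with $1$'s on the superdiagonal, lower left entry $Q/z^{N+1}$ and zeros elsewhere. **$q$-pullback.** For an isomorphism $f:\mathbb{C}\to\mathbb{C}$, the $q$-pullback of $q^{Q\partial_Q}X=A_q(Q)X$ by $f$ is $q^{Q\partial_Q}X=A_q(f^{-1}(Q))X$. **Confluent system.** A system $q^{Q\partial_Q}X=A_q(Q)X$ of rank $n$ is *regular singular* (at $Q=0$) if there is a gauge transformation $F_q$, an invertible $n\times n$ matrix of Laurent series converging in a punctured disc at $0$, such that $(q^{Q\partial_Q}F_q)A_qF_q^{-1}$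 is well defined and invertible at $Q=0$. It is *non $q$-resonant* if any two distinct eigenvalues $\lambda_i\ne\lambda_j$ of $A_q(0)$ satisfy $\lambda_i\lambda_j^{-1}\notin q^{\mathbb{Z}}$. A regular singular, non $q$-resonant system is *confluent* if, with $B_q=(A_q-\mathrm{Id})/(q-1)$ having poles $Q_1(q),\dots,Q_k(q)$ in $Q$: (1) the spirals $Q_i(q_0)q_0^{\mathbb{R}}$ are pairwise disjoint; (2) there is $\widetilde B\in GL_n(\mathbb{C}(Q))$ with $\lim_{t\to0}B_{q(t)}=\widetilde B$ uniformly on compact subsets of $\mathbb{C}^*\setminus\bigcup_{i=0}^kQ_i(q_0)q_0^{\mathbb{R}}$, where $Q_0=1$; (3) $Q\partial_QX=\widetilde BX$ is regular singular at $Q=0$ and non resonant (differences of distinct eigenvalues of $\widetilde B(0)$ are not integers), with distinct singularities $\lim_{t\to0}Q_i(q(t))$; (4) there are Jordan decompositions $B_{q(t)}(0)=P_{q(t)}^{-1}\mathcal{J}_{q(t)}P_{q(t)}$ and $\widetilde B(0)=\widetilde P^{-1}\widetilde{\mathcal{J}}\widetilde P$ with $\lim_{t\to0}P_{q(t)}=\widetilde P$. The *limit* of the confluent system is $Q\partial_QX=\widetilde BX$. **Confluence of the solution.** The $q$-pulled-back solution $\widetilde{J^{K\mathrm{th}}}(q,\varphi_{q,z}^{-1}(Q))$ is modified by a $q$-constant change of fundamental solution, denoted $P_{q,z}$, which replaces $\ell_q(\varphi_{q,z}^{-1}(Q))$ by $\ell_q(Q)$ and multiplies the coefficient of $(1-P^{-1})^i$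 by $\left(\frac{1-q}{z}\right)^i$. The result is $$P_{q,z}\cdot\varphi_{q,z}^*\widetilde{J^{K\mathrm{th}}}(z,q,Q)=\sum_{i=0}^N(1-P^{-1})^i\sum_{0\le a,b\le N,\ a+b=i}\left(\frac{q-1}{z}\right)^a\binom{\ell_q(Q)}{a}\left(\frac{1-q}{z}\right)^bJ_b\left(q,\left(\frac{1-q}{z}\right)^{N+1}Q\right),$$ and $\mathrm{confluence}(\widetilde{J^{K\mathrm{th}}})(z,Q)=\lim_{t\to0}P_{q(t),z}\cdot\varphi_{q(t),z}^*\widetilde{J^{K\mathrm{th}}}(z,q(t),Q)$ (for fixed $Q$ the series $J_b$ converge once $t$ is small). *)

(* Defs.v *)
From HB Require Import structures.
From mathcomp Require Import all_boot all_order all_algebra.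
From mathcomp Require Import complex qpoly fraction generic_quotient.
From mathcomp Require Import all_classical all_reals all_analysis.

Set Implicit Arguments.
Unset Strict Implicit.
Unset Printing Implicit Defensive.

Import Order.TTheory GRing.Theory Num.Theory numFieldNormedType.Exports.
Local Open Scope classical_set_scope.
Local Open Scope ring_scope.
Local Open Scope complex_scope.

(* Typing the complex numbers as a numClosedFieldType makes the generic
   topology of numeric fields available on them. *)
Definition Cplx (R : realType) : numClosedFieldType := R[i].

Section ComplexExponential.
Variable R : realType.
Local Notation C := (Cplx R).

Definition cexp (z : C) : C :=
  let: x +i* y := (z : R[i]) in (expR x * cos y) +i* (expR x * sin y).

(* q0 ^ s, where lq0 is the chosen logarithm of q0; also q(t) = q0 ^ t. *)
Definition qpow (lq0 : C) (s : R) : C := cexp (s%:C * lq0).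

(* The spiral c * q0 ^ R. *)
Definition spiral (lq0 c : C) : set C := [set c * qpow lq0 s | s in [set: R]].

Definition log_domain (lq0 : C) : set C :=
  [set Q | Q != 0] `\` spiral lq0 (-1).

Definition is_log_branch (lq0 : C) (L : C -> C) : Prop :=
  [/\ {within log_domain lq0, continuous L},
      forall Q, log_domain lq0 Q -> cexp (L Q) = Q & L 1 = 0].

End ComplexExponential.

Section QLogarithm.
Variable R : realType.
Local Notation C := (Cplx R).

(* The bilateral series is split into its terms of index d and -(d + 1), d >= 0;
   'C(d, 2) = d (d - 1) / 2 and 'C(d + 2, 2) = - (d + 1) (- (d + 1) - 1) / 2. *)
Definition theta (q Q : C) : C :=
  limn (series (fun d : nat => q ^+ 'C(d, 2) * Q ^+ d)) +
  limn (series (fun d : nat => q ^+ 'C(d.+2, 2) * Q ^- d.+1)).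

Definition ellq (q Q : C) : C := - Q * derive1 (theta q) Q / theta q Q.

Definition cbinom (x : C) (a : nat) : C :=
  (\prod_(r < a) (x - r%:R)) / a`!%:R.

End QLogarithm.

(* K(P^N) tensored with C. It is presented with the generator P^-1 instead of
   P^{+-1}: modulo (1 - P^-1)^(N+1) the class of P^-1 is already a unit.
   ('X - 1 rather than 1 - 'X, because {poly %/ h} requires h monic.) *)
Definition relK (R : realType) (N : nat) : {poly Cplx R} := ('X - 1) ^+ N.+1.
Definition relH (R : realType) (N : nat) : {poly Cplx R} := 'X^(N.+1).
Notation KP R N := {poly %/ (relK R N)}.
Notation HP R N := {poly %/ (relH R N)}.

Section Rings.
Variables (R : realType) (N : nat).
Local Notation C := (Cplx R).
Local Notation hK := (relK R N).
Local Notation hH := (relH R N).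

Definition Pinv : KP R N := in_qpoly hK 'X.
Definition Hcl : HP R N := in_qpoly hH 'X.

(* Coordinates in the bases (1 - P^-1)^b and H^b, 0 <= b <= N; for the first
   one, p(X) = \sum_b c_b (1 - X)^b iff p(1 - X) = \sum_b c_b X^b. *)
Definition kcoef (b : nat) (p : KP R N) : C := ((p : {poly C}) \Po (1 - 'X))`_b.
Definition hcoef (b : nat) (p : HP R N) : C := (p : {poly C})`_b.

(* The C-linear ring isomorphism with P^-1 |-> 1 - H. *)
Definition gamma (p : KP R N) : HP R N :=
  in_qpoly hH ((p : {poly C}) \Po (1 - 'X)).

Lemma hK_monic : hK \is monic.
Proof. by rewrite /relK monic_exp // -polyC1 monicXsubC. Qed.

Lemma mk_monic_hK : mk_monic hK = hK.
Proof.
by rewrite /mk_monic hK_monic /relK -polyC1 size_exp_XsubC.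
Qed.

Lemma mk_monic_hH : mk_monic hH = hH.
Proof. by rewrite /relH mk_monic_Xn. Qed.

Lemma in_qpoly_val (h : {poly C}) (p : {poly %/ h}) : in_qpoly h p = p.
Proof. by apply/val_inj/in_qpoly_small/size_mk_monic. Qed.

Lemma comp_1subX (p : {poly C}) : (p \Po (1 - 'X)) \Po (1 - 'X) = p.
Proof.
rewrite -comp_polyA comp_polyB comp_polyX -polyC1 comp_polyC polyC1.
by rewrite opprB addrC subrK comp_polyXr.
Qed.

Lemma hK_comp : hK \Po (1 - 'X) = (-1) ^+ N.+1 * hH.
Proof.
rewrite /relK rmorphXn /= comp_polyB comp_polyX -polyC1 comp_polyC polyC1.
by rewrite addrAC subrr add0r -exprMn mulN1r.
Qed.

Lemma gamma_in (p : {poly C}) :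
  gamma (in_qpoly hK p) = in_qpoly hH (p \Po (1 - 'X)).
Proof.
rewrite /gamma /= mk_monic_hK.
rewrite [in RHS](Pdiv.RingMonic.rdivp_eq hK_monic p).
rewrite comp_polyD comp_polyM hK_comp.
have hH0 : in_qpoly hH hH = 0.
  by apply/val_inj; rewrite /= mk_monic_hH Pdiv.RingMonic.rmodpp // monicXn.
by rewrite mulrA in_qpolyD in_qpolyM hH0 mulr0; exact/esym/add0r.
Qed.

Lemma gamma_is_linear : linear gamma.
Proof.
by move=> a p q; rewrite /gamma /= linearP /= in_qpolyD in_qpolyZ.
Qed.

Lemma gamma_is_monoid_morphism : monoid_morphism gamma.
Proof.
split=> [|p q].
  by rewrite -(in_qpoly1 hK) gamma_in -polyC1 comp_polyC polyC1 in_qpoly1.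
rewrite -[p * q]/(in_qpoly hK ((p : {poly C}) * (q : {poly C}))).
by rewrite gamma_in rmorphM in_qpolyM.
Qed.

HB.instance Definition _ :=
  GRing.isLinear.Build C (KP R N) (HP R N) _ gamma gamma_is_linear.
HB.instance Definition _ :=
  GRing.isMonoidMorphism.Build (KP R N) (HP R N) gamma gamma_is_monoid_morphism.

Lemma gamma_1subPinv : gamma (1 - Pinv) = Hcl.
Proof.
rewrite rmorphB rmorph1 /= gamma_in comp_polyX raddfB /= in_qpoly1.
by rewrite opprB addrC subrK.
Qed.

Lemma in_hK_comp (p : {poly C}) :
  in_qpoly hK ((in_qpoly hH p : {poly C}) \Po (1 - 'X)) =
  in_qpoly hK (p \Po (1 - 'X)).
Proof.
rewrite /= mk_monic_hH.
rewrite [in RHS](Pdiv.RingMonic.rdivp_eq (monicXn C N.+1) p).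
have hXc : hH \Po (1 - 'X) = (-1) ^+ N.+1 * hK.
  by rewrite /relH /relK comp_Xn_poly -exprMn mulN1r opprB.
rewrite comp_polyD comp_polyM hXc.
have hK0 : in_qpoly hK hK = 0.
  by apply/val_inj; rewrite /= mk_monic_hK Pdiv.RingMonic.rmodpp // hK_monic.
by rewrite mulrA in_qpolyD in_qpolyM hK0 mulr0; exact/esym/add0r.
Qed.

Lemma gamma_bij : bijective gamma.
Proof.
exists (fun p : HP R N => in_qpoly hK ((p : {poly C}) \Po (1 - 'X))) => p.
  by rewrite in_hK_comp comp_1subX in_qpoly_val.
by rewrite gamma_in comp_1subX in_qpoly_val.
Qed.

Lemma kcoefE (p : KP R N) : p = \sum_(b < N.+1) kcoef b p *: (1 - Pinv) ^+ b.
Proof.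
have -> : \sum_(b < N.+1) kcoef b p *: (1 - Pinv) ^+ b =
    in_qpoly hK (\sum_(b < N.+1) kcoef b p *: (1 - 'X) ^+ b).
  rewrite (big_morph _ (in_qpolyD hK) (in_qpoly0 hK)); apply: eq_bigr => b _.
  by rewrite in_qpolyZ rmorphXn rmorphB rmorph1.
rewrite -[LHS]in_qpoly_val; congr (in_qpoly _ _).
rewrite -[LHS]comp_1subX comp_polyE.
have hs : (size ((p : {poly C}) \Po (1 - 'X)) <= N.+1)%N.
  rewrite size_comp_poly2.
    rewrite -ltnS (leq_trans (size_mk_monic p)) //.
    by rewrite mk_monic_hK /relK -polyC1 size_exp_XsubC.
  by rewrite -opprB size_polyN -polyC1 size_XsubC.
rewrite (big_ord_widen _ (fun i => (((p : {poly C}) \Po (1 - 'X))`_i *: (1 - 'X) ^+ i)) hs).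
rewrite big_mkcond /=; apply: eq_bigr => i _; case: ltnP => // hi.
by rewrite /kcoef nth_default // scale0r.
Qed.

Lemma Pinv_unit : Pinv \is a GRing.unit.
Proof.
have nil : (1 - Pinv) ^+ N.+1 = 0.
  rewrite -(in_qpoly1 hK) /Pinv -rmorphB -rmorphXn /=.
  have -> : (1 - 'X) ^+ N.+1 = (-1) ^+ N.+1 * hK.
    by rewrite /relK -exprMn mulN1r opprB.
  by apply/val_inj; rewrite /= mk_monic_hK Pdiv.RingMonic.rmodp_mull // hK_monic.
apply/unitrPr; exists (\sum_(i < N.+1) (1 - Pinv) ^+ i).
have := subrX1 (1 - Pinv) N.+1; rewrite nil sub0r.
have -> : 1 - Pinv - 1 = - Pinv by rewrite addrC addKr.
by rewrite mulNr => /oppr_inj.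
Qed.

End Rings.

Section JFunctions.
Variables (R : realType) (N : nat).
Local Notation C := (Cplx R).

(* Infinite sums in K(P^N) and H^*(P^N) are taken coordinatewise. *)
Definition ksum (u : nat -> KP R N) : KP R N :=
  \sum_(b < N.+1)
    limn (series (fun d => kcoef b (u d))) *: (1 - Pinv R N) ^+ b.
Definition hsum (u : nat -> HP R N) : HP R N :=
  \sum_(b < N.+1) limn (series (fun d => hcoef b (u d))) *: Hcl R N ^+ b.

(* (q P^-1; q)_d *)
Definition qpochP (q : C) (d : nat) : KP R N :=
  \prod_(r < d) (1 - q ^+ r *: (q *: Pinv R N)).

Definition JK_term (q Q : C) (d : nat) : KP R N :=
  Q ^+ d *: (qpochP q d ^+ N.+1)^-1.

Definition Jb (b : nat) (q Q : C) : C := kcoef b (ksum (JK_term q Q)).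

(* The sum defining P^(- ell_q(Q)) stops at N, as (1 - P^-1)^(N+1) = 0. *)
Definition JK (q Q : C) : KP R N :=
  (\sum_(k < N.+1)
     ((-1) ^+ k * cbinom (ellq q Q) k) *: (1 - Pinv R N) ^+ k)
  * ksum (JK_term q Q).

Definition Jcoh_term (z Q : C) (d : nat) : HP R N :=
  Q ^+ d *: (\prod_(1 <= r < d.+1) (Hcl R N + (r%:R * z)%:A) ^+ N.+1)^-1.

(* L is the branch of the logarithm; the exponential of the nilpotent element
   (H / z) log Q stops at N, as H^(N+1) = 0. *)
Definition Jcoh (L : C -> C) (z Q : C) : HP R N :=
  (\sum_(k < N.+1) (k`!%:R)^-1 *: ((L Q / z) *: Hcl R N) ^+ k)
  * hsum (Jcoh_term z Q).

(* P_{q,z} . phi_{q,z}^* J^Kth *)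
Definition JK_mod (z q Q : C) : KP R N :=
  \sum_(i < N.+1)
    (\sum_(a < N.+1) \sum_(b < N.+1 | (a + b == i)%N)
       ((q - 1) / z) ^+ a * cbinom (ellq q Q) a *
       (((1 - q) / z) ^+ b * Jb b q (((1 - q) / z) ^+ N.+1 * Q)))
    *: (1 - Pinv R N) ^+ i.

Definition confluence_exists (lq0 z Q : C) : Prop :=
  forall i : nat, cvg (kcoef i (JK_mod z (qpow lq0 t) Q) @[t --> 0^'+]).

Definition confluence (lq0 z Q : C) : KP R N :=
  \sum_(i < N.+1)
    lim (kcoef i (JK_mod z (qpow lq0 t) Q) @[t --> 0^'+]) *: (1 - Pinv R N) ^+ i.

(* [(1 - q^{Q d_Q})^(N+1) - Q] f = 0 at the point Q. *)
Definition qeq_at (q : C) (f : C -> KP R N) (Q : C) : Prop :=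
  iter N.+1 (fun (g : C -> KP R N) x => g x - g (q * x)) f Q - Q *: f Q = 0.

(* z Q d_Q, acting coordinatewise. *)
Definition zQd (z : C) (f : C -> HP R N) : C -> HP R N := fun Q =>
  \sum_(b < N.+1) (z * Q * derive1 (fun x => hcoef b (f x)) Q) *: Hcl R N ^+ b.

(* f can be differentiated N + 1 times at Q and [(z Q d_Q)^(N+1) - Q] f = 0. *)
Definition deq_at (z : C) (f : C -> HP R N) (Q : C) : Prop :=
  (forall k b, (k <= N)%N ->
     derivable (fun x => hcoef b (iter k (zQd z) f x)) Q 1) /\
  iter N.+1 (zQd z) f Q - Q *: f Q = 0.

End JFunctions.

Section RationalFunctions.
Variable R : realType.
Local Notation C := (Cplx R).
Local Notation CQ := {fraction {poly C}}.

(* Numerator and denominator in lowest terms. *)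
Definition rnum (f : CQ) : {poly C} :=
  (frac (repr f)).1 %/ gcdp ((frac (repr f)).1) ((frac (repr f)).2).
Definition rden (f : CQ) : {poly C} :=
  (frac (repr f)).2 %/ gcdp ((frac (repr f)).1) ((frac (repr f)).2).

Definition reval (f : CQ) (x : C) : C := (rnum f).[x] / (rden f).[x].
Definition is_pole (f : CQ) (x : C) : Prop := root (rden f) x.
Definition rcomp (f : CQ) (g : {poly C}) : CQ :=
  tofrac (rnum f \Po g) / tofrac (rden f \Po g).

Definition mxeval n (A : 'M[CQ]_n) (x : C) : 'M[C]_n :=
  \matrix_(i, j) reval (A i j) x.
Definition mx_pole n (A : 'M[CQ]_n) (x : C) : Prop :=
  exists i j, is_pole (A i j) x.

End RationalFunctions.

(* A q-difference system q^{Q d_Q} X = A X and a differential system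
   Q d_Q X = B X are represented by the matrices A and B over C(Q). *)
Section Systems.
Variables (R : realType) (n : nat).
Local Notation C := (Cplx R).
Local Notation CQ := {fraction {poly C}}.

(* B = (A - Id) / (q - 1) *)
Definition delta_mx_of (q : C) (A : 'M[CQ]_n) : 'M[CQ]_n :=
  (tofrac (q - 1)%:P)^-1 *: (A - 1%:M).

(* Inverse of the affine map f = f`_1 'X + f`_0; the automorphisms of C are the
   f of this form with f`_1 != 0. *)
Definition affine_inv (f : {poly C}) : {poly C} := (f`_1)^-1 *: ('X - (f`_0)%:P).

Definition qpullback (f : {poly C}) (A : 'M[CQ]_n) : 'M[CQ]_n :=
  \matrix_(i, j) rcomp (A i j) (affine_inv f).

(* F is an invertible matrix of Laurent series, with finitely many negative
   powers, converging for 0 < |Q| < r. *)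
Definition gauge (F : C -> 'M[C]_n) : Prop :=
  exists (r : R) (m : nat) (G : nat -> 'M[C]_n), 0 < r /\
    forall Q : C, 0 < `|Q| < r%:C ->
      F Q \in unitmx /\
      forall i j, series (fun k => G k i j * Q ^+ k) @ \oo --> Q ^+ m * F Q i j.

(* A function meromorphic at 0 is well defined at 0 iff it has a limit there. *)
Definition q_regular_singular (q : C) (A : 'M[CQ]_n) : Prop :=
  exists F, gauge F /\
    exists2 A0 : 'M[C]_n, A0 \in unitmx &
      F (q * Q) *m mxeval A Q *m invmx (F Q) @[Q --> 0^'] --> A0.

Definition q_nonresonant (q : C) (A : 'M[CQ]_n) : Prop :=
  ~ mx_pole A 0 /\
  forall l1 l2, eigenvalue (mxeval A 0) l1 -> eigenvalue (mxeval A 0) l2 ->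
    l1 != l2 -> forall k : int, l1 / l2 != q ^ k.

(* X |-> F X turns Q d_Q X = B X into the system with matrix
   (F B + Q d_Q F) F^-1. *)
Definition d_regular_singular (B : 'M[CQ]_n) : Prop :=
  exists F, gauge F /\
    exists B0 : 'M[C]_n,
      (F Q *m mxeval B Q + Q *: \matrix_(i, j) derive1 (fun x => F x i j) Q)
        *m invmx (F Q) @[Q --> 0^'] --> B0.

Definition d_nonresonant (B : 'M[CQ]_n) : Prop :=
  ~ mx_pole B 0 /\
  forall l1 l2, eigenvalue (mxeval B 0) l1 -> eigenvalue (mxeval B 0) l2 ->
    l1 != l2 -> forall k : int, l1 - l2 != k%:~R.

(* Block diagonal with Jordan blocks: an upper bidiagonal matrix whose
   superdiagonal entries are 0 or 1, a 1 occurring only between equal diagonal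
   entries. *)
Definition is_jordan (J : 'M[C]_n) : Prop :=
  forall i j : 'I_n, i != j ->
    if (j == i.+1 :> nat)
    then J i j = 0 \/ (J i j = 1 /\ J i i = J j j)
    else J i j = 0.

Definition jordan_decomposition (B P J : 'M[C]_n) : Prop :=
  [/\ P \in unitmx, is_jordan J & B = invmx P *m J *m P].

(* The family A_q, restricted to q = q(t), 0 < t <= 1, is confluent, and its
   limit is the differential system with matrix Bt. The pole Q_i(q(t)) is
   Qp i t; in particular Qp i 1 = Q_i(q0). *)
Definition confluent_with_limit (lq0 : C) (A : C -> 'M[CQ]_n) (Bt : 'M[CQ]_n) :
    Prop :=
  let q := qpow lq0 in
  let B := fun t : R => delta_mx_of (q t) (A (q t)) in
  (forall t : R, 0 < t <= 1 ->
     q_regular_singular (q t) (A (q t)) /\ q_nonresonant (q t) (A (q t))) /\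
  exists (k : nat) (Qp : 'I_k -> R -> C),
  (forall t : R, 0 < t <= 1 ->
     forall x, mx_pole (B t) x <-> exists i, x = Qp i t) /\
  [/\ forall i j, i != j ->
        spiral lq0 (Qp i 1) `&` spiral lq0 (Qp j 1) = set0,
      Bt \in unitmx /\
      (forall K : set C, compact K ->
         K `<=` [set Q | Q != 0] `\`
                (spiral lq0 1 `|` \bigcup_i spiral lq0 (Qp i 1)) ->
         {uniform K, (fun x => mxeval (B t) x) @[t --> 0^'+] -->
                     (fun x => mxeval Bt x)}),
      [/\ d_regular_singular Bt, d_nonresonant Bt &
        exists Ql : 'I_k -> C,
          [/\ injective Ql,
              forall i, Qp i t @[t --> 0^'+] --> Ql i &
              forall x, mx_pole Bt x <-> exists i, x = Ql i]] &
      exists (P J : R -> 'M[C]_n) (Pt Jt : 'M[C]_n),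
        [/\ forall t : R, 0 < t <= 1 ->
              jordan_decomposition (mxeval (B t) 0) (P t) (J t),
            jordan_decomposition (mxeval Bt 0) Pt Jt &
            P t @[t --> 0^'+] --> Pt]].

End Systems.

Section ProjectiveSpaceSystems.
Variables (R : realType) (N : nat).
Local Notation C := (Cplx R).
Local Notation CQ := {fraction {poly C}}.

Definition companion_mx (c : CQ) : 'M[CQ]_N.+1 :=
  \matrix_(i, j)
    if (j == i.+1 :> nat) then 1
    else if (i == ord_max) && (j == ord0) then c else 0.

(* A_q = Id + (q - 1) B_q *)
Definition qsys (q : C) : 'M[CQ]_N.+1 :=
  1%:M + tofrac (q - 1)%:P *:
         companion_mx (tofrac (((1 - q) ^+ N.+1)^-1 *: 'X)).

Definition dsys (z : C) : 'M[CQ]_N.+1 :=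
  companion_mx (tofrac ((z ^+ N.+1)^-1 *: 'X)).

Definition phi (z q : C) : {poly C} := (z / (1 - q)) ^+ N.+1 *: 'X.

End ProjectiveSpaceSystems.

(* Main.v *)
Require Import Defs.
From HB Require Import structures.
From mathcomp Require Import all_boot all_order all_algebra.
From mathcomp Require Import complex qpoly fraction generic_quotient.
From mathcomp Require Import all_classical all_reals all_analysis.
From mathcomp Require Import zify ring lra.

Set Implicit Arguments.
Unset Strict Implicit.
Unset Printing Implicit Defensive.

Import Order.TTheory GRing.Theory Num.Theory numFieldNormedType.Exports.
Local Open Scope classical_set_scope.
Local Open Scope ring_scope.
Local Open Scope complex_scope.

(** The three parts rest on different ideas.

    Equations.  Identify [1 - P^-1] with [H]; the coefficients of [Q^d] in both
    J-functions become products of inverses of [al + be H].  The operator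
    [1 - q^(Q d_Q)] multiplies [P^(- ell_q(Q)) Q^d] by [1 - q^d P^-1], because
    [ell_q(q Q) = ell_q(Q) + 1], and [z Q d_Q] multiplies [Q^(H/z) Q^d] by
    [H + d z].  Applied [N + 1] times, each operator cancels the last factor of the
    coefficient of degree [d] and kills the term of degree 0, as [H^(N+1) = 0]
    ([qeq_JK], [deq_Jcoh]).

    Systems.  The pullback makes [B_q] independent of [q] and equal to the matrix
    of the differential system ([confluent_dsys]).

    Solutions.  The modified solution is a finite convolution of two families.
    One consists of the series [J_b]: rescaling [H] by [(1 - q) / z] turns the
    factors [1 - q^r P^-1] into [z [r]_q + q^r H], which tend to [r z + H], and a
    geometric majorant uniform in [t] allows passing to the limit term by term
    ([cvg_Jb]).  The other consists of the binomials of [ell_q(Q)], which tend to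
    the coefficients of [Q^(H/z)] as soon as [(q - 1) ell_q(Q)] tends to [log Q]
    ([cvg_cbinom]).

    This last limit is the analytic heart ([ell_limit]).  A finite form of the
    Jacobi triple product, normalized by the central Gaussian binomial
    coefficient, gives both the nonvanishing of theta off the spiral of -1 and the
    expansion of [ell_q(Q)] as the limit of
    [sum_(k<2m) 1 / (1 + q^(k-m) Q) - m] ([theta_neq0], [cvg_ellm]).  The
    increment of this sum from [Q] to [rho Q] telescopes exactly when [rho = q],
    which yields [(q - 1) (ell_q(rho Q) - ell_q(Q)) = rho - 1 +
    O(|1 - rho| |q - rho|)], uniformly on a union of spirals away from -1
    ([ell_step]).  Subdividing the path [exp (t x)] from 1 to [Q = exp x] ever
    more finely gives [(q - 1) (ell_q(Q) - ell_q(1)) = x + O(|1 - q|)], and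
    [ell_q(1) = -1/2]. *)

(** * The complex numbers as a normed field *)

Section ComplexBasics.
Variable R : realType.
Local Notation C := (Cplx R).

(** Typed in [Cplx R] and not in [R[i]], so that the topology and the order of
    [Cplx R] are the ones found by inference. *)
Definition rc (x : R) : C := x%:C.
(** The norm of [Cplx R] takes its values in [Cplx R] itself; this real-valued
    version gives access to the total order and to linear arithmetic over [R]. *)
Definition nm (z : C) : R := complex.Re `|z|.

Lemma rcM x y : rc (x * y) = rc x * rc y.
Proof. exact: (rmorphM (real_complex R)). Qed.
Lemma rcD x y : rc (x + y) = rc x + rc y.
Proof. exact: (rmorphD (real_complex R)). Qed.
Lemma rcB x y : rc (x - y) = rc x - rc y.
Proof. exact: (rmorphB (real_complex R)). Qed.
Lemma rc0 : rc 0 = 0. Proof. by []. Qed.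
Lemma rc1 : rc 1 = 1. Proof. by []. Qed.
Lemma rcV x : rc x^-1 = (rc x)^-1. Proof. exact: (fmorphV (real_complex R)). Qed.
Lemma rc_nat n : rc n%:R = n%:R. Proof. exact: (rmorph_nat (real_complex R)). Qed.
Lemma rc_lt x y : (rc x < rc y) = (x < y). Proof. exact: ltcR. Qed.
Lemma rc_le x y : (rc x <= rc y) = (x <= y). Proof. exact: lecR. Qed.

Lemma nmE (z : C) : `|z| = rc (nm z).
Proof. by rewrite /nm normc_def. Qed.

Lemma rc_inj : injective rc. Proof. by move=> x y []. Qed.

Lemma nm_rc x : nm (rc x) = `|x|.
Proof. by apply: rc_inj; rewrite -nmE /rc normc_def /= expr0n addr0 sqrtr_sqr. Qed.

Lemma nm_ge0 z : 0 <= nm z. Proof. by rewrite -rc_le -nmE rc0. Qed.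
Lemma nm0 : nm 0 = 0. Proof. by apply: rc_inj; rewrite -nmE normr0. Qed.
Lemma nm1 : nm 1 = 1. Proof. by apply: rc_inj; rewrite -nmE normr1. Qed.
Lemma nm_eq0 z : (nm z == 0) = (z == 0).
Proof. by rewrite -(inj_eq rc_inj) -nmE rc0 normr_eq0. Qed.
Lemma nm_gt0 z : (0 < nm z) = (z != 0).
Proof. by rewrite -rc_lt -nmE rc0 normr_gt0. Qed.
Lemma nmM x y : nm (x * y) = nm x * nm y.
Proof. by apply: rc_inj; rewrite rcM -!nmE normrM. Qed.
Lemma nmN x : nm (- x) = nm x.
Proof. by rewrite /nm normrN. Qed.
Lemma nmBC x y : nm (x - y) = nm (y - x).
Proof. by rewrite -nmN opprB. Qed.
Lemma nmD x y : nm (x + y) <= nm x + nm y.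
Proof. by rewrite -rc_le rcD -!nmE ler_normD. Qed.
Lemma nmB x y : nm (x - y) <= nm x + nm y.
Proof. by rewrite -(nmN y) nmD. Qed.
Lemma nmDB x y : nm x - nm y <= nm (x + y).
Proof. by rewrite lerBlDr; have := nmB (x + y) y; rewrite addrK. Qed.
Lemma nmX x n : nm (x ^+ n) = nm x ^+ n.
Proof. by elim: n => [|n IH]; rewrite ?expr0 ?nm1 // !exprS nmM IH. Qed.
Lemma nmV x : nm x^-1 = (nm x)^-1.
Proof.
have [->|x0] := eqVneq x 0; first by rewrite invr0 nm0 invr0.
have h : nm x != 0 by rewrite nm_eq0.
by apply: (mulfI h); rewrite -nmM !divff // nm1.
Qed.
Lemma nm_nat n : nm n%:R = n%:R.
Proof.
have -> : (n%:R : C) = rc n%:R by rewrite /rc (rmorph_nat (real_complex R)).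
by rewrite nm_rc normr_nat.
Qed.
Lemma nm_sum (I : Type) (r : seq I) (P : pred I) (F : I -> C) :
  nm (\sum_(i <- r | P i) F i) <= \sum_(i <- r | P i) nm (F i).
Proof.
elim/big_rec2: _ => [|i a b _ h]; first by rewrite nm0.
by apply: (le_trans (nmD _ _)); rewrite lerD2l.
Qed.
Lemma nm_prod (I : Type) (r : seq I) (P : pred I) (F : I -> C) :
  nm (\prod_(i <- r | P i) F i) = \prod_(i <- r | P i) nm (F i).
Proof. exact: (big_morph nm nmM nm1). Qed.

Definition reC (z : C) : R := complex.Re z.
Definition imC (z : C) : R := complex.Im z.

Lemma nm_sqr z : nm z ^+ 2 = reC z ^+ 2 + imC z ^+ 2.
Proof.
rewrite /nm /reC /imC normc_def /= sqr_sqrtr //.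
by rewrite addr_ge0 // sqr_ge0.
Qed.
Lemma re_le_nm z : `|reC z| <= nm z.
Proof.
rewrite -(@ler_pXn2r _ 2) ?nnegrE ?nm_ge0 // nm_sqr real_normK ?num_real //.
by rewrite lerDl sqr_ge0.
Qed.
Lemma im_le_nm z : `|imC z| <= nm z.
Proof.
rewrite -(@ler_pXn2r _ 2) ?nnegrE ?nm_ge0 // nm_sqr real_normK ?num_real //.
by rewrite lerDr sqr_ge0.
Qed.
Lemma nm_le_reim z : nm z <= `|reC z| + `|imC z|.
Proof.
rewrite -(@ler_pXn2r _ 2) ?nnegrE ?nm_ge0 ?addr_ge0 // nm_sqr sqrrD.
by rewrite !real_normK ?num_real // addrAC lerDl mulrn_wge0.
Qed.
Lemma reB x y : reC (x - y) = reC x - reC y. Proof. by case: x; case: y. Qed.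
Lemma imB x y : imC (x - y) = imC x - imC y. Proof. by case: x; case: y. Qed.
Lemma reD x y : reC (x + y) = reC x + reC y. Proof. by case: x; case: y. Qed.
Lemma imD x y : imC (x + y) = imC x + imC y. Proof. by case: x; case: y. Qed.
Lemma re_sum (I : Type) (r : seq I) (P : pred I) (F : I -> C) :
  reC (\sum_(i <- r | P i) F i) = \sum_(i <- r | P i) reC (F i).
Proof. exact: (big_morph reC reD (erefl _)). Qed.
Lemma im_sum (I : Type) (r : seq I) (P : pred I) (F : I -> C) :
  imC (\sum_(i <- r | P i) F i) = \sum_(i <- r | P i) imC (F i).
Proof. exact: (big_morph imC imD (erefl _)). Qed.

Lemma cvgCP (T : Type) (F : set_system T) {FF : Filter F} (f : T -> C) (l : C) :
  f x @[x --> F] --> l <-> forall e : R, 0 < e -> \forall x \near F, nm (f x - l) < e.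
Proof.
split.
  move=> /cvgrPdist_lt h e e0.
  have := h (rc e); rewrite -rc0 rc_lt => /(_ e0).
  by apply: filterS => x; rewrite nmE rc_lt nmBC.
move=> h; apply/cvgrPdist_lt => e e0.
have er : e = rc (reC e).
  by case: e e0 => a b; rewrite ltcE /= => /andP[/eqP -> _].
move: e0; rewrite er -rc0 rc_lt => e0.
by apply: filterS (h _ e0) => x; rewrite nmE rc_lt nmBC.
Qed.

Lemma cvgC_nm (T : Type) (F : set_system T) {FF : Filter F} (f : T -> C) (l : C)
  (g : T -> R) : (\forall x \near F, nm (f x - l) <= g x) ->
  g x @[x --> F] --> 0 -> f x @[x --> F] --> l.
Proof.
move=> h /cvgrPdist_lt hg; apply/cvgCP => e e0.
near=> x; apply: (@le_lt_trans _ _ (g x)); first by near: x.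
have : `|0 - g x| < e by near: x; exact: hg.
by rewrite sub0r normrN; apply: le_lt_trans; exact: ler_norm.
Unshelve. all: by end_near. Qed.

Lemma cvg_nm (T : Type) (F : set_system T) {FF : Filter F} (f : T -> C) (l : C) :
  f x @[x --> F] --> l -> nm (f x) @[x --> F] --> nm l.
Proof.
move=> /cvgCP h; apply/cvgrPdist_lt => e e0.
apply: filterS (h _ e0) => x; apply: le_lt_trans.
rewrite ler_norml; apply/andP; split.
  by rewrite lerNl opprB lerBlDr -[X in nm X <= _](subrK l) nmD.
by rewrite nmBC lerBlDr -[X in nm X <= _](subrK (f x)) nmD.
Qed.

Lemma cvg_rc (T : Type) (F : set_system T) {FF : Filter F} (f : T -> R) (l : R) :
  f x @[x --> F] --> l -> rc (f x) @[x --> F] --> rc l.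
Proof.
move=> /cvgrPdist_lt h; apply/cvgCP => e e0.
by apply: filterS (h _ e0) => x; rewrite -rcB nm_rc distrC.
Qed.

Lemma cvgC_reim (T : Type) (F : set_system T) {FF : Filter F} (f : T -> C) (a b : R) :
  reC (f x) @[x --> F] --> a -> imC (f x) @[x --> F] --> b ->
  f x @[x --> F] --> (a +i* b : C).
Proof.
move=> /cvgrPdist_lt ha /cvgrPdist_lt hb; apply/cvgCP => e e0.
have e2 : 0 < e / 2 by rewrite divr_gt0.
near=> x.
apply: (le_lt_trans (nm_le_reim _)); rewrite reB imB (splitr e).
by apply: ltrD; rewrite distrC /=; near: x; [exact: ha|exact: hb].
Unshelve. all: by end_near. Qed.

Lemma limC (T : Type) (F : set_system T) {FF : ProperFilter F} (f : T -> C) (l : C) :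
  f x @[x --> F] --> l -> lim (f x @[x --> F]) = l.
Proof. by apply: cvg_lim; exact: norm_hausdorff. Qed.

Lemma nm_lim_le (T : Type) (F : set_system T) {FF : ProperFilter F} (f : T -> C)
  (l : C) (B : R) : f x @[x --> F] --> l -> (\forall x \near F, nm (f x) <= B) ->
  nm l <= B.
Proof. by move=> /cvg_nm h hB; exact: (limr_le_near (cvgP _ h) _) || (rewrite -(cvg_lim _ h) //; apply: limr_le => //; exact: cvgP h). Qed.

Section CvgOps.
Context (T : Type) (F : set_system T) {FF : Filter F}.
Implicit Types (f g : T -> C) (a b : C).

Lemma cvgDC f g a b : f x @[x --> F] --> a -> g x @[x --> F] --> b ->
  f x + g x @[x --> F] --> a + b.
Proof. by move=> h k; exact: (cvgD h k). Qed.
Lemma cvgNC f a : f x @[x --> F] --> a -> - f x @[x --> F] --> - a.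
Proof. by move=> h; exact: (cvgN h). Qed.
Lemma cvgBC f g a b : f x @[x --> F] --> a -> g x @[x --> F] --> b ->
  f x - g x @[x --> F] --> a - b.
Proof. by move=> h k; exact: (cvgB h k). Qed.
Lemma cvgMC f g a b : f x @[x --> F] --> a -> g x @[x --> F] --> b ->
  f x * g x @[x --> F] --> a * b.
Proof. by move=> h k; exact: (cvgM h k). Qed.
Lemma cvgVC f a : a != 0 -> f x @[x --> F] --> a -> (f x)^-1 @[x --> F] --> a^-1.
Proof. by move=> a0 h; exact: (cvgV a0 h). Qed.
Lemma cvg_cstC a : (fun _ : T => a) x @[x --> F] --> a.
Proof. exact: cvg_cst. Qed.
Lemma cvg_eqC f g a b : (forall x, f x = g x) -> b = a ->
  g x @[x --> F] --> b -> f x @[x --> F] --> a.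
Proof. by move=> /funext -> ->. Qed.
Lemma cvgMlC f a b : f x @[x --> F] --> b -> a * f x @[x --> F] --> a * b.
Proof. move=> h; apply: cvgMl_tmp; exact: h. Qed.
Lemma cvgMrC f a b : f x @[x --> F] --> a -> f x * b @[x --> F] --> a * b.
Proof. move=> h; apply: cvgMr_tmp; exact: h. Qed.
End CvgOps.

Lemma cvg_sumC (T I : Type) (F : set_system T) {FF : Filter F} (r : seq I)
  (P : pred I) (f : I -> T -> C) (l : I -> C) :
  (forall i, P i -> f i x @[x --> F] --> l i) ->
  \sum_(i <- r | P i) f i x @[x --> F] --> \sum_(i <- r | P i) l i.
Proof.
move=> h; elim: r => [|i r IH].
  by rewrite big_nil; under eq_fun do rewrite big_nil; exact: cvg_cst.
rewrite big_cons; under eq_fun do rewrite big_cons.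
case: (boolP (P i)) => Pi; last exact: IH.
exact: (cvgD (h _ Pi) IH).
Qed.

Lemma cvg_prodC (T I : Type) (F : set_system T) {FF : Filter F} (r : seq I)
  (P : pred I) (f : I -> T -> C) (l : I -> C) :
  (forall i, P i -> f i x @[x --> F] --> l i) ->
  \prod_(i <- r | P i) f i x @[x --> F] --> \prod_(i <- r | P i) l i.
Proof.
move=> h; elim: r => [|i r IH].
  by rewrite big_nil; under eq_fun do rewrite big_nil; exact: cvg_cst.
rewrite big_cons; under eq_fun do rewrite big_cons.
case: (boolP (P i)) => Pi; last exact: IH.
exact: (cvgM (h _ Pi) IH).
Qed.

Lemma cvg_exprC (T : Type) (F : set_system T) {FF : Filter F}
  (f : T -> C) (l : C) n :
  f x @[x --> F] --> l -> f x ^+ n @[x --> F] --> l ^+ n.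
Proof.
move=> h; elim: n => [|n IH]; first by under eq_fun do rewrite expr0; exact: cvg_cst.
by rewrite exprS; under eq_fun do rewrite exprS; exact: (cvgM h IH).
Qed.

Lemma geo_sum_le (K r : R) n m : 0 <= K -> 0 <= r < 1 ->
  \sum_(n <= i < m) K * r ^+ i <= K * r ^+ n / (1 - r).
Proof.
move=> K0 /andP[r0 r1].
have r1' : 0 < 1 - r by rewrite subr_gt0.
have [nm|mn] := leqP n m; last first.
  rewrite big_geq; last exact: ltnW.
  by rewrite divr_ge0 ?mulr_ge0 ?exprn_ge0 // ltW.
suff -> : \sum_(n <= i < m) K * r ^+ i = (K * r ^+ n - K * r ^+ m) / (1 - r).
  rewrite ler_pM2r ?invr_gt0 // lerBlDr lerDl.
  by rewrite mulr_ge0 ?exprn_ge0.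
rewrite (eq_bigr (fun i => (K * r ^+ i - K * r ^+ i.+1) / (1 - r))); last first.
  move=> i _; apply: (canRL (mulfK _)); first by rewrite gt_eqF.
  by rewrite exprS; ring.
by rewrite -mulr_suml; congr (_ / _); elim: m nm => [|m IH];
  [rewrite leqn0 => /eqP ->; rewrite big_geq // subrr
  |rewrite leq_eqVlt => /orP[/eqP <-|h];
   [rewrite big_geq // subrr|rewrite big_nat_recr //= IH //; ring]].
Qed.

Lemma series_shift_dist (u : nat -> C) (K r : R) n m : 0 <= K -> 0 <= r < 1 ->
  (forall d, nm (u d) <= K * r ^+ d) -> (n <= m)%N ->
  nm (series u m - series u n) <= K * r ^+ n / (1 - r).
Proof.
move=> K0 hr hu lnm; rewrite sub_series_geq //.
apply: (le_trans (nm_sum _ _ _)).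
apply: le_trans (geo_sum_le n m K0 hr).
by apply: ler_sum => i _.
Qed.

Lemma geo_cvgR (K r : R) (v : nat -> R) : 0 <= r < 1 ->
  (forall d, `|v d| <= K * r ^+ d) -> cvgn (series v).
Proof.
move=> /andP[r0 r1] hv; apply: normed_cvg.
apply: (@series_le_cvg _ (fun d => `|v d|) (geometric K r)) => //=.
  by move=> n; exact: le_trans (hv n).
by apply: is_cvg_geometric_series; rewrite ger0_norm.
Qed.

(** The real and imaginary parts converge absolutely, by comparison with a
    geometric series. *)
Lemma geo_cvg (u : nat -> C) (K r : R) : 0 <= r < 1 ->
  (forall d, nm (u d) <= K * r ^+ d) -> cvgn (series u).
Proof.
move=> hr hu.
have h1 : cvgn (series (fun d => reC (u d))).
  by apply: (geo_cvgR hr) => d; exact: le_trans (re_le_nm _) (hu d).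
have h2 : cvgn (series (fun d => imC (u d))).
  by apply: (geo_cvgR hr) => d; exact: le_trans (im_le_nm _) (hu d).
have e1 : (fun n => reC (series u n)) = series (fun d => reC (u d)).
  by apply/funext => n; rewrite /series /= re_sum.
have e2 : (fun n => imC (series u n)) = series (fun d => imC (u d)).
  by apply/funext => n; rewrite /series /= im_sum.
apply/cvg_ex; eexists; apply: cvgC_reim.
- by rewrite e1; exact: h1.
- by rewrite e2; exact: h2.
Qed.

Lemma geo_tail (u : nat -> C) (K r : R) n : 0 <= K -> 0 <= r < 1 ->
  (forall d, nm (u d) <= K * r ^+ d) ->
  nm (limn (series u) - series u n) <= K * r ^+ n / (1 - r).
Proof.
move=> K0 hr hu.
have hc : series u m - series u n @[m --> \oo] --> limn (series u) - series u n.
  by apply: cvgB; [exact: geo_cvg hr hu|exact: cvg_cst].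
refine (nm_lim_le hc _); exists n => // m /= hm.
exact: series_shift_dist.
Qed.

Lemma geo_lim0 (K r : R) : 0 <= r < 1 -> K * r ^+ n / (1 - r) @[n --> \oo] --> 0.
Proof.
move=> /andP[r0 r1].
have -> : (fun n => K * r ^+ n / (1 - r)) = (fun n => (K / (1 - r)) * r ^+ n).
  by apply/funext => n; rewrite mulrAC.
rewrite -[X in _ --> X](mulr0 (K / (1 - r))).
by apply: cvgMr; apply: cvg_expr; rewrite ger0_norm.
Qed.

(** Tannery's theorem with a geometric majorant: up to a tail that is small
    uniformly in [x], the series is a finite sum, and finite sums commute with
    limits.  Every exchange of a limit with an infinite sum below is an instance,
    with [F] a punctured neighbourhood of a point, [t --> 0+], or [m --> oo]. *)
Lemma tannery (T : Type) (F : set_system T) {FF : ProperFilter F}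
   (u : T -> nat -> C) (v : nat -> C) (K r : R) :
  0 <= r < 1 -> (forall d, u x d @[x --> F] --> v d) ->
  (\forall x \near F, forall d, nm (u x d) <= K * r ^+ d) ->
  limn (series (u x)) @[x --> F] --> limn (series v).
Proof.
move=> hr hv hK.
have K0 : 0 <= K.
  have [x hx] := filter_ex hK.
  by have := hx 0%N; rewrite expr0 mulr1; apply: le_trans; exact: nm_ge0.
have hvK d : nm (v d) <= K * r ^+ d.
  by apply: (nm_lim_le (hv d)); apply: filterS hK => x; exact.
apply/cvgCP => e e0.
have e4 : 0 < e / 4 by rewrite divr_gt0.
have [n _ hn] : \forall n \near \oo, K * r ^+ n / (1 - r) < e / 4.
  have /cvgrPdist_lt /(_ _ e4) := geo_lim0 K hr.
  apply: filterS => n; rewrite sub0r normrN; apply: le_lt_trans.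
  exact: ler_norm.
have {}hn := hn n (leqnn n).
have hs : series (u x) n @[x --> F] --> series v n.
  by rewrite /series /=; apply: cvg_sumC => i _; exact: hv.
have /cvgCP /(_ _ e4) hs' := hs.
near=> x.
have hx : forall d, nm (u x d) <= K * r ^+ d by near: x.
have h1 := geo_tail n K0 hr hx.
have h2 := geo_tail n K0 hr hvK.
have h3 : nm (series (u x) n - series v n) < e / 4 by near: x.
have -> : limn (series (u x)) - limn (series v) =
  (limn (series (u x)) - series (u x) n) + (series (u x) n - series v n)
  - (limn (series v) - series v n) by ring.
apply: (le_lt_trans (nmB _ _)).
apply: (le_lt_trans (lerD (nmD _ _) (lexx _))).
by lra.
Unshelve. all: by end_near. Qed.

End ComplexBasics.

(** * Geometrically dominated series and power series *)

Section PowerSeries.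
Variable R : realType.
Local Notation C := (Cplx R).
Local Notation S u := (limn (series u)).

(** The explicit constant is what makes the bound uniform when [a] depends on a
    parameter but [B], [rho] and [n0] do not. *)
Lemma ratio_bound (a : nat -> R) (B rho : R) (n0 : nat) :
  0 < rho <= B -> (forall d, 0 <= a d) -> (forall d, a d.+1 <= B * a d) ->
  (forall d, (n0 <= d)%N -> a d.+1 <= rho * a d) ->
  forall d, a d <= a 0%N * (B / rho) ^+ n0 * rho ^+ d.
Proof.
move=> /andP[r0 rB] a0 hB hr.
have B0 : 0 < B by exact: lt_le_trans rB.
have q1 : 1 <= B / rho by rewrite ler_pdivlMr // mul1r.
have low d : a d <= a 0%N * (B / rho) ^+ d * rho ^+ d.
  rewrite -mulrA -exprMn divfK ?gt_eqF //.
  elim: d => [|d IH]; first by rewrite expr0 mulr1.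
  apply: (le_trans (hB d)); rewrite exprS mulrCA ler_pM2l //.
elim=> [|d IH].
  by rewrite expr0 mulr1 ler_peMr // exprn_ege1.
have [h|h] := leqP n0 d.
  apply: (le_trans (hr _ h)); rewrite exprS mulrCA ler_pM2l //.
apply: (le_trans (low _)); rewrite ler_pM2r ?exprn_gt0 //.
by apply: ler_wpM2l => //; apply: ler_weXn2l.
Qed.

Lemma ratio_ev (a : nat -> R) (rho : R) (n0 : nat) :
  0 < rho -> (forall d, 0 <= a d) ->
  (forall d, (n0 <= d)%N -> a d.+1 <= rho * a d) ->
  exists K, forall d, a d <= K * rho ^+ d.
Proof.
move=> r0 a0 hr; exists (\sum_(i < n0.+1) a i / rho ^+ i).
have t0 (i : 'I_n0.+1) : 0 <= a i / rho ^+ i.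
  by rewrite divr_ge0 // exprn_ge0 // ltW.
have low d : (d <= n0)%N -> a d <= (\sum_(i < n0.+1) a i / rho ^+ i) * rho ^+ d.
  move=> hd; rewrite -ler_pdivrMr ?exprn_gt0 //.
  rewrite (bigD1 (Ordinal (hd : (d < n0.+1)%N))) //= lerDl.
  by apply: sumr_ge0 => i _.
elim=> [|d IH]; first exact: low.
have [h|h] := leqP n0 d; last exact: low.
apply: (le_trans (hr _ h)); rewrite exprS mulrCA ler_pM2l //.
Qed.

(** Domination by a geometric sequence, the only kind of summability needed. *)
Definition geob (u : nat -> C) :=
  exists (K r : R), 0 <= r < 1 /\ forall d, nm (u d) <= K * r ^+ d.

Lemma geob_cvg u : geob u -> cvgn (series u).
Proof. by move=> [K [r [hr hu]]]; exact: geo_cvg hr hu. Qed.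

Lemma geob_le u (v : nat -> C) : geob u -> (forall d, nm (v d) <= nm (u d)) -> geob v.
Proof.
move=> [K [r [hr hu]]] h; exists K, r; split => // d.
exact: le_trans (h d) (hu d).
Qed.

Lemma geob_scale c u : geob u -> geob (fun d => c * u d).
Proof.
move=> [K [r [hr hu]]]; exists (nm c * K), r; split => // d.
by rewrite nmM -mulrA; apply: ler_wpM2l => //; exact: nm_ge0.
Qed.

Lemma geob_K0 (u : nat -> C) K (r : R) : (forall d, nm (u d) <= K * r ^+ d) -> 0 <= K.
Proof. by move=> /(_ 0%N); rewrite expr0 mulr1; apply: le_trans; exact: nm_ge0. Qed.

Lemma geob_add u v : geob u -> geob v -> geob (fun d => u d + v d).
Proof.
move=> [K [r [/andP[r0 r1] hu]]] [L [s [/andP[s0 s1] hv]]].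
exists (K + L), (Num.max r s); split.
  by rewrite le_max r0 /= gt_max r1 s1.
move=> d; apply: (le_trans (nmD _ _)); rewrite mulrDl.
apply: lerD.
  apply: (le_trans (hu d)); apply: ler_wpM2l; first exact: geob_K0 hu.
  by apply: lerXn2r; rewrite ?nnegrE ?le_max ?r0 ?lexx.
apply: (le_trans (hv d)); apply: ler_wpM2l; first exact: geob_K0 hv.
by apply: lerXn2r; rewrite ?nnegrE ?le_max ?s0 ?lexx ?orbT.
Qed.

Lemma geob_sum (I : Type) (s : seq I) (P : pred I) (u : I -> nat -> C) :
  (forall i, P i -> geob (u i)) -> geob (fun d => \sum_(i <- s | P i) u i d).
Proof.
move=> h; elim: s => [|i s IH].
  exists 0, 0; split; first by rewrite lexx ltr01.
  by move=> d; rewrite big_nil nm0 mul0r.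
have [Pi|nPi] := boolP (P i).
  apply: (geob_le (geob_add (h i Pi) IH)) => d.
  by rewrite big_cons Pi.
by apply: (geob_le IH) => d; rewrite big_cons (negbTE nPi).
Qed.

Lemma geob_shift u : geob u -> geob (fun d => u d.+1).
Proof.
move=> [K [r [/andP[r0 r1] hu]]]; exists (K * r), r; split; first by rewrite r0.
by move=> d; rewrite -mulrA -exprS.
Qed.

Lemma S_scale c u : geob u -> S (fun d => c * u d) = c * S u.
Proof. by move=> /geob_cvg h; exact: (lim_seriesZ c h). Qed.

Lemma S_add u v : geob u -> geob v -> S (fun d => u d + v d) = S u + S v.
Proof. by move=> /geob_cvg h /geob_cvg h'; exact: (lim_seriesD h h'). Qed.

Lemma S_zero : S (fun _ => 0 : C) = 0.
Proof.
have -> : series (fun _ => 0 : C) = cst 0.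
  by apply/funext => n; rewrite /series /= big1.
apply: limC; exact: cvg_cst.
Qed.

Lemma S_sum (I : Type) (s : seq I) (P : pred I) (u : I -> nat -> C) :
  (forall i, P i -> geob (u i)) ->
  S (fun d => \sum_(i <- s | P i) u i d) = \sum_(i <- s | P i) S (u i).
Proof.
move=> h; elim: s => [|i s IH].
  by rewrite big_nil; under eq_fun do rewrite big_nil; exact: S_zero.
rewrite big_cons; under eq_fun do rewrite big_cons.
have hs := geob_sum s h.
by case: (boolP (P i)) => Pi; rewrite ?S_add ?IH //; exact: h.
Qed.

Lemma S_shift u : geob u -> S u = u 0%N + S (fun d => u d.+1).
Proof.
move=> hu; have /geob_cvg h1 := geob_shift hu.
suff h : series u n @[n --> \oo] --> u 0%N + S (fun d => u d.+1).
  exact: limC h.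
rewrite -(cvg_shiftS (series u)).
have -> : (fun n => series u n.+1) = (fun n => u 0%N + series (fun d => u d.+1) n).
  by apply/funext => n; rewrite /series /= big_nat_recl.
by apply: cvgD; [exact: cvg_cst|exact: h1].
Qed.

(** Coefficients of an entire power series. *)
Definition entire (v : nat -> C) :=
  forall rho : R, 0 < rho -> exists K, forall d, nm (v d) <= K * rho ^+ d.

Lemma entire_geob v x : entire v -> geob (fun d => v d * x ^+ d).
Proof.
move=> hv; have a0 : 0 < nm x + 1 by have := nm_ge0 x; lra.
have a2 : 0 < (nm x + 1)^-1 / 2 by rewrite divr_gt0 ?invr_gt0.
have [K hK] := hv _ a2.
exists K, 2^-1; split; first by lra.
move=> d; have K0 := geob_K0 hK.
rewrite nmM nmX; apply: (le_trans (ler_wpM2r (exprn_ge0 _ (nm_ge0 _)) (hK d))).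
rewrite -mulrA; apply: ler_wpM2l => //; rewrite -exprMn.
apply: lerXn2r; rewrite ?nnegrE ?mulr_ge0 ?invr_ge0 ?nm_ge0 ?(ltW a0) //.
rewrite mulrAC -[leRHS]mul1r; apply: ler_wpM2r; first by lra.
by rewrite mulrC ler_pdivrMr // mul1r; lra.
Qed.

Lemma natX2 d : (d%:R : R) <= 2 ^+ d.
Proof. by rewrite -natrX ler_nat ltnW // ltn_expl. Qed.

Lemma entire_nat v : entire v -> entire (fun d => d%:R * v d).
Proof.
move=> hv rho r0; have r2 : 0 < rho / 2 by rewrite divr_gt0.
have [K hK] := hv _ r2.
exists K => d; rewrite nmM nm_nat.
apply: (le_trans (ler_wpM2l (ler0n _ _) (hK d))).
rewrite expr_div_n mulrCA; apply: ler_wpM2l; first exact: geob_K0 hK.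
by rewrite mulrCA ler_piMr ?exprn_ge0 ?(ltW r0) // ler_pdivrMr ?exprn_gt0 // mul1r natX2.
Qed.

Lemma entire_ratio v : (forall rho, 0 < rho -> exists n0, forall d, (n0 <= d)%N ->
   nm (v d.+1) <= rho * nm (v d)) -> entire v.
Proof.
move=> h rho r0; have [n0 hn] := h _ r0.
by apply: (@ratio_ev (fun d => nm (v d)) rho n0) => // d; exact: nm_ge0.
Qed.

Lemma nearC (x : C) (e : R) : 0 < e -> \forall y \near x, nm (y - x) < e.
Proof. by move=> e0; have /cvgCP := @cvg_id _ (nbhs x); apply. Qed.

Lemma nearCP (x : C) (P : C -> Prop) : (\forall y \near x, P y) <->
  exists2 e : R, 0 < e & forall y, nm (y - x) < e -> P y.
Proof.
split; last by move=> [e e0 h]; apply: filterS (nearC x e0) => y; exact: h.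
move=> /nbhs_ballP[e /= e0 h].
have er : e = rc (reC e).
  by case: e e0 {h} => a b; rewrite ltcE /= => /andP[/eqP -> _].
exists (reC e); first by rewrite -rc_lt -er.
by move=> y hy; apply: h; rewrite /ball /= nmE er rc_lt nmBC.
Qed.

(** Complex differentiability as a first order expansion, which composes more
    easily than a limit of difference quotients. *)
Definition hasd (f : C -> C) (x l : C) : Prop :=
  forall e : R, 0 < e -> \forall y \near x,
    nm (f y - f x - l * (y - x)) <= e * nm (y - x).

Lemma hasd_slope (f g : C -> C) (x l : C) :
  (\forall y \near x, f y - f x = (y - x) * g y) -> g y @[y --> x] --> l ->
  hasd f x l.
Proof.
move=> h /cvgCP hg e e0; near=> y.
have -> : f y - f x = (y - x) * g y by near: y.
rewrite [l * _]mulrC -mulrBr nmM mulrC; apply: ler_wpM2r; first exact: nm_ge0.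
by apply: ltW; near: y; exact: hg.
Unshelve. all: by end_near. Qed.

Lemma hasd_is_derive f x l : hasd f x l -> is_derive x 1 f l.
Proof.
move=> h.
have hc : h^-1 *: ((f \o shift x) (h *: 1) - f x) @[h --> 0^'] --> l.
  apply/cvgCP => e e0; have e2 : 0 < e / 2 by rewrite divr_gt0.
  have /nearCP[d d0 hd] := h _ e2.
  apply/nearCP; exists d => // k; rewrite subr0 => hk k0 /=.
  have k0' : 0 < nm k by rewrite nm_gt0.
  have ek : k *: (1 : C) + x = k + x by rewrite -[k in RHS]mulr1.
  have := hd (k + x); rewrite addrK => /(_ hk) hh.
  rewrite -(ltr_pM2r k0') -nmM ek.
  have -> : (k^-1 *: (f (k + x) - f x) - l) * k = f (k + x) - f x - l * k.
    by rewrite mulrBl -[k^-1 *: _]/(k^-1 * _) [_ * k]mulrAC mulVf // mul1r.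
  by apply: (le_lt_trans hh); rewrite ltr_pM2r //; lra.
split; first by apply/cvg_ex; exists l.
exact: limC hc.
Qed.

Lemma hasd_cont f x l : hasd f x l -> f y @[y --> x] --> f x.
Proof.
move=> h; apply/(@cvgCP _ _ (nbhs x)) => e e0.
have b0 : 0 < 1 + nm l by have := nm_ge0 l; lra.
have ed : 0 < e / (1 + nm l) by rewrite divr_gt0.
near=> y.
have h1 : nm (f y - f x - l * (y - x)) <= 1 * nm (y - x) by near: y; exact: h.
have h2 : nm (y - x) < e / (1 + nm l) by near: y; exact: nearC.
rewrite -(subrK (l * (y - x)) (f y - f x)); apply: (le_lt_trans (nmD _ _)).
rewrite nmM; apply: (le_lt_trans (lerD h1 (lexx _))).
by rewrite -mulrDl mulrC -ltr_pdivlMr.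
Unshelve. all: by end_near. Qed.

Lemma hasd_comp f g x l m : hasd f x l -> hasd g (f x) m ->
  hasd (g \o f) x (m * l).
Proof.
move=> hf hg e e0.
have a0 : 0 < 1 + nm l by have := nm_ge0 l; lra.
have m0 : 0 < 1 + nm m by have := nm_ge0 m; lra.
have e1 : 0 < e / 2 / (1 + nm l) by rewrite !divr_gt0.
have e2 : 0 < e / 2 / (1 + nm m) by rewrite !divr_gt0.
have hfc := hasd_cont hf.
near=> y; rewrite /=.
have h1 : nm (g (f y) - g (f x) - m * (f y - f x)) <=
    e / 2 / (1 + nm l) * nm (f y - f x).
  by near: y; exact: hfc (hg _ e1).
have h2 : nm (f y - f x - l * (y - x)) <= 1 * nm (y - x) by near: y; exact: hf.
have h3 : nm (f y - f x - l * (y - x)) <= e / 2 / (1 + nm m) * nm (y - x).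
  by near: y; exact: hf.
have h4 : nm (f y - f x) <= (1 + nm l) * nm (y - x).
  rewrite -(subrK (l * (y - x)) (f y - f x)); apply: (le_trans (nmD _ _)).
  by rewrite nmM mulrDl; apply: lerD.
have -> : g (f y) - g (f x) - m * l * (y - x) =
  (g (f y) - g (f x) - m * (f y - f x)) + m * (f y - f x - l * (y - x)) by ring.
apply: (le_trans (nmD _ _)); rewrite (splitr e) mulrDl; apply: lerD.
  apply: (le_trans h1); rewrite -[X in _ <= X * _](divfK (_ : 1 + nm l != 0)) ?gt_eqF //.
  by rewrite -[X in _ <= X]mulrA; apply: ler_wpM2l => //; exact: ltW.
rewrite nmM; apply: (le_trans (ler_wpM2l (nm_ge0 _) h3)).
rewrite mulrA; apply: ler_wpM2r; first exact: nm_ge0.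
by rewrite mulrCA ler_piMr ?ler_pdivrMr // ?mul1r; lra.
Unshelve. all: by end_near. Qed.

Lemma hasd_add f g x l m : hasd f x l -> hasd g x m ->
  hasd (fun y => f y + g y) x (l + m).
Proof.
move=> hf hg e e0; have e2 : 0 < e / 2 by rewrite divr_gt0.
near=> y.
have -> : f y + g y - (f x + g x) - (l + m) * (y - x) =
  (f y - f x - l * (y - x)) + (g y - g x - m * (y - x)) by ring.
apply: (le_trans (nmD _ _)); rewrite (splitr e) mulrDl.
by apply: lerD; near: y; [exact: hf|exact: hg].
Unshelve. all: by end_near. Qed.

Lemma hasd_inv (x : C) : x != 0 -> hasd (fun y => y^-1) x (- x ^- 2).
Proof.
move=> x0; have hne : \forall y \near x, y != 0.
  have e0 : 0 < nm x by rewrite nm_gt0.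
  apply: filterS (nearC x e0) => y; apply: contraTneq => ->.
  by rewrite sub0r nmN ltxx.
apply: (@hasd_slope _ (fun y => - (y^-1 * x^-1))).
  by apply: filterS hne => y y0; field; rewrite x0.
rewrite -exprVn expr2; apply: (@cvgNC R C (nbhs x)).
by apply: (@cvgMrC R C (nbhs x)); apply: (@cvgVC R C (nbhs x) _ _ _ x0); exact: cvg_id.
Qed.

(** The difference quotient of [y ^+ d] is the polynomial [D d y], which tends to
    [d x^(d-1)] and is at most [d rho^(d-1)] on a disc; Tannery's theorem then
    differentiates the series term by term. *)
Lemma hasd_pseries v x : entire v ->
  hasd (fun y => S (fun d => v d * y ^+ d)) x
       (S (fun d => v d * (d%:R * x ^+ d.-1))).
Proof.
move=> hv.
pose D d (y : C) := \sum_(i < d) y ^+ (d.-1 - i) * x ^+ i.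
have subD d y : y ^+ d - x ^+ d = (y - x) * D d y by exact: subrXX.
apply: (@hasd_slope _ (fun y => S (fun d => v d * D d y))).
  apply: filterS (nearC x ltr01) => y _.
  have gy := entire_geob y hv; have gx := entire_geob x hv.
  have gN := geob_scale (- 1) gx.
  have gb : geob (fun d => v d * y ^+ d + - 1 * (v d * x ^+ d)) := geob_add gy gN.
  have -> : S (fun d => v d * y ^+ d) - S (fun d => v d * x ^+ d) =
      S (fun d => v d * y ^+ d + - 1 * (v d * x ^+ d)).
    by rewrite (S_add gy gN) (S_scale (- 1) gx) mulN1r.
  have e : (fun d => v d * y ^+ d + - 1 * (v d * x ^+ d)) =
           (fun d => (y - x) * (v d * D d y)).
    by apply/funext => d; rewrite mulN1r -mulrBr subD mulrCA.
  rewrite e; have [->|nxy] := eqVneq y x.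
    rewrite subrr mul0r (_ : (fun d => _) = (fun d => 0)) ?S_zero //.
    by apply/funext => d; rewrite mul0r.
  rewrite S_scale //.
  have yx0 : y - x != 0 by rewrite subr_eq0.
  have gb' : geob (fun d => (y - x) * (v d * D d y)) by rewrite -e.
  apply: (geob_le (geob_scale (y - x)^-1 gb')) => d.
  by rewrite mulKf.
pose rho := nm x + 1.
have r0 : 0 < rho by have := nm_ge0 x; rewrite /rho; lra.
(* The factor 4 leaves room for d <= 2^d and for a ratio 1/2. *)
have r4 : 0 < (rho * 4)^-1 by rewrite invr_gt0; lra.
have [K hK] := hv _ r4; have K0 := geob_K0 hK.
apply: (@tannery _ _ (nbhs x) _ _ _ (K / rho) (2^-1)) => //.
- by lra.
- move=> d; apply: (@cvgMlC R C (nbhs x)).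
  have -> : d%:R * x ^+ d.-1 = \sum_(i < d) x ^+ (d.-1 - i) * x ^+ i.
    rewrite (eq_bigr (fun _ => x ^+ d.-1)) ?sumr_const ?card_ord ?mulr_natl //.
    by move=> i _; rewrite -exprD subnK // -ltnS prednK //; case: d i => // -[].
  apply: (@cvg_sumC R C _ (nbhs x)) => i _; apply: (@cvgMrC R C (nbhs x)).
  by apply: (@cvg_exprC R C (nbhs x)); exact: cvg_id.
- near=> y => d.
  have hy : nm y <= rho.
    have h : nm (y - x) < 1 by near: y; exact: nearC.
    rewrite -(subrK x y); apply: (le_trans (nmD _ _)); rewrite /rho; lra.
  have hx : nm x <= rho by rewrite /rho; lra.
  have hD : nm (D d y) <= d%:R * rho ^+ d / rho.
    apply: (le_trans (nm_sum _ _ _)).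
    apply: (@le_trans _ _ (\sum_(i < d) rho ^+ d / rho)).
      apply: ler_sum => i _; rewrite nmM !nmX.
      have -> : rho ^+ d / rho = rho ^+ (d.-1 - i) * rho ^+ i.
        rewrite -exprD subnK; last by rewrite -ltnS prednK //; case: d i => // -[].
        case: d i => [[]//|d _] /=; by rewrite exprSr mulfK // gt_eqF.
      by apply: ler_pM; rewrite ?exprn_ge0 ?nm_ge0 //; apply: lerXn2r; rewrite ?nnegrE ?nm_ge0 // ltW.
    by rewrite sumr_const card_ord -[leRHS]mulrA mulr_natl.
  rewrite nmM; apply: (le_trans (ler_pM (nm_ge0 _) (nm_ge0 _) (hK d) hD)).
  have -> : K * (rho * 4)^-1 ^+ d * (d%:R * rho ^+ d / rho) =
      (K / rho) * (d%:R / 4 ^+ d).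
    rewrite invfM exprMn !exprVn; field.
    by rewrite !expf_neq0 ?gt_eqF.
  apply: ler_wpM2l; first by rewrite divr_ge0 // ltW.
  rewrite ler_pdivrMr ?exprn_gt0 // -exprMn.
  have -> : (2^-1 * 4 : R) = 2 by lra.
  exact: natX2.
Unshelve. all: by end_near. Qed.

End PowerSeries.

(** * The theta function *)

Lemma bin2S d : 'C(d.+1, 2) = ('C(d, 2) + d)%N.
Proof. by rewrite binS bin1. Qed.

Lemma bin2D i j : 'C(i + j, 2) = ('C(i, 2) + 'C(j, 2) + i * j)%N.
Proof.
elim: j => [|j IH]; first by rewrite addn0 muln0 !addn0.
by rewrite addnS !bin2S IH mulnS; lia.
Qed.

Lemma bin2sq j : ('C(j.+1, 2) + 'C(j, 2) = j * j)%N.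
Proof. by elim: j => // j IH; rewrite bin2S; move: IH; rewrite bin2S; nia. Qed.

Section Theta.
Variable R : realType.
Local Notation C := (Cplx R).
Local Notation S u := (limn (series u)).
Variable q : C.
Hypotheses (q0 : q != 0) (q1 : nm q < 1).

Let r0 : 0 <= nm q. Proof. exact: nm_ge0. Qed.

(** Coefficients of the part of nonnegative degree of theta; [thb] holds those of
    negative degree, as a power series in [Q^-1] without constant term. *)
Definition tha (d : nat) : C := q ^+ 'C(d, 2).
Definition thb (d : nat) : C := if d is d'.+1 then q ^+ 'C(d'.+2, 2) else 0.

Lemma small_pow (rho : R) : 0 < rho -> exists n0, forall d, (n0 <= d)%N -> nm (q ^+ d) <= rho.
Proof.
move=> h.
have : nm q ^+ n @[n --> \oo] --> 0 by apply: cvg_expr; rewrite ger0_norm.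
move=> /cvgrPdist_le /(_ _ h) [n0 _ hn]; exists n0 => d hd.
have := hn d hd; rewrite sub0r normrN nmX ger0_norm // exprn_ge0 //.
Qed.

Lemma entire_tha : entire tha.
Proof.
apply: entire_ratio => rho /small_pow [n0 hn]; exists n0 => d hd.
rewrite /tha bin2S exprD nmM mulrC; apply: ler_wpM2r; first exact: nm_ge0.
exact: hn.
Qed.

Lemma entire_thb : entire thb.
Proof.
apply: entire_ratio => rho /small_pow [n0 hn]; exists n0.+1 => -[//|d] hd.
rewrite /thb bin2S exprD nmM mulrC; apply: ler_wpM2r; first exact: nm_ge0.
by apply: hn; lia.
Qed.

Lemma thetaE Q : theta q Q = S (fun d => tha d * Q ^+ d) + S (fun d => thb d * Q^-1 ^+ d).
Proof.
rewrite /theta; congr (_ + _).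
rewrite [RHS]S_shift; last exact: entire_geob entire_thb.
by rewrite mul0r add0r; under [in RHS]eq_fun do rewrite exprVn.
Qed.

(** The value of [Q theta'(Q)]. *)
Definition thd (Q : C) : C := S (fun d => d%:R * tha d * Q ^+ d) - S (fun d => d%:R * thb d * Q^-1 ^+ d).

Lemma weight_pred (v : nat -> C) x : entire v ->
  x * S (fun d => v d * (d%:R * x ^+ d.-1)) = S (fun d => d%:R * v d * x ^+ d).
Proof.
move=> hv; have e d : d%:R * v d * x ^+ d = x * (v d * (d%:R * x ^+ d.-1)).
  by case: d => [|d]; rewrite ?mul0r ?mulr0 // exprS; ring.
have g := entire_geob x (entire_nat hv).
under [in RHS]eq_fun do rewrite e.
have [->|x0] := eqVneq x 0.
  by rewrite mul0r; under eq_fun do rewrite mul0r; rewrite S_zero.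
rewrite S_scale //; apply: (geob_le (geob_scale x^-1 g)) => d.
by rewrite e mulKf.
Qed.

Lemma hasd_theta Q : Q != 0 -> hasd (theta q) Q (Q^-1 * thd Q).
Proof.
move=> Q0.
have ha := hasd_pseries Q entire_tha.
have hb := hasd_comp (hasd_inv Q0) (hasd_pseries Q^-1 entire_thb).
have e : theta q = fun Q => S (fun d => tha d * Q ^+ d) + S (fun d => thb d * Q^-1 ^+ d).
  by apply/funext => y; exact: thetaE.
have := hasd_add ha hb; rewrite e; congr hasd.
rewrite /thd -(weight_pred Q entire_tha) -(weight_pred Q^-1 entire_thb).
have key (A B : C) : A + B * (- Q ^- 2) = Q^-1 * (Q * A - Q^-1 * B) by field.
exact: key.
Qed.

Lemma derive_theta Q : Q != 0 -> derive1 (theta q) Q = Q^-1 * thd Q.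
Proof.
by move=> Q0; have h := hasd_is_derive (hasd_theta Q0); rewrite derive1E derive_val.
Qed.

Lemma ellqE Q : Q != 0 -> ellq q Q = - thd Q / theta q Q.
Proof. by move=> Q0; rewrite /ellq derive_theta // mulNr mulVKf // mulNr. Qed.

(** Multiplying by [Q] shifts both halves of the bilateral series by one; the
    constant terms that appear cancel. *)
Lemma theta_q Q : Q != 0 -> theta q (q * Q) = Q^-1 * theta q Q.
Proof.
move=> Q0; apply: (mulfI Q0); rewrite mulVKf //.
have qQ0 : q * Q != 0 by rewrite mulf_neq0.
have g1 := entire_geob (q * Q) entire_tha.
have g2 := entire_geob Q entire_tha.
have g3 : geob (fun d => q ^+ 'C(d.+2, 2) * (q * Q) ^- d.+1).
  have := geob_shift (entire_geob (q * Q)^-1 entire_thb).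
  by under eq_fun do rewrite exprVn.
have g4 : geob (fun d => q ^+ 'C(d.+2, 2) * Q ^- d.+1).
  have := geob_shift (entire_geob Q^-1 entire_thb).
  by under eq_fun do rewrite exprVn.
have g5 : geob (fun d => q ^+ 'C(d.+1, 2) * Q ^- d).
  apply: (geob_le (geob_scale Q g3)) => d.
  rewrite (bin2S d.+1) exprD exprMn invfM [Q ^+ d.+1]exprS invfM.
  have -> : Q * (q ^+ 'C(d.+1, 2) * q ^+ d.+1 * (q ^- d.+1 * (Q^-1 * Q ^- d)))
     = q ^+ 'C(d.+1, 2) * Q ^- d.
    by field; rewrite ?Q0 ?expf_neq0 ?q0.
  exact: lexx.
rewrite /theta mulrDr -!S_scale //.
have -> : (fun d => Q * (q ^+ 'C(d, 2) * (q * Q) ^+ d)) = (fun d => q ^+ 'C(d.+1, 2) * Q ^+ d.+1).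
  by apply/funext => d; rewrite bin2S exprD exprMn exprS; ring.
have -> : (fun d => Q * (q ^+ 'C(d.+2, 2) * (q * Q) ^- d.+1)) = (fun d => q ^+ 'C(d.+1, 2) * Q ^- d).
  apply/funext => d; rewrite (bin2S d.+1) exprD exprMn invfM [Q ^+ d.+1]exprS invfM.
  by field; rewrite ?Q0 ?expf_neq0 ?q0.
rewrite (S_shift g5) [in RHS](S_shift g2) /tha.
by rewrite !expr0 invr1 mulr1; ring.
Qed.

Lemma theta_qn Q n : Q != 0 -> theta q Q != 0 -> theta q (q ^+ n * Q) != 0.
Proof.
move=> Q0 h; elim: n => [|n IH]; first by rewrite expr0 mul1r.
rewrite exprS -mulrA theta_q; last by rewrite mulf_neq0 // expf_neq0.
by rewrite mulf_neq0 // invr_neq0 // mulf_neq0 // expf_neq0.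
Qed.

(** Logarithmic derivative of [theta_q]. *)
Lemma ellq_q Q : Q != 0 -> theta q Q != 0 -> ellq q (q * Q) = ellq q Q + 1.
Proof.
move=> Q0 t0; have qQ0 : q * Q != 0 by rewrite mulf_neq0.
have h1 := hasd_theta Q0.
have h2 : hasd (fun y => q * y) Q q.
  move=> e e0; apply: filterS (nearC Q ltr01) => y _.
  by rewrite -mulrBr subrr nm0 mulr_ge0 ?nm_ge0 // ltW.
have h3 := hasd_is_derive (hasd_comp h2 (hasd_theta qQ0)).
have h4 := hasd_is_derive (hasd_inv Q0).
have h5 := hasd_is_derive h1.
have h6 := is_deriveM h4 h5.
have e : \forall y \near Q, ((fun y => y^-1) * theta q) y = (theta q \o (fun y => q * y)) y.
  have nQ0 : 0 < nm Q by rewrite nm_gt0.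
  apply: filterS (nearC Q nQ0) => y hy; rewrite /= theta_q //.
  by apply: contraTneq hy => ->; rewrite sub0r nmN ltxx.
have h7 := near_eq_is_derive e h6.
have : ((q * Q)^-1 * thd (q * Q)) * q = Q^-1 *: (Q^-1 * thd Q) + theta q Q *: - Q ^- 2.
  by rewrite -(derive_val (is_derive := h7)) -(derive_val (is_derive := h3)).
rewrite -[Q^-1 *: _]/(Q^-1 * _) -[theta q Q *: _]/(theta q Q * _) => hh.
have hd : thd (q * Q) = Q^-1 * (thd Q - theta q Q).
  have -> : thd (q * Q) = Q * ((q * Q)^-1 * thd (q * Q) * q).
    by field; rewrite q0 Q0.
  by rewrite hh; field.
rewrite !ellqE // hd theta_q //; field; by rewrite t0 Q0.
Qed.

End Theta.

(** * The triple product and the partial fractions of the q-logarithm *)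

Section Products.
Variable R : realType.
Local Notation C := (Cplx R).

Lemma prod_ge (a : nat -> C) (n0 k : nat) : 
  (forall i, nm (a (n0 + i)%N) <= 1) ->
  1 - \sum_(i < k) nm (a (n0 + i)%N) <= \prod_(i < k) nm (1 + a (n0 + i)%N).
Proof.
move=> h; elim: k => [|k IH]; first by rewrite !big_ord0 subr0.
rewrite !big_ord_recr /=.
have h1 : 1 - nm (a (n0 + k)%N) <= nm (1 + a (n0 + k)%N).
  by have := nmDB 1 (a (n0 + k)%N); rewrite nm1.
have h2 := h k; have h3 := nm_ge0 (a (n0 + k)%N).
have s0 : 0 <= \sum_(i < k) nm (a (n0 + i)%N) by apply: sumr_ge0 => i _; exact: nm_ge0.
have p0 : 0 <= \prod_(i < k) nm (1 + a (n0 + i)%N) by apply: prodr_ge0 => i _; exact: nm_ge0.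
have h4 : (\prod_(i < k) nm (1 + a (n0 + i)%N)) * (1 - nm (a (n0 + k)%N)) <=
  \prod_(i < k) nm (1 + a (n0 + i)%N) * nm (1 + a (n0 + k)%N).
  exact: ler_wpM2l.
have h5 : (1 - \sum_(i < k) nm (a (n0 + i)%N)) * (1 - nm (a (n0 + k)%N)) <=
  (\prod_(i < k) nm (1 + a (n0 + i)%N)) * (1 - nm (a (n0 + k)%N)).
  by apply: ler_wpM2r => //; lra.
apply: le_trans h4; apply: le_trans h5.
by rewrite mulrBl mul1r mulrBr mulr1; have := mulr_ge0 s0 h3; lra.
Qed.

(** A tail product is at least one minus the sum of its [nm (a i)], hence at
    least 1/2 once the geometric tail is at most 1/2; the finitely many remaining
    factors do not vanish. *)
Lemma prod_lb (a : nat -> C) (K r : R) : 0 <= r < 1 ->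
  (forall i, nm (a i) <= K * r ^+ i) -> (forall i, 1 + a i != 0) ->
  exists2 del, 0 < del &
    \forall n \near \oo, del <= nm (\prod_(i < n) (1 + a i)).
Proof.
move=> hr ha hne; have K0 := geob_K0 ha.
have h2 : 0 < 2^-1 :> R by rewrite invr_gt0.
have /cvgrPdist_le /(_ _ h2) [n0 _ hn0] := geo_lim0 K hr.
have {}hn0 := hn0 n0 (leqnn n0); rewrite sub0r normrN in hn0.
have {hn0} hn0 := le_trans (ler_norm _) hn0.
have hs k : \sum_(i < k) nm (a (n0 + i)%N) <= 2^-1.
  apply: le_trans hn0; apply: le_trans (geo_sum_le n0 (n0 + k) K0 hr).
  have -> : \sum_(n0 <= i < n0 + k) K * r ^+ i = \sum_(i < k) K * r ^+ (n0 + i).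
    rewrite -{1}[n0]add0n big_addn addKn big_mkord.
    by apply: eq_bigr => i _; rewrite addnC.
  exact: ler_sum.
have h1 i : nm (a (n0 + i)%N) <= 1.
  have := hs i.+1; rewrite big_ord_recr /=.
  have : 0 <= \sum_(j < i) nm (a (n0 + j)%N) by apply: sumr_ge0 => j _; exact: nm_ge0.
  by lra.
exists (nm (\prod_(i < n0) (1 + a i)) / 2).
  by rewrite divr_gt0 // nm_gt0; apply/prodf_neq0 => i _.
exists n0 => // n /= hn.
have -> : \prod_(i < n) (1 + a i) = (\prod_(i < n0) (1 + a i)) *
    \prod_(i < n - n0) (1 + a (n0 + i)%N).
  rewrite -(big_mkord xpredT (fun i => 1 + a i)) (big_cat_nat (n := n0)) //= big_mkord.
  congr (_ * _); rewrite -{1}[n0]add0n big_addn big_mkord.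
  by apply: eq_bigr => i _; rewrite addnC.
rewrite nmM; apply: ler_wpM2l; first exact: nm_ge0.
rewrite nm_prod; apply: le_trans (prod_ge _ h1).
by have := hs (n - n0)%N; lra.
Qed.

End Products.

Section Centre.
Variable R : realType.
Local Notation C := (Cplx R).

(** Degree [k] of [qbpoly (2m)] evaluated at [Q / q^m] carries the power
    [Q^(k-m)]: the index is split around [m]. *)
Lemma sum_centre m (F : nat -> C) :
  \sum_(k < m.*2.+1) F k = \sum_(j < m.+1) F (m + j)%N + \sum_(j < m) F (m - j.+1)%N.
Proof.
rewrite -(big_mkord xpredT F) (big_cat_nat (n := m)) //=; last lia.
rewrite addrC; congr (_ + _).
  rewrite -{1}[m]add0n big_addn; have -> : (m.*2.+1 - m = m.+1)%N by lia.
  by rewrite big_mkord; apply: eq_bigr => i _; rewrite addnC.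
rewrite big_nat_rev big_mkord; apply: eq_bigr => i _.
by rewrite add0n.
Qed.

Lemma double_split m (F : nat -> C) :
  \sum_(j < m.*2) F j = \sum_(n < m) F (m + n)%N + \sum_(n < m) F (m - n.+1)%N.
Proof.
rewrite -(big_mkord xpredT F) (big_cat_nat (n := m)) //=; last lia.
rewrite addrC; congr (_ + _).
  rewrite -{1}[m]add0n big_addn; have -> : (m.*2 - m = m)%N by lia.
  by rewrite big_mkord; apply: eq_bigr => i _; rewrite addnC.
rewrite big_nat_rev big_mkord; apply: eq_bigr => i _.
by rewrite add0n.
Qed.

Lemma double_splitP m (F : nat -> C) :
  \prod_(j < m.*2) F j = (\prod_(n < m) F (m + n)%N) * (\prod_(n < m) F (m - n.+1)%N).
Proof.
rewrite -(big_mkord xpredT F) (big_cat_nat (n := m)) //=; last lia.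
rewrite mulrC; congr (_ * _).
  rewrite -{1}[m]add0n big_addn; have -> : (m.*2 - m = m)%N by lia.
  by rewrite big_mkord; apply: eq_bigr => i _; rewrite addnC.
rewrite big_nat_rev big_mkord; apply: eq_bigr => i _.
by rewrite add0n.
Qed.

End Centre.

Section Jacobi.
Variable R : realType.
Local Notation C := (Cplx R).
Local Notation S u := (limn (series u)).
Variable q : C.
Hypotheses (q0 : q != 0) (q1 : nm q < 1).

Let r0 : 0 <= nm q. Proof. exact: nm_ge0. Qed.

Lemma oneBq_neq0 i : 1 - q ^+ i.+1 != 0.
Proof.
rewrite subr_eq0; apply: contraTneq isT => h.
have : nm (q ^+ i.+1) < 1 by rewrite nmX exprn_ilt1.
by rewrite -h nm1 ltxx.
Qed.

Lemma oneBq_le i : nm (1 - q ^+ i.+1) <= 2.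
Proof.
apply: (le_trans (nmB _ _)); rewrite nm1 nmX.
have : nm q ^+ i.+1 <= 1 by rewrite exprn_ile1 // ltW.
by lra.
Qed.

Lemma oneBq_ge i : 1 - nm q <= nm (1 - q ^+ i.+1).
Proof.
have := nmDB 1 (- q ^+ i.+1); rewrite nm1 nmN nmX.
have : nm q ^+ i.+1 <= nm q by rewrite exprS ler_piMr // exprn_ile1 // ltW.
by lra.
Qed.

(** [(q; q)_n]. *)
Definition qfac (n : nat) : C := \prod_(i < n) (1 - q ^+ i.+1).

Lemma qfacS n : qfac n.+1 = qfac n * (1 - q ^+ n.+1).
Proof. by rewrite /qfac big_ord_recr. Qed.

Lemma qfac_neq0 n : qfac n != 0.
Proof. by apply/prodf_neq0 => i _; exact: oneBq_neq0. Qed.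

Lemma qfac_up a j : nm (qfac (a + j)) <= 2 ^+ j * nm (qfac a).
Proof.
elim: j => [|j IH]; first by rewrite addn0 mul1r.
rewrite addnS qfacS nmM [leLHS]mulrC [2 ^+ j.+1]exprS -mulrA.
by apply: ler_pM; rewrite ?nm_ge0 // oneBq_le.
Qed.

Lemma qfac_down a j : (1 - nm q) ^+ j * nm (qfac a) <= nm (qfac (a + j)).
Proof.
elim: j => [|j IH]; first by rewrite addn0 mul1r.
rewrite addnS qfacS nmM [leRHS]mulrC [(1 - nm q) ^+ j.+1]exprS -mulrA.
have h : 0 <= 1 - nm q by rewrite subr_ge0 ltW.
by apply: ler_pM; rewrite ?oneBq_ge // mulr_ge0 ?exprn_ge0 ?nm_ge0.
Qed.

(** The Gaussian binomial coefficient. *)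
Definition qbin (n k : nat) : C :=
  if (k <= n)%N then qfac n / (qfac k * qfac (n - k)) else 0.

Lemma qbinS n k : qbin n.+1 k.+1 = qbin n k.+1 + q ^+ (n - k) * qbin n k.
Proof.
rewrite /qbin ltnS subSS; case: (ltngtP k n) => [kn|nk|->].
- rewrite -(subnSK kn) [qfac (n - k.+1).+1]qfacS !qfacS.
  have -> : q ^+ n.+1 = q ^+ (n - k.+1).+1 * q ^+ k.+1.
    by rewrite -exprD; congr (_ ^+ _); lia.
  field; have := oneBq_neq0; have := qfac_neq0 => h h'.
  by rewrite !h !h'.
- by rewrite mulr0 addr0.
- by rewrite subnn expr0 mul1r add0r /qfac big_ord0 !mulr1 !divff ?qfac_neq0.
Qed.

Lemma qbin0 n : qbin n 0 = 1.
Proof. by rewrite /qbin leq0n subn0 /qfac big_ord0 mul1r divff ?qfac_neq0. Qed.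

Definition qbpoly (n : nat) : {poly C} := \poly_(k < n.+1) (q ^+ 'C(k, 2) * qbin n k).

(** The finite q-binomial theorem, by the q-Pascal rule. *)
Lemma qbpoly_prod n : qbpoly n = \prod_(j < n) (1 + q ^+ j *: 'X).
Proof.
elim: n => [|n IH].
  rewrite big_ord0; apply/polyP => -[|k]; rewrite coef_poly coef1 //=.
  by rewrite qbin0 mulr1.
rewrite big_ord_recr -IH /=; apply/polyP => k.
rewrite mulrDr mulr1 -scalerAr coefD coefZ coefMX !coef_poly.
case: k => [|k]; first by rewrite /= !qbin0 mulr0 addr0.
rewrite /= !ltnS qbinS [qbin n k.+1]/qbin.
case: (ltngtP k n) => kn.
- rewrite bin2S exprD mulrDr; congr (_ + _).
  rewrite -(subnK (ltnW kn)) addnK [q ^+ (n - k + k)]exprD; ring.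
- by rewrite mulr0 addr0.
- by rewrite kn subnn expr0 mul1r !add0r bin2S exprD; ring.
Qed.

Lemma qbpoly_horner n x : (qbpoly n).[x] = \prod_(j < n) (1 + q ^+ j * x).
Proof.
rewrite qbpoly_prod horner_prod; apply: eq_bigr => j _.
by rewrite hornerD hornerZ hornerX -polyC1 hornerC.
Qed.

Lemma qbpoly_logder n x : (forall j, (j < n)%N -> 1 + q ^+ j * x != 0) ->
  (qbpoly n)^`().[x] = (qbpoly n).[x] * \sum_(j < n) q ^+ j / (1 + q ^+ j * x).
Proof.
rewrite qbpoly_prod; elim: n => [|n IH] h.
  by rewrite !big_ord0 -polyC1 derivC horner0 mulr0.
rewrite !big_ord_recr /= derivM hornerD !hornerM IH; last first.
  by move=> j jn; apply: h; exact: ltnW.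
have hn := h n (ltnSn n).
rewrite derivD derivZ derivX -polyC1 derivC add0r.
rewrite hornerD !hornerZ hornerX !hornerC.
by field.
Qed.

Lemma S_finite (u : nat -> C) n : (forall d, (n <= d)%N -> u d = 0) ->
  S u = \sum_(i < n) u i.
Proof.
move=> h; suff hc : series u m @[m --> \oo] --> \sum_(i < n) u i by exact: limC hc.
apply: (@cvg_near_cst _ _ _ _ _ _) => //.
exists n => // m /= nm; rewrite /series /= (big_cat_nat (n := n)) //=.
rewrite [X in _ + X]big_nat [X in _ + X]big1 ?addr0 ?big_mkord // => i /andP[ni _].
exact: h.
Qed.

(** [qbin (2m) (m + j) / qbin (2m) m], symmetric in [j].  Normalizing by the
    central coefficient makes the limit for [m --> oo] equal to 1, so that the
    infinite product [(q; q)_oo] never appears. *)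
Definition qbin_ratio (m j : nat) : C :=
  if (j <= m)%N then (qfac m * qfac m) / (qfac (m + j) * qfac (m - j)) else 0.

(** A crude bound, exponential in [j]; the Gaussian decay of the theta
    coefficients absorbs it. *)
Lemma qbin_ratio_le m j : nm (qbin_ratio m j) <= (2 / (1 - nm q)) ^+ j.
Proof.
have p : 0 < 1 - nm q by rewrite subr_gt0.
rewrite /qbin_ratio; case: leqP => jm; last first.
  by rewrite nm0 exprn_ge0 // divr_ge0 // ltW.
rewrite nmM nmV !nmM invfM mulrACA expr_div_n.
have u : nm (qfac m) / nm (qfac (m + j)) <= (1 - nm q) ^- j.
  rewrite ler_pdivrMr ?nm_gt0 ?qfac_neq0 // ler_pdivlMl ?exprn_gt0 //.
  exact: qfac_down.
have d : nm (qfac m) / nm (qfac (m - j)) <= 2 ^+ j.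
  rewrite ler_pdivrMr ?nm_gt0 ?qfac_neq0 // -{1}(subnK jm); exact: qfac_up.
by rewrite [leRHS]mulrC; apply: ler_pM => //; rewrite divr_ge0 ?nm_ge0.
Qed.

Lemma cvg_qpow0 : q ^+ m @[m --> \oo] --> (0 : C).
Proof.
apply: (@cvgC_nm _ _ _ _ _ _ (fun m => nm q ^+ m)).
  by apply: nearW => m; rewrite subr0 nmX.
by apply: cvg_expr; rewrite ger0_norm.
Qed.

Lemma cvg_qfac_ratio j : qfac m / qfac (m + j) @[m --> \oo] --> (1 : C).
Proof.
elim: j => [|j IH].
  by under eq_fun do rewrite addn0 divff ?qfac_neq0 //; exact: cvg_cst.
apply: (@cvg_eqC _ _ _ _
  (fun m => qfac m / qfac (m + j) * (1 - q ^+ m * q ^+ j.+1)^-1) _ (1 * (1 - 0 * q ^+ j.+1)^-1)).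
- by move=> m; rewrite addnS qfacS invfM mulrA -addnS exprD.
- by rewrite mul0r subr0 invr1 mulr1.
apply: cvgMC; first exact: IH.
apply: cvgVC; first by rewrite mul0r subr0 oner_neq0.
apply: cvgBC; first exact: cvg_cst.
by apply: cvgMrC; exact: cvg_qpow0.
Qed.

Lemma cvg_qbin_ratio j : qbin_ratio m j @[m --> \oo] --> (1 : C).
Proof.
rewrite -(cvg_shiftn j).
apply: (@cvg_eqC _ _ _ _
  (fun m => (qfac (m + j) / qfac (m + j + j)) * (qfac m / qfac (m + j))^-1) _ (1 * 1^-1)).
- by move=> m; rewrite /qbin_ratio leq_addl addnK; field; rewrite !qfac_neq0.
- by rewrite invr1 mulr1.
apply: cvgMC.
  by have := cvg_qfac_ratio j; rewrite -(cvg_shiftn j).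
by apply: cvgVC; [exact: oner_neq0|exact: cvg_qfac_ratio].
Qed.

Lemma tannery_qbin_ratio v x : entire v ->
  S (fun d => qbin_ratio m d * v d * x ^+ d) @[m --> \oo] --> S (fun d => v d * x ^+ d).
Proof.
move=> hv.
have [K [s [hs hK]]] := entire_geob (rc (2 / (1 - nm q)) * x) hv.
apply: (@tannery _ _ _ _ _ _ K s) => //.
- move=> d; apply: (@cvg_eqC _ _ _ _
    (fun m => qbin_ratio m d * (v d * x ^+ d)) _ (1 * (v d * x ^+ d))).
  + by move=> m; rewrite mulrA.
  + by rewrite mul1r.
  by apply: cvgMrC; exact: cvg_qbin_ratio.
apply: nearW => m d; apply: le_trans (hK d).
rewrite exprMn !nmM !nmX nm_rc -[leLHS]mulrA [leRHS]mulrCA; apply: ler_wpM2r.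
  by rewrite mulr_ge0 ?exprn_ge0 ?nm_ge0.
apply: (le_trans (qbin_ratio_le _ _)).
by rewrite ger0_norm // divr_ge0 // subr_ge0 ltW.
Qed.

Section AtQ.
Variable Q : C.
Hypothesis Q0 : Q != 0.
Hypothesis hP : forall n, 1 + q ^+ n * Q != 0.
Hypothesis hM : forall n, 1 + q ^+ n.+1 / Q != 0.

Let x m : C := Q / q ^+ m.
(** The factor that turns [qbpoly (2m)] at [Q / q^m] into a truncation of
    theta: the central coefficient times the powers of [q] and [Q] that recentre
    the sum. *)
Definition Unorm (m : nat) : C := q ^+ 'C(m, 2) / q ^+ (m * m) * Q ^+ m * qbin m.*2 m.

Lemma qbin_neq0 n k : (k <= n)%N -> qbin n k != 0.
Proof. by move=> kn; rewrite /qbin kn mulf_neq0 ?invr_neq0 ?mulf_neq0 ?qfac_neq0. Qed.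

Lemma leq_double m : (m <= m.*2)%N. Proof. by rewrite -addnn leq_addr. Qed.

Lemma qbin_ratioE m j : (j <= m)%N -> qbin_ratio m j = qbin m.*2 (m + j) / qbin m.*2 m.
Proof.
move=> jm; rewrite /qbin_ratio /qbin jm leq_double.
have -> : (m + j <= m.*2)%N by lia.
have -> : (m.*2 - (m + j) = m - j)%N by lia.
have -> : (m.*2 - m = m)%N by lia.
by field; rewrite !qfac_neq0.
Qed.

Lemma qbin_ratioE' m j : (j <= m)%N -> qbin_ratio m j = qbin m.*2 (m - j) / qbin m.*2 m.
Proof.
move=> jm; rewrite qbin_ratioE //; congr (_ / _); rewrite /qbin.
have -> : (m + j <= m.*2)%N by lia.
have -> : (m - j <= m.*2)%N by lia.
have -> : (m.*2 - (m + j) = m - j)%N by lia.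
have -> : (m.*2 - (m - j) = m + j)%N by lia.
by rewrite [qfac (m + j) * _]mulrC.
Qed.

Lemma qbin_term_ge m j : (j <= m)%N ->
  q ^+ 'C(m + j, 2) * qbin m.*2 (m + j) * x m ^+ (m + j) / Unorm m =
  qbin_ratio m j * tha q j * Q ^+ j.
Proof.
move=> jm; rewrite qbin_ratioE // /Unorm /x /tha bin2D.
rewrite expr_div_n -exprM [(m * (m + j))%N]mulnDr !exprD.
by field; rewrite !expf_neq0 ?qbin_neq0 ?leq_double.
Qed.

Lemma qbin_term_lt m j : (j < m)%N ->
  q ^+ 'C(m - j.+1, 2) * qbin m.*2 (m - j.+1) * x m ^+ (m - j.+1) / Unorm m =
  qbin_ratio m j.+1 * thb q j.+1 * Q^-1 ^+ j.+1.
Proof.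
move=> jm; rewrite qbin_ratioE' // /Unorm /x /thb.
have -> : Q ^+ m = Q ^+ (m - j.+1) * Q ^+ j.+1 by rewrite -exprD subnK.
have -> : q ^+ (m * m) = q ^+ (m * (m - j.+1)) * q ^+ (m * j.+1).
  by rewrite -exprD -mulnDr subnK.
have e : q ^+ 'C(m - j.+1, 2) * q ^+ (m * j.+1) = q ^+ 'C(m, 2) * q ^+ 'C(j.+2, 2).
  rewrite -!exprD; congr (_ ^+ _); rewrite -{2 3}(subnK jm) bin2D.
  have := bin2sq j.+1; move: (m - j.+1)%N => a; nia.
rewrite exprVn expr_div_n -exprM.
have e' : q ^+ 'C(m - j.+1, 2) = q ^+ 'C(m, 2) * q ^+ 'C(j.+2, 2) / q ^+ (m * j.+1).
  by rewrite -e mulfK // expf_neq0.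
by rewrite e'; field; rewrite !expf_neq0 ?qbin_neq0 ?leq_double.
Qed.

(** Normalized finite triple product
    [prod_(n<m) (1 + q^n Q) (1 + q^(n+1) / Q)]. *)
Definition Um m := (qbpoly m.*2).[x m] / Unorm m.

Lemma Um_S m : Um m = S (fun d => qbin_ratio m d * tha q d * Q ^+ d) +
  S (fun d => qbin_ratio m d * thb q d * Q^-1 ^+ d).
Proof.
rewrite /Um horner_poly mulr_suml.
rewrite (sum_centre m (fun k => q ^+ 'C(k, 2) * qbin m.*2 k * x m ^+ k / Unorm m)).
have gz d : (m.+1 <= d)%N -> qbin_ratio m d = 0 by move=> h; rewrite /qbin_ratio leqNgt h.
rewrite (@S_finite _ m.+1); last by move=> d /gz ->; rewrite !mul0r.
rewrite (@S_finite _ m.+1); last by move=> d /gz ->; rewrite !mul0r.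
rewrite [X in _ = _ + X]big_ord_recl [qbin_ratio m ord0 * _]mulr0 mul0r add0r.
congr (_ + _); apply: eq_bigr => i _; first by rewrite qbin_term_ge // -ltnS.
by rewrite qbin_term_lt.
Qed.

(** The image of the finite triple product under [Q d/dQ], with the same
    normalization as [Um]. *)
Definition Vm m := (x m * (qbpoly m.*2)^`().[x m] - m%:R * (qbpoly m.*2).[x m]) / Unorm m.

Lemma Vm_S m : Vm m = S (fun d => qbin_ratio m d * (d%:R * tha q d) * Q ^+ d) -
  S (fun d => qbin_ratio m d * (d%:R * thb q d) * Q^-1 ^+ d).
Proof.
have e : x m * (qbpoly m.*2)^`().[x m] - m%:R * (qbpoly m.*2).[x m] =
    \sum_(k < m.*2.+1) (k%:R - m%:R) * (q ^+ 'C(k, 2) * qbin m.*2 k * x m ^+ k).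
  have -> : (qbpoly m.*2)^`().[x m] =
      \sum_(k < m.*2.+1) k%:R * (q ^+ 'C(k, 2) * qbin m.*2 k) * x m ^+ k.-1.
    rewrite /qbpoly poly_def raddf_sum /= horner_sum; apply: eq_bigr => k _.
    by rewrite derivZ derivXn hornerZ hornerMn hornerXn -mulr_natr; ring.
  rewrite horner_poly !mulr_sumr -sumrB; apply: eq_bigr => k _.
  rewrite mulrBl; congr (_ - _).
  by case: (nat_of_ord k) => [|k']; rewrite ?mul0r ?mulr0 // exprS; ring.
rewrite /Vm e mulr_suml.
rewrite (sum_centre m (fun k =>
  (k%:R - m%:R) * (q ^+ 'C(k, 2) * qbin m.*2 k * x m ^+ k) / Unorm m)).
have gz d : (m.+1 <= d)%N -> qbin_ratio m d = 0 by move=> h; rewrite /qbin_ratio leqNgt h.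
rewrite (@S_finite _ m.+1); last by move=> d /gz ->; rewrite !mul0r.
rewrite (@S_finite _ m.+1); last by move=> d /gz ->; rewrite !mul0r.
rewrite [X in _ = _ - X]big_ord_recl [_%:R * thb q _]mulr0 mulr0 mul0r add0r -sumrN.
congr (_ + _); apply: eq_bigr => i _.
  rewrite -mulrA qbin_term_ge; last by rewrite -ltnS.
  by rewrite natrD; ring.
rewrite -mulrA qbin_term_lt // natrB // lift0; ring.
Qed.

Lemma cvg_Um : Um m @[m --> \oo] --> theta q Q.
Proof.
rewrite thetaE //; under eq_fun do rewrite Um_S.
by apply: cvgDC; apply: tannery_qbin_ratio; [exact: entire_tha|exact: entire_thb].
Qed.

Lemma cvg_Vm : Vm m @[m --> \oo] --> thd q Q.
Proof.
rewrite /thd; under eq_fun do rewrite Vm_S.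
apply: cvgBC.
  exact: (@tannery_qbin_ratio (fun d => d%:R * tha q d) Q (entire_nat (entire_tha q1))).
exact: (@tannery_qbin_ratio (fun d => d%:R * thb q d) Q^-1 (entire_nat (entire_thb q0 q1))).
Qed.

(** Minus the logarithmic derivative of the finite triple product; it is also the
    partial sum of the partial fraction expansion of [ellq]. *)
Definition ellm m : C := - \sum_(n < m) (q ^+ n * Q) / (1 + q ^+ n * Q)
  + \sum_(n < m) 1 / (1 + Q / q ^+ n.+1).

Lemma hM' n : 1 + Q / q ^+ n.+1 != 0.
Proof.
have -> : 1 + Q / q ^+ n.+1 = (1 + q ^+ n.+1 / Q) * (Q / q ^+ n.+1).
  by field; rewrite expf_neq0 ?Q0.
by rewrite !mulf_neq0 ?hM ?invr_neq0 ?expf_neq0.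
Qed.

Lemma qx_hi m n : q ^+ (m + n) * x m = q ^+ n * Q.
Proof. by rewrite /x exprD; field; rewrite expf_neq0. Qed.

Lemma qx_lo m n : (n < m)%N -> q ^+ (m - n.+1) * x m = Q / q ^+ n.+1.
Proof.
move=> nm; rewrite /x; have -> : q ^+ m = q ^+ (m - n.+1) * q ^+ n.+1.
  by rewrite -exprD subnK.
by field; rewrite !expf_neq0.
Qed.

Lemma Vm_Um m : Vm m = - ellm m * Um m.
Proof.
have hne j : (j < m.*2)%N -> 1 + q ^+ j * x m != 0.
  have [mj _|jm _] := leqP m j; first by rewrite -(subnKC mj) qx_hi hP.
  have -> : j = (m - (m - j.+1).+1)%N by lia.
  by rewrite qx_lo ?hM' //; lia.
have key : x m * (\sum_(j < m.*2) q ^+ j / (1 + q ^+ j * x m)) - m%:R = - ellm m; last first.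
  by rewrite /Vm /Um qbpoly_logder // -key; ring.
rewrite mulr_sumr (double_split m (fun j => x m * (q ^+ j / (1 + q ^+ j * x m)))).
rewrite /ellm opprD opprK -addrA; congr (_ + _).
  by apply: eq_bigr => n _; rewrite -(qx_hi m n); ring.
have -> : m%:R = \sum_(n < m) (1 : C) by rewrite sumr_const card_ord.
rewrite -sumrB -sumrN; apply: eq_bigr => n _.
rewrite mulrA [x m * _]mulrC qx_lo //.
have h := hM' n; set y := Q / q ^+ n.+1 in h *.
by field.
Qed.

(** [Um] is bounded below: the three infinite products in the numerator are by
    [prod_lb], and [(q; q)_(2m)] is bounded above because
    [(1 + x) (1 - x) <= 1] reduces it to the inverse of such a product. *)
Lemma theta_neq0 : theta q Q != 0.
Proof.
have [d1 d10 hd1] : exists2 del, 0 < del &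
    \forall n \near \oo, del <= nm (\prod_(i < n) (1 + q ^+ i * Q)).
  apply: (@prod_lb _ (fun i => q ^+ i * Q) (nm Q) (nm q)); [by rewrite r0| |exact: hP].
  by move=> i; rewrite nmM nmX mulrC.
have [d2 d20 hd2] : exists2 del, 0 < del &
    \forall n \near \oo, del <= nm (\prod_(i < n) (1 + q ^+ i.+1 / Q)).
  apply: (@prod_lb _ (fun i => q ^+ i.+1 / Q) (nm Q)^-1 (nm q)); [by rewrite r0| |exact: hM].
  move=> i; rewrite nmM nmX nmV mulrC ler_wpM2l ?invr_ge0 ?nm_ge0 //.
  by rewrite exprS ler_piMl ?exprn_ge0 ?nm_ge0 // ltW.
have [d3 d30 hd3] : exists2 del, 0 < del &
    \forall n \near \oo, del <= nm (qfac n).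
  apply: (@prod_lb _ (fun i => - q ^+ i.+1) 1 (nm q)); [by rewrite r0| |exact: oneBq_neq0].
  move=> i; rewrite nmN nmX mul1r exprS ler_piMl ?exprn_ge0 ?nm_ge0 //; exact: ltW.
have [d4 d40 hd4] : exists2 del, 0 < del &
    \forall n \near \oo, del <= nm (\prod_(i < n) (1 + - rc (nm q) ^+ i.+1)).
  apply: (@prod_lb _ (fun i => - rc (nm q) ^+ i.+1) 1 (nm q)); [by rewrite r0| |].
    by move=> i; rewrite nmN nmX nm_rc ger0_norm // mul1r exprS ler_piMl ?exprn_ge0 ?nm_ge0 // ltW.
  move=> i; rewrite subr_eq0; apply: contraTneq isT => h.
  have : nm (rc (nm q) ^+ i.+1) < 1 by rewrite nmX nm_rc ger0_norm // exprn_ilt1.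
  by rewrite -h nm1 ltxx.
have hUm m : nm (Um m) = nm (\prod_(n < m) (1 + q ^+ n * Q)) *
   nm (\prod_(n < m) (1 + q ^+ n.+1 / Q)) * nm (qfac m) ^+ 2 / nm (qfac m.*2).
  rewrite -nmX -!nmM -nmV -nmM; congr nm.
  rewrite /Um qbpoly_horner (double_splitP m (fun j => 1 + q ^+ j * x m)).
  have -> : \prod_(n < m) (1 + q ^+ (m - n.+1) * x m) =
    (\prod_(n < m) (1 + q ^+ n.+1 / Q)) * \prod_(n < m) (Q / q ^+ n.+1).
    rewrite -big_split /=; apply: eq_bigr => n _; rewrite qx_lo //.
    by field; rewrite expf_neq0 ?Q0.
  under [X in X * _ / _]eq_bigr do rewrite qx_hi.
  have -> : \prod_(n < m) (Q / q ^+ n.+1) = Q ^+ m * q ^+ 'C(m, 2) / q ^+ (m * m).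
    rewrite big_split /= prodr_const card_ord -mulrA; congr (_ * _).
    have -> : \prod_(n < m) q ^- n.+1 = q ^- 'C(m.+1, 2).
      elim: (m) => [|k IH]; first by rewrite big_ord0 expr0 invr1.
      by rewrite big_ord_recr /= IH (bin2S k.+1) exprD invfM.
    by rewrite -bin2sq exprD; field; rewrite !expf_neq0.
  rewrite /Unorm /qbin leq_double; have -> : (m.*2 - m = m)%N by lia.
  by field; rewrite !qfac_neq0 !expf_neq0 ?Q0.
have hq2 n : nm (qfac n) * nm (\prod_(i < n) (1 + - rc (nm q) ^+ i.+1)) <= 1.
  rewrite /qfac !nm_prod -big_split /=; apply: prodr_ile1 => i _.
  have e : rc (nm q) ^+ i.+1 = rc (nm q ^+ i.+1) by rewrite /rc (rmorphXn (real_complex R)).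
  have le1 : nm q ^+ i.+1 <= 1 by rewrite exprn_ile1 // ltW.
  have ge0 : 0 <= nm q ^+ i.+1 by rewrite exprn_ge0.
  rewrite mulr_ge0 ?nm_ge0 //= e -rc1 -rcB nm_rc ger0_norm ?subr_ge0 //.
  have h : nm (1 - q ^+ i.+1) <= 1 + nm q ^+ i.+1 by rewrite -nmX -{1}nm1; exact: nmB.
  have h' : 0 <= 1 - nm q ^+ i.+1 by lra.
  by apply: (le_trans (ler_wpM2r h' h)); move: (sqr_ge0 (nm q ^+ i.+1)); nra.
pose del := d1 * d2 * d3 ^+ 2 * d4.
have del0 : 0 < del by rewrite !mulr_gt0 // exprn_gt0.
have low : \forall m \near \oo, del <= nm (Um m).
  near=> m.
  have b1 : d1 <= nm (\prod_(n < m) (1 + q ^+ n * Q)) by near: m; exact: hd1.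
  have b2 : d2 <= nm (\prod_(n < m) (1 + q ^+ n.+1 / Q)) by near: m; exact: hd2.
  have b3 : d3 <= nm (qfac m) by near: m; exact: hd3.
  have b4 : d4 <= nm (\prod_(i < m.*2) (1 + - rc (nm q) ^+ i.+1)).
    near: m; case: hd4 => n0 _ hn; exists n0 => // m /= h; apply: hn => /=.
    exact: leq_trans h (leq_double m).
  have q20 : 0 < nm (qfac m.*2) by rewrite nm_gt0 qfac_neq0.
  have b5 : d4 <= (nm (qfac m.*2))^-1.
    rewrite -[leRHS]mul1r ler_pdivlMr // mulrC.
    exact: le_trans (ler_wpM2l (ltW q20) b4) (hq2 m.*2).
  have [p1 p2 p3] : [/\ 0 <= d1, 0 <= d2 & 0 <= d3] by split; exact: ltW.
  have p12 : 0 <= d1 * d2 by exact: mulr_ge0.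
  have p33 : 0 <= d3 ^+ 2 by exact: sqr_ge0.
  rewrite hUm /del; apply: ler_pM b5; [exact: mulr_ge0|exact: ltW|].
  apply: ler_pM => //; first exact: ler_pM.
  by apply: lerXn2r; rewrite ?nnegrE ?nm_ge0.
rewrite -nm_gt0; apply: (lt_le_trans del0).
have h : nm (Um m) @[m --> \oo] --> nm (theta q Q) by apply: cvg_nm; exact: cvg_Um.
by rewrite -(cvg_lim _ h) //; apply: limr_ge => //; apply/cvg_ex; eexists; exact: h.
Unshelve. all: by end_near. Qed.

(** [Vm = - ellm Um] holds exactly for each [m], so no infinite product has to be
    differentiated: only the two series converge. *)
Lemma cvg_ellm : ellm m @[m --> \oo] --> ellq q Q.
Proof.
rewrite ellqE //.
have h : - Vm m / Um m @[m --> \oo] --> - thd q Q / theta q Q.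
  apply: cvgMC; first by apply: cvgNC; exact: cvg_Vm.
  by apply: cvgVC; [exact: theta_neq0|exact: cvg_Um].
have hU : \forall m \near \oo, - Vm m / Um m = ellm m.
  have t0 : 0 < nm (theta q Q) by rewrite nm_gt0 theta_neq0.
  have /cvgCP /(_ _ t0) := cvg_Um.
  apply: filterS => m hm.
  have u0 : Um m != 0 by apply: contraTneq hm => ->; rewrite sub0r nmN ltxx.
  by rewrite Vm_Um; field.
exact: cvg_trans (near_eq_cvg hU) h.
Qed.

End AtQ.
End Jacobi.

(** * The complex exponential *)

Section CExp.
Variable R : realType.
Local Notation C := (Cplx R).

Lemma cexpE (z : C) : cexp z = (expR (reC z) * cos (imC z)) +i* (expR (reC z) * sin (imC z)).
Proof. by case: z. Qed.

Lemma cexpD (x y : C) : cexp (x + y) = cexp x * cexp y.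
Proof.
rewrite !cexpE reD imD expRD cosD sinD.
apply/eqP; rewrite eq_complex /=; apply/andP; split; apply/eqP; ring.
Qed.

Lemma cexp0 : cexp (0 : C) = 1.
Proof. by rewrite cexpE /= expR0 cos0 sin0 mulr1 mulr0. Qed.

Lemma nm_cexp (z : C) : nm (cexp z) = expR (reC z).
Proof.
apply/eqP; rewrite -(@eqrXn2 _ 2) ?nm_ge0 ?expR_ge0 // nm_sqr cexpE /reC /imC /=.
by rewrite !exprMn -mulrDr cos2Dsin2 mulr1.
Qed.

Lemma cexp_neq0 (z : C) : cexp z != 0.
Proof. by rewrite -nm_gt0 nm_cexp expR_gt0. Qed.

Lemma cexpN (z : C) : cexp (- z) = (cexp z)^-1.
Proof.
by apply: (mulfI (cexp_neq0 z)); rewrite -cexpD subrr cexp0 divff ?cexp_neq0.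
Qed.

Lemma cexpMn (z : C) n : cexp (n%:R * z) = cexp z ^+ n.
Proof.
elim: n => [|n IH]; first by rewrite mul0r cexp0.
by rewrite exprS -IH -cexpD -natr1 mulrDl mul1r addrC.
Qed.

Lemma littleo0 (f : R -> R) (l : R) : f 0 = 0 -> is_derive (0 : R) (1 : R) f l ->
  forall e, 0 < e -> \forall h \near (0 : R), `|f h - l * h| <= e * `|h|.
Proof.
move=> f0 [df dfl] e e0.
have : h^-1 *: ((f \o shift 0) (h *: 1) - f 0) @[h --> 0^'] --> l.
  by rewrite -dfl; exact: df.
move=> /cvgrPdist_le /(_ _ e0) H.
have H' : \forall h \near (0 : R), h != 0 -> `|f h - l * h| <= e * `|h|.
  move: H; rewrite near_withinE => H; apply: filterS H => h H h0.
  have := H h0; rewrite /= addr0 f0 subr0 -[h *: 1]/(h * 1) mulr1 -[_ *: _]/(h^-1 * f h) => H1.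
  have -> : f h - l * h = - (l - h^-1 * f h) * h by field.
  by rewrite normrM normrN; apply: ler_wpM2r.
apply: filterS H' => h H'; have [->|/H' //] := eqVneq h 0.
by rewrite f0 mulr0 subr0 normr0 mulr0.
Qed.

(** First order expansions at 0 of [expR], [cos] and [sin], combined. *)
Lemma cexp_o (e : R) : 0 < e ->
  \forall z \near (0 : C), nm (cexp z - 1 - z) <= e * nm z.
Proof.
move=> e0; have [e1 [e10 ee e11]] : exists e1 : R, [/\ 0 < e1, e1 <= e / 8 & e1 <= 1].
  exists (Num.min (e / 8) 1); split; rewrite ?lt_min ?ge_min ?lexx ?orbT //.
  by rewrite divr_gt0 //= ltr01.
have dE : is_derive (0 : R) (1 : R) (fun x => expR x - 1) 1.
  by apply: is_derive_eq; rewrite expR0 oppr0 addr0.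
have dS : is_derive (0 : R) (1 : R) sin 1.
  by apply: is_derive_eq; rewrite cos0.
have dC : is_derive (0 : R) (1 : R) (fun x => cos x - 1) 0.
  by apply: is_derive_eq; rewrite sin0 oppr0 addr0.
have zE : expR 0 - 1 = 0 :> R by rewrite expR0 subrr.
have zC : cos 0 - 1 = 0 :> R by rewrite cos0 subrr.
have /nbhs_ballP[d1 /= d10 h1] := littleo0 zE dE e10.
have /nbhs_ballP[d2 /= d20 h2] := littleo0 (@sin0 R) dS e10.
have /nbhs_ballP[d3 /= d30 h3] := littleo0 zC dC e10.
pose d := Num.min (Num.min d1 d2) (Num.min d3 e1).
have d0 : 0 < d by rewrite !lt_min d10 d20 d30 /= e10.
apply/nearCP; exists d => // z; rewrite subr0 => hz.
have hx := re_le_nm z; have hy := im_le_nm z.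
set x := reC z in hx *; set y := imC z in hy *.
have bx : `|x| < d by exact: le_lt_trans hz.
have by_ : `|y| < d by exact: le_lt_trans hz.
move: (bx) (by_); rewrite /d !lt_min => /andP[/andP[x1 x2] /andP[x3 x4]] /andP[/andP[y1 y2] /andP[y3 y4]].
have H1 : `|expR x - 1 - x| <= e1 * `|x|.
  by have := h1 x; rewrite /ball /= sub0r normrN mul1r; apply.
have H2 : `|sin y - y| <= e1 * `|y|.
  by have := h2 y; rewrite /ball /= sub0r normrN mul1r; apply.
have H3 : `|cos y - 1| <= e1 * `|y|.
  by have := h3 y; rewrite /ball /= sub0r normrN mul0r subr0; apply.
have c1 : `|cos y| <= 1 by rewrite ler_norml cos_geN1 cos_le1.
have s1 : `|sin y| <= `|y| * 2.
  rewrite -(subrK y (sin y)); apply: (le_trans (ler_normD _ _)).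
  have : e1 * `|y| <= 1 * `|y| by exact: ler_wpM2r.
  by lra.
have E1 : `|expR x - 1| <= `|x| * 2.
  rewrite -(subrK x (expR x - 1)); apply: (le_trans (ler_normD _ _)).
  have : e1 * `|x| <= 1 * `|x| by exact: ler_wpM2r.
  by lra.
apply: (le_trans (nm_le_reim _)).
have -> : reC (cexp z - 1 - z) = (expR x - 1 - x) * cos y + (cos y - 1) * (1 + x).
  by rewrite !reB cexpE /= -/x -/y /reC /=; ring.
have -> : imC (cexp z - 1 - z) = (expR x - 1) * sin y + (sin y - y).
  by rewrite !imB cexpE /= -/x -/y /imC /=; ring.
have A1 : `|(expR x - 1 - x) * cos y + (cos y - 1) * (1 + x)| <= e1 * `|x| + e1 * `|y| * 2.
  apply: (le_trans (ler_normD _ _)); rewrite !normrM; apply: lerD.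
    by rewrite -[leRHS]mulr1; apply: ler_pM.
  apply: ler_pM => //; apply: (le_trans (ler_normD _ _)); rewrite normr1.
  by have xx := lt_le_trans x4 e11; lra.
have A2 : `|(expR x - 1) * sin y + (sin y - y)| <= e1 * 4 * `|y| + e1 * `|y|.
  apply: (le_trans (ler_normD _ _)); apply: lerD => //; rewrite normrM.
  have := ler_pM (normr_ge0 _) (normr_ge0 _) E1 s1.
  move=> h; apply: (le_trans h).
  have : `|x| * `|y| <= e1 * `|y| by apply: ler_wpM2r => //; exact: ltW.
  by lra.
have B1 : e1 * `|x| <= e1 * nm z by apply: ler_wpM2l => //; exact: ltW.
have B2 : e1 * `|y| <= e1 * nm z by apply: ler_wpM2l => //; exact: ltW.
have B3 : e1 * nm z <= e / 8 * nm z by apply: ler_wpM2r => //; exact: nm_ge0.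
have B4 := nm_ge0 z.
by lra.
Qed.

Lemma hasd_cexp (z : C) : hasd (@cexp R) z (cexp z).
Proof.
move=> e e0; have p : 0 < nm (cexp z) by rewrite nm_gt0 cexp_neq0.
have e1 : 0 < e / nm (cexp z) by rewrite divr_gt0.
have /nearCP[d d0 h] := cexp_o e1.
apply/nearCP; exists d => // y hy.
have -> : cexp y = cexp z * cexp (y - z) by rewrite -cexpD addrC subrK.
have -> : cexp z * cexp (y - z) - cexp z - cexp z * (y - z) =
   cexp z * (cexp (y - z) - 1 - (y - z)) by ring.
rewrite nmM; apply: (le_trans (ler_wpM2l (nm_ge0 _) (h (y - z) _))).
  by rewrite subr0.
by rewrite mulrA mulrCA divff ?mulr1 // gt_eqF.
Qed.

Lemma cvg_cexp (T : Type) (F : set_system T) {FF : Filter F} (f : T -> C) a :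
  f x @[x --> F] --> a -> cexp (f x) @[x --> F] --> cexp a.
Proof. by move=> h; exact: (cvg_comp _ _ h (hasd_cont (hasd_cexp a))). Qed.

Lemma cvg_expM1 (x : C) :
  n.+1%:R * (cexp (x / n.+1%:R) - 1) @[n --> \oo] --> x.
Proof.
apply/cvgCP => e e0.
have p : 0 < nm x + 1 by have := nm_ge0 x; lra.
have e1 : 0 < e / (nm x + 1) by rewrite divr_gt0.
have /nearCP[d d0 h] := cexp_o e1.
have : (fun n => n.+1%:R^-1 : R) @ \oo --> 0 by exact: cvg_harmonic.
have d1 : 0 < d / (nm x + 1) by rewrite divr_gt0.
move=> /cvgrPdist_lt /(_ _ d1); apply: filterS => n.
rewrite sub0r normrN ger0_norm ?invr_ge0 // => hn.
have n0 : (n.+1%:R : C) != 0 by rewrite pnatr_eq0.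
have hx : nm (x / n.+1%:R) < d.
  rewrite nmM nmV nm_nat; move: hn; rewrite ltr_pdivlMr // mulrC.
  apply: le_lt_trans; apply: ler_wpM2r; first by rewrite invr_ge0.
  by lra.
have -> : n.+1%:R * (cexp (x / n.+1%:R) - 1) - x =
   n.+1%:R * (cexp (x / n.+1%:R) - 1 - x / n.+1%:R) by field; rewrite addrC natr1.
rewrite nmM nm_nat.
have := h (x / n.+1%:R); rewrite subr0 => /(_ hx) hh.
apply: (le_lt_trans (ler_wpM2l (ler0n _ _) hh)).
rewrite nmM nmV nm_nat.
have -> : n.+1%:R * (e / (nm x + 1) * (nm x / n.+1%:R)) = e * nm x / (nm x + 1).
  by field; rewrite gt_eqF //= -[1]/(1%:R) -natrD pnatr_eq0 addn1.
rewrite ltr_pdivrMr // ltr_pM2l //; lra.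
Qed.

End CExp.

(** * Increments of the q-logarithm *)

(** Writing [ellm] as a sum of [1 / (1 + w)] over the points [w = q^k Q], the
    increment from [Q] to [rho Q] is [(1 - rho)] times a sum that telescopes when
    [rho = q].  The set [A] is the union of spirals on which the estimates are
    uniform: there [1 + w] stays away from 0 relatively to [1 + |w|]. *)
Section EllStep.
Variable R : realType.
Local Notation C := (Cplx R).
Variable q : C.
Hypotheses (q0 : q != 0) (q1 : nm q < 1).
Variables (A : C -> Prop) (c : R).
Hypothesis Aq : forall w, A w -> A (q * w).
Hypothesis Aq' : forall w, A w -> A (q^-1 * w).
Hypothesis A0 : forall w, A w -> w != 0.
Hypothesis c0 : 0 < c.
Hypothesis hc : forall w, A w -> c * (1 + nm w) <= nm (1 + w).

Let A1 w : A w -> 1 + w != 0.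
Proof.
move=> /hc h; rewrite -nm_gt0; apply: lt_le_trans h; apply: mulr_gt0 => //.
by have := nm_ge0 w; lra.
Qed.

Lemma Aqn n w : A w -> A (q ^+ n * w).
Proof.
move=> h; elim: n => [|n IH]; first by rewrite expr0 mul1r.
by rewrite exprS -mulrA; exact: Aq.
Qed.

Lemma Aqn' n w : A w -> A (w / q ^+ n).
Proof.
move=> h; elim: n => [|n IH]; first by rewrite expr0 divr1.
by rewrite exprS invfM mulrCA; exact: Aq'.
Qed.

Lemma A_neq w n : A w -> 1 + q ^+ n * w != 0.
Proof. by move=> /(Aqn n)/A1. Qed.

Lemma A_neq' w n : A w -> 1 + q ^+ n.+1 / w != 0.
Proof.
move=> Aw; have w0 := A0 Aw.
have -> : 1 + q ^+ n.+1 / w = (1 + w / q ^+ n.+1) * (q ^+ n.+1 / w).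
  by field; rewrite expf_neq0 ?w0.
by rewrite !mulf_neq0 ?invr_neq0 ?expf_neq0 // A1 //; exact: Aqn'.
Qed.

Lemma cvg_ellA w : A w -> ellm q w m @[m --> \oo] --> ellq q w.
Proof.
move=> Aw; apply: cvg_ellm => //; first exact: A0.
  by move=> n; exact: A_neq.
by move=> n; exact: A_neq'.
Qed.

Lemma ellm_sum w m : A w ->
  ellm q w m = \sum_(k < m.*2) (1 + q ^+ k * (w / q ^+ m))^-1 - m%:R.
Proof.
move=> Aw; have w0 := A0 Aw.
rewrite (double_split m (fun k => (1 + q ^+ k * (w / q ^+ m))^-1)) /ellm.
rewrite addrAC; congr (_ + _).
  rewrite -sumrN; have -> : m%:R = \sum_(n < m) (1 : C) by rewrite sumr_const card_ord.
  rewrite -sumrB; apply: eq_bigr => n _; rewrite qx_hi //.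
  by have h := A_neq n Aw; field.
by apply: eq_bigr => n _; rewrite qx_lo // mul1r.
Qed.

(** The deviation from the telescoping sum is
    [(q - rho) sum w^2 / ((1 + w) (1 + rho w) (1 + q w))], whose modulus is
    bounded by the same telescoping sum for [|q|] in place of [q]. *)
Lemma ell_step_fin (Q rho : C) m : A Q -> A (rho * Q) -> 2^-1 <= nm rho ->
  nm ((q - 1) * (ellm q (rho * Q) m - ellm q Q m) -
      (rho - 1) * ((1 + q ^+ m * Q)^-1 - (1 + Q / q ^+ m)^-1)) <=
  2 / c ^+ 3 * (nm (1 - q) / (1 - nm q)) * nm (1 - rho) * nm (q - rho).
Proof.
move=> AQ ArQ hrho.
have r1 : 0 < 1 - nm q by rewrite subr_gt0.
pose w k := q ^+ k * (Q / q ^+ m).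
have Aw k : A (w k) by exact/Aqn/Aqn'.
have Arw k : A (rho * w k).
  have -> : rho * w k = q ^+ k * (rho * Q / q ^+ m) by rewrite /w; ring.
  exact/Aqn/Aqn'.
have wS k : w k.+1 = q * w k by rewrite /w exprS -mulrA.
pose X := \sum_(k < m.*2) w k / ((1 + w k) * (1 + rho * w k)).
pose Y := \sum_(k < m.*2) w k / ((1 + w k) * (1 + q * w k)).
pose Z := \sum_(k < m.*2) w k ^+ 2 / ((1 + w k) * (1 + rho * w k) * (1 + q * w k)).
have e1 : ellm q (rho * Q) m - ellm q Q m = (1 - rho) * X.
  rewrite !ellm_sum // opprB addrA subrK -sumrB mulr_sumr.
  apply: eq_bigr => k _.
  have -> : q ^+ k * (rho * Q / q ^+ m) = rho * w k by rewrite /w; ring.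
  rewrite -/(w k); field.
  by rewrite (A1 (Aw k)) (A1 (Arw k)).
have tel : (1 - q) * Y = (1 + q ^+ m * Q)^-1 - (1 + Q / q ^+ m)^-1.
  rewrite mulr_sumr.
  rewrite (eq_bigr (fun k : 'I_m.*2 => (1 + w k.+1)^-1 - (1 + w k)^-1)); last first.
    move=> k _; rewrite wS; field.
    by rewrite (A1 (Aw k)) -wS (A1 (Aw k.+1)).
  rewrite -(big_mkord xpredT (fun k => (1 + w k.+1)^-1 - (1 + w k)^-1)) telescope_sumr //.
  rewrite /w expr0 mul1r; congr (_^-1 - _); congr (1 + _).
  by rewrite -addnn exprD; field; rewrite expf_neq0.
have XY : X - Y = (q - rho) * Z.
  rewrite /X /Y /Z -sumrB mulr_sumr; apply: eq_bigr => k _; field.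
  by rewrite (A1 (Aw k)) (A1 (Arw k)) -wS (A1 (Aw k.+1)).
rewrite e1 -tel.
have -> : (q - 1) * ((1 - rho) * X) - (rho - 1) * ((1 - q) * Y) =
   (1 - q) * (1 - rho) * (q - rho) * - Z.
  have -> : X = Y + (q - rho) * Z by rewrite -XY; ring.
  ring.
pose a k := nm (w k).
have a0 k : 0 <= a k by exact: nm_ge0.
have aS k : a k.+1 = nm q * a k by rewrite /a wS nmM.
have p0 k : 0 < 1 + a k by have := a0 k; lra.
have u k : 1 + a k != 0 by rewrite gt_eqF.
have hZ : nm Z <= 2 / c ^+ 3 / (1 - nm q).
  apply: (le_trans (nm_sum _ _ _)); rewrite {X Y Z e1 tel XY}.
  clearbody w.
  apply: (@le_trans _ _ (\sum_(k < m.*2) 2 / c ^+ 3 / (1 - nm q) * ((1 + a k.+1)^-1 - (1 + a k)^-1))).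
    apply: ler_sum => k _.
    have -> : (1 + a k.+1)^-1 - (1 + a k)^-1 = (1 - nm q) * (a k / ((1 + a k) * (1 + a k.+1))).
      rewrite aS; field.
      by rewrite -aS !u.
    rewrite [leRHS](_ : _ = 2 / c ^+ 3 * (a k / ((1 + a k) * (1 + a k.+1)))); last first.
      by field; rewrite !u !gt_eqF.
    rewrite nmM nmX nmV !nmM -/(a k).
    have h1 : c * (1 + a k) <= nm (1 + w k) by exact: hc.
    have h2 : c * (1 + nm (rho * w k)) <= nm (1 + rho * w k) by exact: hc.
    have h3 : c * (1 + a k.+1) <= nm (1 + q * w k) by rewrite -wS; exact: hc.
    have pr : 0 < 1 + nm (rho * w k) by have := nm_ge0 (rho * w k); lra.
    have cp : 0 < c ^+ 3 by rewrite exprn_gt0.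
    have cn : c != 0 by rewrite gt_eqF.
    have prn : 1 + nm (rho * w k) != 0 by rewrite gt_eqF.
    apply: (@le_trans _ _ (a k ^+ 2 / (c * (1 + a k) * (c * (1 + nm (rho * w k))) * (c * (1 + a k.+1))))).
      apply: ler_wpM2l; first exact: sqr_ge0.
      rewrite lef_pV2 ?posrE; last first.
      - by rewrite !mulr_gt0.
      - by rewrite !mulr_gt0 // nm_gt0 ?A1 // -wS.
      by apply: ler_pM => //; [rewrite !mulr_ge0 // ltW|rewrite mulr_ge0 // ltW|
        apply: ler_pM => //; rewrite mulr_ge0 // ltW].
    have -> : a k ^+ 2 / (c * (1 + a k) * (c * (1 + nm (rho * w k))) * (c * (1 + a k.+1))) =
      (a k / (1 + nm (rho * w k))) * (a k / ((1 + a k) * (1 + a k.+1)) / c ^+ 3).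
      by field; rewrite !u prn cn.
    have -> : 2 / c ^+ 3 * (a k / ((1 + a k) * (1 + a k.+1))) =
       2 * (a k / ((1 + a k) * (1 + a k.+1)) / c ^+ 3) by field; rewrite !u cn.
    apply: ler_wpM2r.
      by rewrite !divr_ge0 ?mulr_ge0 // ltW.
    (* This is where nm rho >= 1/2 enters. *)
    rewrite ler_pdivrMr // nmM -/(a k).
    have := ler_wpM2r (a0 k) hrho; lra.
  rewrite -mulr_sumr -[leRHS]mulr1; apply: ler_wpM2l.
    by rewrite !divr_ge0 ?exprn_ge0 // ltW.
  rewrite -(big_mkord xpredT (fun k => (1 + a k.+1)^-1 - (1 + a k)^-1)) telescope_sumr //.
  have i0 : 0 <= (1 + a 0%N)^-1 by rewrite invr_ge0 ltW.
  have i1 : (1 + a m.*2)^-1 <= 1 by rewrite invf_le1 //; have := a0 m.*2; lra.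
  by lra.
rewrite !nmM nmN.
have -> : 2 / c ^+ 3 * (nm (1 - q) / (1 - nm q)) * nm (1 - rho) * nm (q - rho) =
  nm (1 - q) * nm (1 - rho) * nm (q - rho) * (2 / c ^+ 3 / (1 - nm q)).
  by field; rewrite !gt_eqF.
apply: ler_wpM2l hZ; by rewrite !mulr_ge0 ?nm_ge0.
Qed.

(** Since [q^m Q] tends to 0 and [Q / q^m] to infinity, the telescoping sum
    tends to 1. *)
Lemma ell_step (Q rho : C) : A Q -> A (rho * Q) -> 2^-1 <= nm rho ->
  nm ((q - 1) * (ellq q (rho * Q) - ellq q Q) - (rho - 1)) <=
  2 / c ^+ 3 * (nm (1 - q) / (1 - nm q)) * nm (1 - rho) * nm (q - rho).
Proof.
move=> AQ ArQ hrho; have Q0 := A0 AQ.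
have l0 : q ^+ m * Q @[m --> \oo] --> (0 : C).
  by rewrite -(mul0r Q); apply: cvgMrC; exact: cvg_qpow0.
have l1 : (1 + q ^+ m * Q)^-1 @[m --> \oo] --> (1 : C).
  apply: (@cvg_eqC _ _ _ _ (fun m => (1 + q ^+ m * Q)^-1) _ ((1 + 0)^-1)).
  - by [].
  - by rewrite addr0 invr1.
  apply: cvgVC; first by rewrite addr0 oner_neq0.
  by apply: cvgDC; [exact: cvg_cst|exact: l0].
have l2 : (1 + Q / q ^+ m)^-1 @[m --> \oo] --> (0 : C).
  have e m : (1 + Q / q ^+ m)^-1 = q ^+ m / (q ^+ m + Q).
    have h := A1 (Aqn' m AQ).
    have h' : q ^+ m + Q != 0.
      have -> : q ^+ m + Q = (1 + Q / q ^+ m) * q ^+ m by field; rewrite expf_neq0.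
      by rewrite mulf_neq0 ?expf_neq0.
    field; rewrite h' expf_neq0 //=.
  apply: (@cvg_eqC _ _ _ _ (fun m => q ^+ m / (q ^+ m + Q)) _ (0 / (0 + Q))).
  - exact: e.
  - by rewrite mul0r.
  apply: cvgMC; first exact: cvg_qpow0.
  apply: cvgVC; first by rewrite add0r.
  by apply: cvgDC; [exact: cvg_qpow0|exact: cvg_cst].
pose G m := (q - 1) * (ellm q (rho * Q) m - ellm q Q m) -
      (rho - 1) * ((1 + q ^+ m * Q)^-1 - (1 + Q / q ^+ m)^-1).
have hG : G m @[m --> \oo] --> (q - 1) * (ellq q (rho * Q) - ellq q Q) - (rho - 1) * (1 - 0).
  apply: cvgBC.
    by apply: cvgMlC; apply: cvgBC; exact: cvg_ellA.
  by apply: cvgMlC; apply: cvgBC; [exact: l1|exact: l2].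
rewrite subr0 mulr1 in hG.
apply: (nm_lim_le hG); apply: nearW => m; exact: ell_step_fin.
Qed.

End EllStep.

(** * The limit of the q-logarithm along the spiral *)

Section Spiral.
Variable R : realType.
Local Notation C := (Cplx R).
Variable lam : C.
Hypothesis lam0 : reC lam < 0.
Let a := reC lam.

Lemma re_rcM (x : R) (z : C) : reC (rc x * z) = x * reC z.
Proof. by case: z => p r; rewrite /reC /rc /= mul0r subr0. Qed.

Definition iang (x : R) : C := 0 +i* x.

Lemma rc_iang t x : rc t * iang x = iang (t * x).
Proof.
by apply/eqP; rewrite eq_complex /= !mulr0 mul0r subr0 addr0 !eqxx.
Qed.

Lemma cexp_iang x : cexp (iang x) = cos x +i* sin x.
Proof. by rewrite cexpE /= expR0 !mul1r. Qed.

Lemma nm_cexp_spiral s x : nm (cexp (rc s * lam + iang x)) = expR (s * a).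
Proof. by rewrite nm_cexp reD re_rcM addr0. Qed.

(** The spirals through the arc from 1 to [exp (i u)].  The set is stable under
    multiplication by [q] and contains the path [exp (t x)], [0 <= t <= 1], from
    1 to [exp x] for [x = s lam + i u]. *)
Definition sect (u : R) (w : C) : Prop :=
  exists s t : R, 0 <= t <= 1 /\ w = cexp (rc s * lam + iang (t * u)).

Lemma cos_neqN1 (x : R) : `|x| < pi -> cos x != -1.
Proof.
move=> h; have -> : cos x = cos `|x|.
  by have [x0|x0] := ger0P x; rewrite ?cosN.
apply: contraTneq h => e; rewrite -leNgt.
have <- : acos (cos `|x|) = pi by rewrite e acosN1.
have [hp|hp] := lerP `|x| pi; first by rewrite cosK // in_itv /= normr_ge0.
by rewrite e acosN1 ltW.
Qed.

(** For [|w| <= 1/2] or [|w| >= 2] the bound is elementary; the remaining part of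
    the sector is the image of a compact rectangle, on which [1 + w] does not
    vanish because [|u| < pi]. *)
Lemma sect_lower u : `|u| < pi -> exists2 c : R, 0 < c &
  forall w, sect u w -> c * (1 + nm w) <= nm (1 + w).
Proof.
move=> hu; pose T := ln 2 / - a.
have a0 : 0 < - a by rewrite oppr_gt0.
have ln2 : 0 < ln 2 :> R by rewrite ln_gt0 // ltr1n.
have T0 : 0 < T by rewrite divr_gt0.
pose g (p : R * R) := nm (1 + cexp (rc p.1 * lam + iang (p.2 * u))).
pose K := `[(- T), T]%classic `*` `[0, 1 : R]%classic.
have Kne : K !=set0.
  by exists (0, 0); split; rewrite /= in_itv /= ?lexx ?ler01 // oppr_le0 ltW //= ltW.
have cK : compact K by apply: compact_setX; exact: segment_compact.
have cg : {within K, continuous g}.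
  apply: continuous_subspaceT => p.
  apply: (@cvg_nm _ _ (nbhs p)).
  apply: (@cvgDC _ _ (nbhs p)); first exact: (@cvg_cstC _ _ (nbhs p)).
  apply: (@cvg_cexp _ _ (nbhs p)).
  apply: (@cvgDC _ _ (nbhs p)).
    by apply: (@cvgMrC _ _ (nbhs p)); apply: (@cvg_rc _ _ (nbhs p)); exact: cvg_fst.
  rewrite -rc_iang; under eq_fun do rewrite -rc_iang.
  by apply: (@cvgMrC _ _ (nbhs p)); apply: (@cvg_rc _ _ (nbhs p)); exact: cvg_snd.
have [p /set_mem [p1 p2] hp] := compact_EVT_min Kne cK cg.
have gp0 : 0 < g p.
  rewrite nm_gt0; apply/negP => /eqP e.
  have h1 : cexp (rc p.1 * lam + iang (p.2 * u)) = -1.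
    by apply: (addrI 1); rewrite e subrr.
  have : nm (cexp (rc p.1 * lam + iang (p.2 * u))) = 1 by rewrite h1 nmN nm1.
  rewrite nm_cexp_spiral -[RHS]expR0 => /expR_inj /eqP.
  rewrite mulf_eq0 [a == 0]lt_eqF // orbF => /eqP s0.
  move: h1; rewrite s0 rc0 mul0r add0r cexp_iang => -[] h1 _.
  have : `|p.2 * u| < pi.
    move: p2; rewrite /= in_itv /= => /andP[t0 t1].
    rewrite normrM ger0_norm //; apply: le_lt_trans hu.
    by rewrite ler_piMl.
  by move=> /cos_neqN1; rewrite h1 eqxx.
exists (Num.min 3^-1 (g p / 3)).
  by rewrite lt_min invr_gt0 ltr0n /= divr_gt0.
move=> w [s [t [ht ->]]].
set m := Num.min _ _.
have m1 : m <= 3^-1 by rewrite ge_min lexx.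
have m2 : m <= g p / 3 by rewrite ge_min lexx orbT.
set w' := cexp _; have n0 := nm_ge0 w'.
have e1 : nm w' = expR (s * a) by exact: nm_cexp_spiral.
have eT : expR (T * - a) = 2 by rewrite divfK ?gt_eqF // lnK ?posrE // ltr0n.
have [sT|sT] := leP T s.
  have h : nm w' <= 2^-1.
    by rewrite e1 -eT -expRN ler_expR mulrN opprK ler_nM2r.
  have h2 : 1 - nm w' <= nm (1 + w') by rewrite -[X in X - _]nm1; exact: nmDB.
  have h3 : m * (1 + nm w') <= 3^-1 * (1 + nm w') by apply: ler_wpM2r => //; lra.
  lra.
have [Ts|Ts] := leP s (- T).
  have h : 2 <= nm w'.
    by rewrite e1 -eT ler_expR mulrN -mulNr ler_nM2r.
  have h2 : nm w' - 1 <= nm (1 + w').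
    by have := nmDB w' 1; rewrite nm1 [w' + 1]addrC.
  have h3 : m * (1 + nm w') <= 3^-1 * (1 + nm w') by apply: ler_wpM2r => //; lra.
  lra.
have h : nm w' <= 2.
  by rewrite e1 -eT ler_expR mulrN -mulNr ler_nM2r // ltW.
have : g p <= g (s, t).
  by apply: hp; apply/mem_set; split; rewrite /= in_itv /= ?ht // !ltW.
rewrite /g /= -/w' => h2.
have h3 : m * (1 + nm w') <= g p / 3 * (1 + nm w') by apply: ler_wpM2r => //; lra.
apply: (le_trans h3); apply: le_trans h2; rewrite -mulrA ler_piMr //; first exact: ltW.
lra.
Qed.

Section Chain.
Variables (t : R) (u : R).
Hypotheses (t0 : 0 < t) (hu : `|u| < pi).
Let q : C := cexp (rc t * lam).

Lemma q_neq0 : q != 0. Proof. exact: cexp_neq0. Qed.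
Lemma nm_q : nm q = expR (t * a).
Proof. by rewrite /q nm_cexp re_rcM. Qed.
Lemma nm_q1 : nm q < 1.
Proof. by rewrite nm_q expR_lt1 pmulr_rlt0. Qed.

Lemma sect_q w : sect u w -> sect u (q * w).
Proof.
move=> [s [x [hx ->]]]; exists (t + s), x; split => //.
by rewrite -cexpD addrA -mulrDl -rcD.
Qed.
Lemma sect_qV w : sect u w -> sect u (q^-1 * w).
Proof.
move=> [s [x [hx ->]]]; exists (s - t), x; split => //.
by rewrite -cexpN -cexpD addrA -mulNr -mulrDl addrC [- _ + _]addrC rcB addrC.
Qed.
Lemma sect_neq0 w : sect u w -> w != 0.
Proof. by move=> [s [x [_ ->]]]; exact: cexp_neq0. Qed.

Lemma sect1 : sect u 1.
Proof.
exists 0, 0; split; first by rewrite lexx ler01.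
by rewrite rc0 !mul0r add0r cexp_iang cos0 sin0.
Qed.

(** The two halves of the sum cancel at [Q = 1] up to the term [n = 0]. *)
Lemma ellq1 : ellq q 1 = - 2^-1.
Proof.
have q0 := q_neq0; have q1 := nm_q1.
have [c c0 hc] := sect_lower hu.
have h : ellm q 1 m @[m --> \oo] --> ellq q 1.
  exact: (@cvg_ellA _ _ q0 q1 _ c sect_q sect_qV sect_neq0 c0 hc _ sect1).
have ne n : 1 + q ^+ n != 0.
  have := @A_neq _ _ _ c sect_q c0 hc 1 n sect1.
  by rewrite mulr1.
have e m : ellm q 1 m = - 2^-1 + q ^+ m / (1 + q ^+ m).
  elim: m => [|m IH].
    rewrite /ellm !big_ord0 expr0 oppr0 add0r -[1 + 1]/(2%:R) mul1r.
    by rewrite addNr.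
  move: IH; rewrite /ellm !big_ord_recr /= opprD addrACA => ->.
  have h1 := ne m; have h2 := ne m.+1.
  have h3 : q ^+ m.+1 != 0 by rewrite expf_neq0.
  rewrite mulr1; set x := q ^+ m in h1 *; set y := q ^+ m.+1 in h2 h3 *.
  by field; rewrite h1 h2 h3.
rewrite -(limC h); apply: limC.
apply: (@cvg_eqC _ _ _ _ (fun m => - 2^-1 + q ^+ m / (1 + q ^+ m)) _ (- 2^-1 + 0 / (1 + 0))).
- exact: e.
- by rewrite mul0r addr0.
apply: cvgDC; first exact: cvg_cst.
apply: cvgMC; first exact: cvg_qpow0.
apply: cvgVC; first by rewrite addr0 oner_neq0.
by apply: cvgDC; [exact: cvg_cst|exact: cvg_qpow0].
Qed.

(** [ell_step] is applied to [n + 1] steps of ratio [exp (x / (n + 1))] and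
    [n] tends to infinity: the main terms add up to [x], and the errors to the
    right-hand side. *)
Lemma ell_chain (c s : R) (x : C) : x = rc s * lam + iang u -> 0 < c ->
  (forall w, sect u w -> c * (1 + nm w) <= nm (1 + w)) ->
  nm ((q - 1) * (ellq q (cexp x) - ellq q 1) - x) <=
    2 / c ^+ 3 * (nm (1 - q) / (1 - nm q)) * nm x * nm (1 - q).
Proof.
move=> ex c0 hc; have q0 := q_neq0; have q1 := nm_q1.
pose rho n := cexp (x / n.+1%:R).
pose K := 2 / c ^+ 3 * (nm (1 - q) / (1 - nm q)).
have rhoS n j : (j <= n.+1)%N -> sect u (rho n ^+ j).
  move=> jn; exists (j%:R / n.+1%:R * s), (j%:R / n.+1%:R); split.
    by rewrite divr_ge0 //= ler_pdivrMr // mul1r ler_nat.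
  rewrite -cexpMn -rc_iang rcM -[rc _ * rc s * lam]mulrA -mulrDr -ex.
  have -> : rc (j%:R / n.+1%:R : R) = j%:R / n.+1%:R.
    by rewrite rcM rcV !rc_nat.
  by rewrite [x / _]mulrC mulrA.
have step n j : 2^-1 <= nm (rho n) -> (j <= n.+1)%N ->
   nm ((q - 1) * (ellq q (rho n ^+ j) - ellq q 1) - j%:R * (rho n - 1)) <=
   j%:R * (K * nm (1 - rho n) * nm (q - rho n)).
  move=> hr; elim: j => [|j IH] jn.
    by rewrite expr0 subrr mulr0 !mul0r subr0 nm0.
  have jn' := ltnW jn.
  have s1 := rhoS n j jn'; have s2 := rhoS n j.+1 jn; rewrite exprS in s2.
  have := @ell_step _ _ q0 q1 _ c sect_q sect_qV sect_neq0 c0 hc _ _ s1 s2 hr.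
  rewrite -/K -exprS => h.
  have -> : (q - 1) * (ellq q (rho n ^+ j.+1) - ellq q 1) - j.+1%:R * (rho n - 1) =
     ((q - 1) * (ellq q (rho n ^+ j.+1) - ellq q (rho n ^+ j)) - (rho n - 1)) +
     ((q - 1) * (ellq q (rho n ^+ j) - ellq q 1) - j%:R * (rho n - 1)).
    rewrite -natr1; move: (rho n - 1) (q - 1) (ellq q (rho n ^+ j.+1)).
    by move: (ellq q (rho n ^+ j)) (ellq q 1) => e1 e2 e3 e4 e5; ring.
  apply: (le_trans (nmD _ _)); rewrite -natr1 [leRHS]mulrDl mul1r addrC.
  by apply: lerD => //; exact: IH.
have rho1 : rho n @[n --> \oo] --> (1 : C).
  rewrite -(cexp0 R); apply: cvg_cexp.
  apply: (@cvg_eqC _ _ _ _ (fun n => x * rc (n.+1%:R^-1)) _ (x * rc 0)).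
  - by move=> n; rewrite rcV rc_nat.
  - by rewrite rc0 mulr0.
  apply: cvgMlC; apply: cvg_rc; exact: cvg_harmonic.
have hM := @cvg_expM1 _ x.
have L1 : nm ((q - 1) * (ellq q (cexp x) - ellq q 1) - n.+1%:R * (rho n - 1)) @[n --> \oo]
   --> nm ((q - 1) * (ellq q (cexp x) - ellq q 1) - x).
  by apply: cvg_nm; apply: cvgBC; [exact: cvg_cst|exact: hM].
have L2 : K * nm (n.+1%:R * (rho n - 1)) * nm (q - rho n) @[n --> \oo] --> K * nm x * nm (1 - q).
  rewrite [nm (1 - q)]nmBC; apply: cvgM.
    by apply: cvgM; [exact: cvg_cst|apply: cvg_nm; exact: hM].
  by apply: cvg_nm; apply: cvgBC; [exact: cvg_cst|exact: rho1].
apply: (ler_cvg_to L1 L2).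
have h2 : 0 < 2^-1 :> R by rewrite invr_gt0.
have /cvgCP /(_ _ h2) := rho1; apply: filterS => n hn.
have hr : 2^-1 <= nm (rho n).
  have := nmDB 1 (rho n - 1); rewrite nm1 addrCA subrr addr0; lra.
have := step n n.+1 hr (leqnn _).
rewrite -cexpMn mulrCA divff ?mulr1 ?pnatr_eq0 // => h; apply: (le_trans h).
rewrite nmM nm_nat [nm (rho n - 1)]nmBC le_eqVlt; apply/orP; left; apply/eqP; ring.
Qed.

End Chain.

(** As [q] tends to 1 along its spiral it stays in a Stolz angle, because
    [Re lam < 0]. *)
Lemma q_ratio : exists2 K : R, 0 < K &
  \forall t \near (0 : R)^'+, nm (1 - cexp (rc t * lam)) <= K * (1 - nm (cexp (rc t * lam))).
Proof.
have a0 : 0 < - a by rewrite oppr_gt0.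
have l0 : 0 < nm lam.
  by rewrite nm_gt0; apply: contraTneq lam0 => ->; rewrite /reC /= ltxx.
exists (4 * nm lam / - a); first by rewrite !divr_gt0 ?mulr_gt0.
have h1 : 0 < 2^-1 :> R by rewrite invr_gt0.
have /nearCP[d d0 hd] := cexp_o h1.
have dd : 0 < d / (nm lam + - a) by rewrite divr_gt0 // addr_gt0.
near=> t.
have t0 : 0 < t by near: t; exact: nbhs_right_gt.
have td : t < d / (nm lam + - a) by near: t; exact: nbhs_right_lt.
rewrite ltr_pdivlMr ?addr_gt0 // mulrDr in td.
have tl : 0 < t * nm lam by rewrite mulr_gt0.
have ta : 0 < t * - a by rewrite mulr_gt0.
have b1 : nm (1 - cexp (rc t * lam)) <= 2 * (t * nm lam).
  have hx : nm (rc t * lam) = t * nm lam by rewrite nmM nm_rc gtr0_norm.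
  have := hd (rc t * lam); rewrite subr0 hx => /(_ _) h.
  have {}h : nm (cexp (rc t * lam) - 1 - rc t * lam) <= 2^-1 * (t * nm lam) by apply: h; lra.
  rewrite nmBC -(subrK (rc t * lam) (cexp (rc t * lam) - 1)).
  by apply: (le_trans (nmD _ _)); rewrite hx; lra.
have b2 : t * - a <= 2 * (1 - nm (cexp (rc t * lam))).
  rewrite nm_cexp re_rcM -/a.
  have hx : nm (rc (t * a)) = t * - a by rewrite nm_rc normrM gtr0_norm // ltr0_norm.
  have := hd (rc (t * a)); rewrite subr0 hx => /(_ _) h.
  have {}h : nm (cexp (rc (t * a)) - 1 - rc (t * a)) <= 2^-1 * (t * - a) by apply: h; lra.
  have e : cexp (rc (t * a)) = rc (expR (t * a)).
    by rewrite cexpE /= cos0 sin0 mulr1 mulr0.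
  rewrite e -rc1 -!rcB nm_rc in h.
  have := ler_norm (expR (t * a) - 1 - t * a); lra.
apply: (le_trans b1).
have -> : 2 * (t * nm lam) = (2 * nm lam / - a) * (t * - a) by field; rewrite lt_eqF.
have -> : 4 * nm lam / - a = (2 * nm lam / - a) * 2 by field; rewrite lt_eqF.
rewrite -[leRHS]mulrA; apply: ler_wpM2l => //.
by rewrite divr_ge0 ?mulr_ge0 // ltW.
Unshelve. all: by end_near. Qed.

Lemma cvg_qpow1 : cexp (rc t * lam) @[t --> 0^'+] --> (1 : C).
Proof.
rewrite -(cexp0 R); apply: cvg_cexp.
rewrite -(mul0r lam); apply: cvgMrC; rewrite -rc0; apply: cvg_rc.
exact: (cvg_at_right_filter cvg_id).
Qed.

(** In [ell_chain] the right-hand side is [O(|1 - q|)] by [q_ratio], and the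
    contribution of [ellq 1 = -1/2] disappears with [q - 1]. *)
Lemma ell_limit (s u : R) (x : C) : x = rc s * lam + iang u -> `|u| < pi ->
  (cexp (rc t * lam) - 1) * ellq (cexp (rc t * lam)) (cexp x) @[t --> 0^'+] --> x.
Proof.
move=> ex hu; have [c c0 hc] := sect_lower hu.
have [K K0 hK] := q_ratio.
have hq := cvg_qpow1.
pose q t := cexp (rc t * lam).
have h1 : (q t - 1) * (ellq (q t) (cexp x) - ellq (q t) 1) @[t --> 0^'+] --> x.
  apply: (@cvgC_nm _ _ _ _ _ _ (fun t => 2 / c ^+ 3 * K * nm x * nm (1 - q t))).
    near=> t.
    have t0 : 0 < t by near: t; exact: nbhs_right_gt.
    have hKt : nm (1 - q t) <= K * (1 - nm (q t)) by near: t; exact: hK.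
    have r1 : 0 < 1 - nm (q t) by rewrite subr_gt0; exact: nm_q1.
    have h := ell_chain t0 ex c0 hc; rewrite -/(q t) in h.
    apply: (le_trans h).
    apply: ler_wpM2r; first exact: nm_ge0.
    apply: ler_wpM2r; first exact: nm_ge0.
    apply: ler_wpM2l; first by rewrite divr_ge0 ?exprn_ge0 // ltW.
    by rewrite ler_pdivrMr.
  rewrite -[X in _ --> X](mulr0 (2 / c ^+ 3 * K * nm x)); apply: cvgM; first exact: cvg_cst.
  have h : nm (1 - q t) @[t --> 0^'+] --> nm (1 - 1 : C).
    by apply: cvg_nm; apply: cvgBC; [exact: cvg_cst|exact: hq].
  by rewrite subrr nm0 in h; exact: h.
apply: (cvg_trans (near_eq_cvg _) (_ : ((q t - 1) * (ellq (q t) (cexp x) - ellq (q t) 1) + (q t - 1) * - 2^-1) @[t --> 0^'+] --> x)).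
  near=> t; have t0 : 0 < t by near: t; exact: nbhs_right_gt.
  rewrite -(ellq1 t0 hu) -/(q t).
  by move: (ellq (q t) (cexp x)) (ellq (q t) 1) (q t - 1) => e1 e2 e3; ring.
rewrite -[X in _ --> X]addr0; apply: cvgDC; first exact: h1.
rewrite -[X in _ --> X](mul0r (- 2^-1)); apply: cvgMrC; rewrite -[X in _ --> X](subrr 1).
by apply: cvgBC; [exact: hq|exact: cvg_cst].
Unshelve. all: by end_near. Qed.

End Spiral.

(** * The branch of the logarithm *)

Section LogBranch.
Variable R : realType.
Local Notation C := (Cplx R).
Variable lam : C.
Hypothesis lam0 : reC lam < 0.
Let a := reC lam.

Lemma qpowE (s : R) : qpow lam s = cexp (rc s * lam). Proof. by []. Qed.

Lemma polar_unit (w : C) : nm w = 1 -> w != -1 ->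
  exists2 u : R, `|u| < pi & w = cexp (iang u).
Proof.
move=> w1 wN1; have := nm_sqr w; rewrite w1 expr1n.
case: w w1 wN1 => x y w1 wN1 e'.
have {e'} e : 1 = x ^+ 2 + y ^+ 2 by exact: e'.
have y2 : y ^+ 2 = 1 - x ^+ 2 by lra.
have xr : -1 <= x <= 1.
  by rewrite -ler_norml -(@ler_pXn2r _ 2) ?nnegrE // real_normK ?num_real // expr1n; have := sqr_ge0 y; lra.
have xN1 : x != -1.
  apply: contra wN1 => /eqP ex; rewrite eq_complex /= ex eqxx /=.
  by rewrite oppr0 -sqrf_eq0 y2 ex sqrrN expr1n subrr.
have x1 : -1 < x <= 1 by rewrite lt_neqAle eq_sym xN1 /=.
have ha := acos_ge0 xr; have hpi := acos_ltpi x1.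
have hc : cos (acos x) = x by apply: acosK; rewrite in_itv.
have hs : sin (acos x) = `|y| by rewrite sin_acos // -y2 sqrtr_sqr.
have [y0|y0] := ger0P y.
  exists (acos x); first by rewrite ger0_norm.
  by rewrite cexp_iang hc hs ger0_norm.
exists (- acos x); first by rewrite normrN ger0_norm.
by rewrite cexp_iang cosN sinN hc hs ltr0_norm // opprK.
Qed.

(** The modulus determines [s]; what remains lies on the unit circle and differs
    from -1. *)
Lemma polar (Q : C) : log_domain lam Q ->
  exists s u : R, `|u| < pi /\ Q = cexp (rc s * lam + iang u).
Proof.
move=> [/= Q0 hQ]; pose s := ln (nm Q) / a.
have a0 : a != 0 by rewrite lt_eqF.
have nQ : nm (cexp (rc s * lam)) = nm Q.
  by rewrite nm_cexp re_rcM divfK // lnK // posrE nm_gt0.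
have e0 := cexp_neq0 (rc s * lam).
have [u hu eu] : exists2 u : R, `|u| < pi & Q / cexp (rc s * lam) = cexp (iang u).
  apply: polar_unit; first by rewrite nmM nmV nQ divff // nm_eq0.
  apply/eqP => e; apply: hQ; exists s => //; rewrite qpowE.
  by rewrite -e divfK.
exists s, u; split => //.
by rewrite cexpD -eu mulrC divfK.
Qed.

Lemma polar_dom (s u : R) : `|u| < pi -> log_domain lam (cexp (rc s * lam + iang u)).
Proof.
move=> hu; split; first exact: cexp_neq0.
move=> [s' _]; rewrite qpowE => e.
have e2 : cexp (rc (s - s') * lam + iang u) = -1.
  have -> : rc (s - s') * lam + iang u = rc s * lam + iang u - rc s' * lam.
    by rewrite rcB; ring.
  rewrite cexpD cexpN -e mulN1r mulNr divff ?cexp_neq0 //.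
have : nm (cexp (rc (s - s') * lam + iang u)) = 1 by rewrite e2 nmN nm1.
rewrite nm_cexp_spiral -[RHS]expR0 => /expR_inj /eqP.
rewrite mulf_eq0 [reC lam == 0]lt_eqF // orbF => /eqP s0.
move: e2; rewrite s0 rc0 mul0r add0r cexp_iang => -[h1 _].
by have := cos_neqN1 hu; rewrite h1 eqxx.
Qed.

(** Only one point of the spiral has the modulus of [Q].  This describes the
    domain by a continuous inequation, hence shows that it is open. *)
Lemma log_domainP (Q : C) : log_domain lam Q <->
  Q != 0 /\ Q + cexp (rc (ln (nm Q) / a) * lam) != 0.
Proof.
have a0 : a != 0 by rewrite lt_eqF.
split=> [[/= Q0 hQ]|[Q0 hQ]]; split => //.
  apply/eqP => e; apply: hQ; exists (ln (nm Q) / a) => //.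
  by rewrite qpowE mulN1r -[RHS](addrK (cexp (rc (ln (nm Q) / a) * lam))) e sub0r.
move=> [s _]; rewrite qpowE mulN1r => e; move/negP: hQ; apply.
have -> : ln (nm Q) / a = s.
  by rewrite -e nmN nm_cexp re_rcM expRK mulfK.
by rewrite -e addNr.
Qed.

Lemma log_domain_open : open (log_domain lam).
Proof.
rewrite openE => Q /log_domainP[Q0 hQ].
pose g (y : C) := y + cexp (rc (ln (nm y) / a) * lam).
have cg : g y @[y --> Q] --> g Q.
  apply: (@cvgDC _ _ (nbhs Q)); first exact: cvg_id.
  apply: (@cvg_cexp _ _ (nbhs Q)); apply: (@cvgMrC _ _ (nbhs Q)).
  apply: (@cvg_rc _ _ (nbhs Q)).
  apply: (@cvgM _ _ (nbhs Q)); last exact: cvg_cst.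
  have nQ : 0 < nm Q by rewrite nm_gt0.
  have h1 : nm y @[y --> Q] --> nm Q by apply: (@cvg_nm _ _ (nbhs Q)); exact: cvg_id.
  exact: (cvg_comp _ _ h1 (continuous_ln nQ)).
have g0 : 0 < nm (g Q) by rewrite nm_gt0.
have n0 : 0 < nm Q by rewrite nm_gt0.
have /(@cvgCP _ _ (nbhs Q)) /(_ _ g0) h := cg.
have h' := nearC Q n0.
apply: (@filterS2 _ (nbhs Q) _ _ _ _ _ h h') => y hy hy'.
apply/log_domainP; split.
  by apply: contraTneq hy' => ->; rewrite sub0r nmN ltxx.
by apply: contraTneq hy; rewrite -/(g y) => ->; rewrite sub0r nmN ltxx.
Qed.

Variable L : C -> C.
Hypothesis hL : is_log_branch lam L.

Lemma L_cont Q : log_domain lam Q -> L y @[y --> Q] --> L Q.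
Proof.
move=> hQ; case: hL => c _ _.
move: c; rewrite (continuous_open_subspace L log_domain_open) => c.
exact: (c Q (mem_set hQ)).
Qed.

Lemma L_exp Q : log_domain lam Q -> cexp (L Q) = Q.
Proof. by case: hL => _ h _; exact: h. Qed.

(** Inverse function rule for [cexp]. *)
Lemma hasd_L Q : log_domain lam Q -> hasd L Q Q^-1.
Proof.
move=> hQ e e0; have Q0 : Q != 0 by case: hQ.
have nQ : 0 < nm Q by rewrite nm_gt0.
have [e1 [e10 e11 e1e]] : exists e1 : R, [/\ 0 < e1, e1 <= 2^-1 & e1 * 2 <= e * nm Q].
  have p : 0 < e * nm Q / 2 by rewrite divr_gt0 // mulr_gt0.
  exists (Num.min 2^-1 (e * nm Q / 2)); split.
  - by rewrite lt_min p invr_gt0 ltr0n.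
  - by rewrite ge_min lexx.
  - by rewrite -ler_pdivlMr // ge_min lexx orbT.
have /nearCP[d d0 hd] := cexp_o e10.
have /(@cvgCP _ _ (nbhs Q)) /(_ _ d0) hc := L_cont hQ.
have ho : \forall y \near Q, log_domain lam y by exact: (open_nbhs_nbhs (conj log_domain_open hQ)).
apply: (@filterS2 _ (nbhs Q) _ _ _ _ _ hc ho) => y hy dy.
set k := L y - L Q in hy *.
have ek : y - Q = Q * (cexp k - 1).
  have -> : y = Q * cexp k by rewrite -{1}(L_exp hQ) -cexpD /k addrC subrK L_exp.
  ring.
have hk : nm (cexp k - 1 - k) <= e1 * nm k by apply: hd; rewrite subr0.
have b1 : nm k <= 2 * nm (cexp k - 1).
  have h1 : nm k <= nm (cexp k - 1) + nm (cexp k - 1 - k).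
    have e' : (cexp k - 1) - (cexp k - 1 - k) = k by ring.
    by have := nmB (cexp k - 1) (cexp k - 1 - k); rewrite e'.
  have h2 : e1 * nm k <= 2^-1 * nm k by apply: ler_wpM2r => //; exact: nm_ge0.
  by lra.
rewrite ek mulKf // nmBC; apply: (le_trans hk).
have h3 := ler_wpM2l (ltW e10) b1; apply: (le_trans h3).
rewrite nmM !mulrA; apply: ler_wpM2r => //; exact: nm_ge0.
Qed.

(** Along the path [exp (t x)] the difference [L (exp (t x)) - t x] is continuous
    and has exponential 1; as 0 is isolated among the logarithms of 1, the set of
    [t] where it vanishes is open and closed in [[0, 1]], and contains 0. *)
Lemma L_polar (s u : R) (x : C) : x = rc s * lam + iang u -> `|u| < pi -> L (cexp x) = x.
Proof.
move=> ex hu.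
pose p (t : R) : C := cexp (rc t * x).
have et t : rc t * x = rc (t * s) * lam + iang (t * u).
  by rewrite ex mulrDr rc_iang mulrA -rcM.
have pdom t : `|t * u| < pi -> log_domain lam (p t) by rewrite /p et => h; exact: polar_dom.
pose f t := L (p t) - rc t * x.
have cp (t : R) : p s @[s --> t] --> p t.
  apply: (@cvg_cexp _ _ (nbhs t)); apply: (@cvgMrC _ _ (nbhs t)).
  by apply: (@cvg_rc _ _ (nbhs t)); exact: cvg_id.
have cf (t : R) : `|t * u| < pi -> f s @[s --> t] --> f t.
  move=> ht; apply: (@cvgBC _ _ (nbhs t)).
    exact: (cvg_comp _ _ (cp t) (L_cont (pdom t ht))).
  by apply: (@cvgMrC _ _ (nbhs t)); apply: (@cvg_rc _ _ (nbhs t)); exact: cvg_id.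
have fexp t : `|t * u| < pi -> cexp (f t) = 1.
  by move=> ht; rewrite /f cexpD cexpN L_exp ?divff ?cexp_neq0 //; exact: pdom.
have near_dom (t : R) : `|t * u| < pi -> \forall s \near t, `|s * u| < pi.
  move=> ht; have c : `|s * u| @[s --> t] --> `|t * u|.
    by apply: cvg_norm; apply: cvgM; [exact: cvg_id|exact: cvg_cst].
  exact: (cvgr_lt _ c).
have inI t : `[0, 1]%classic t -> `|t * u| < pi.
  rewrite /= in_itv /= => /andP[t0 t1]; rewrite normrM ger0_norm //.
  by apply: le_lt_trans hu; rewrite ler_piMl.
have h1 : 0 < 2^-1 :> R by rewrite invr_gt0.
have /nearCP[d d0 hd] := cexp_o h1.
have small z : nm z < d -> cexp z = 1 -> z = 0.
  move=> hz e; have := hd z; rewrite subr0 e subrr sub0r nmN => /(_ hz) h.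
  by apply/eqP; rewrite -nm_eq0; have h0 := nm_ge0 z; apply/eqP; lra.
pose Z := [set t : R | f t = 0].
have Z0 : Z 0.
  rewrite /Z /f /= /p rc0 mul0r cexp0 subr0.
  by case: hL.
have ne : (`[0, 1]%classic `&` Z) !=set0.
  by exists 0; split => //; rewrite /= in_itv /= lexx ler01.
have op : exists2 U : set R, open U & `[0, 1]%classic `&` Z = `[0, 1]%classic `&` U.
  exists (interior Z); first exact: open_interior.
  apply/seteqP; split => t [tI tZ]; split => //; last exact: interior_subset tZ.
  have ht := inI t tI.
  have /(@cvgCP _ _ (nbhs t)) /(_ _ d0) hc := cf t ht.
  apply: (@filterS2 _ (nbhs t) _ _ _ _ _ hc (near_dom t ht)) => t' h h'.
  apply: small; last exact: fexp.
  by move: h; rewrite tZ subr0.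
have cl : exists2 D : set R, closed D & `[0, 1]%classic `&` Z = `[0, 1]%classic `&` D.
  exists (closure (`[0, 1]%classic `&` Z)); first exact: closed_closure.
  apply/seteqP; split => t [tI tZ]; split => //; first by apply: subset_closure; split.
  have ht := inI t tI; apply: contrapT => ft.
  have f0 : 0 < nm (f t) by rewrite nm_gt0; apply/eqP.
  have /(@cvgCP _ _ (nbhs t)) /(_ _ f0) hc := cf t ht.
  have [t' [[_ hZ] h]] := tZ _ hc.
  by move: h; rewrite hZ /= sub0r nmN ltxx.
have H := @segment_connected R 0 1 _ ne op cl.
have : (`[0, 1]%classic `&` Z) 1 by rewrite H /= in_itv /= ler01 lexx.
move=> [_]; rewrite /Z /f /p /= rc1 mul1r => /eqP.
by rewrite subr_eq0 => /eqP.
Qed.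

End LogBranch.

(** * The truncated polynomial ring *)

Section HRing.
Variables (R : realType) (N : nat).
Local Notation C := (Cplx R).
Local Notation HP := {poly %/ (relH R N)}.
Local Notation S u := (limn (series u)).
Local Notation H := (Hcl R N).

Lemma hcoefD b (p q : HP) : hcoef b (p + q) = hcoef b p + hcoef b q.
Proof. by rewrite /hcoef -coefD. Qed.
Lemma hcoefZ b c (p : HP) : hcoef b (c *: p) = c * hcoef b p.
Proof. by rewrite /hcoef -coefZ. Qed.
Lemma hcoef0 b : hcoef b (0 : HP) = 0.
Proof. by rewrite -(scale0r (0 : HP)) hcoefZ mul0r. Qed.
Lemma hcoefN b (p : HP) : hcoef b (- p) = - hcoef b p.
Proof. by rewrite -scaleN1r hcoefZ mulN1r. Qed.
Lemma hcoef_sum b (I : Type) (r : seq I) (P : pred I) (F : I -> HP) :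
  hcoef b (\sum_(i <- r | P i) F i) = \sum_(i <- r | P i) hcoef b (F i).
Proof. exact: (big_morph (hcoef b) (hcoefD b) (hcoef0 b)). Qed.

Lemma hcoef_big b (p : HP) : (N < b)%N -> hcoef b p = 0.
Proof.
move=> h; rewrite /hcoef nth_default //; apply: leq_trans h; rewrite -ltnS.
by apply: leq_trans (size_mk_monic p) _; rewrite mk_monic_hH /relH size_polyXn.
Qed.

Lemma hcoefP (p q : HP) : (forall b, (b <= N)%N -> hcoef b p = hcoef b q) -> p = q.
Proof.
move=> h; apply/val_inj/polyP => b /=; have [bN|Nb] := leqP b N; first exact: h.
by have := hcoef_big p Nb; have := hcoef_big q Nb; rewrite /hcoef => -> ->.
Qed.

Lemma hcoef_in b (p : {poly C}) : (b <= N)%N -> hcoef b (in_qpoly (relH R N) p) = p`_b.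
Proof.
move=> bN; rewrite /hcoef /= mk_monic_hH.
rewrite [in RHS](Pdiv.RingMonic.rdivp_eq (monicXn C N.+1) p) coefD coefMXn.
by rewrite ltnS bN add0r.
Qed.

Lemma hcoefM b (p q : HP) : (b <= N)%N ->
  hcoef b (p * q) = \sum_(i < b.+1) hcoef i p * hcoef (b - i) q.
Proof.
move=> bN; rewrite -[p * q]/(in_qpoly (relH R N) ((p : {poly C}) * (q : {poly C}))).
by rewrite hcoef_in // coefM.
Qed.

Lemma HclX a : H ^+ a = in_qpoly (relH R N) 'X^a.
Proof. by rewrite /Hcl -rmorphXn. Qed.

Lemma hcoef_Xn a b : (b <= N)%N -> hcoef b (H ^+ a) = (b == a)%:R.
Proof. by move=> bN; rewrite HclX hcoef_in // coefXn. Qed.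

Lemma HclN : H ^+ N.+1 = 0.
Proof.
by apply: hcoefP => b bN; rewrite hcoef_Xn // hcoef0 (ltn_eqF (n := N.+1)) // ltnS.
Qed.

Lemma hcoef1 b : (b <= N)%N -> hcoef b (1 : HP) = (b == 0)%:R.
Proof. by move=> bN; rewrite -(expr0 H) hcoef_Xn. Qed.

Lemma hcoef_expand (c : 'I_N.+1 -> C) (b : 'I_N.+1) :
  hcoef b (\sum_(i < N.+1) c i *: H ^+ i) = c b.
Proof.
rewrite hcoef_sum (bigD1 b) //= hcoefZ hcoef_Xn; last by rewrite -ltnS.
rewrite eqxx mulr1 big1 ?addr0 // => i ib; rewrite hcoefZ hcoef_Xn; last by rewrite -ltnS.
by rewrite [_ == _]eq_sym (inj_eq val_inj) (negbTE ib) mulr0.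
Qed.

Lemma hexpand (p : HP) : p = \sum_(i < N.+1) hcoef i p *: H ^+ i.
Proof.
apply: hcoefP => b bN; have bN' : (b < N.+1)%N by [].
by rewrite (@hcoef_expand (fun i => hcoef i p) (Ordinal bN')).
Qed.

Lemma hcoefH b (p : HP) : (b <= N)%N ->
  hcoef b (H * p) = if b is b'.+1 then hcoef b' p else 0.
Proof.
move=> bN; rewrite hcoefM //.
rewrite (eq_bigr (fun i : 'I_b.+1 => (i == 1%N :> nat)%:R * hcoef (b - i) p)); last first.
  by move=> i _; rewrite -{1}[H]expr1 hcoef_Xn // (leq_trans _ bN) // -ltnS.
case: b bN => [|b] bN; first by rewrite big_ord1 mul0r.
rewrite (bigD1 (Ordinal (isT : (1 < b.+2)%N))) //= mul1r subn1 big1 ?addr0 // => i.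
by rewrite -(inj_eq val_inj) /= => /negbTE ->; rewrite mul0r.
Qed.

(** The sum of the moduli of the coordinates, a submultiplicative norm. *)
Definition hn (p : HP) : R := \sum_(b < N.+1) nm (hcoef b p).

Lemma hn_ge0 p : 0 <= hn p. Proof. by apply: sumr_ge0 => b _; exact: nm_ge0. Qed.

Lemma hcoef_le b p : nm (hcoef b p) <= hn p.
Proof.
have [bN|Nb] := leqP b N; last by rewrite hcoef_big // nm0 hn_ge0.
rewrite /hn (bigD1 (Ordinal (bN : (b < N.+1)%N))) //= lerDl.
by apply: sumr_ge0 => i _; exact: nm_ge0.
Qed.

Lemma hnD p q : hn (p + q) <= hn p + hn q.
Proof. by rewrite /hn -big_split; apply: ler_sum => b _; rewrite hcoefD nmD. Qed.

Lemma hnZ c p : hn (c *: p) = nm c * hn p.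
Proof. by rewrite /hn mulr_sumr; apply: eq_bigr => b _; rewrite hcoefZ nmM. Qed.

Lemma hn_sum (I : Type) (r : seq I) (P : pred I) (F : I -> HP) :
  hn (\sum_(i <- r | P i) F i) <= \sum_(i <- r | P i) hn (F i).
Proof.
elim/big_rec2: _ => [|i x y _ h].
  by rewrite /hn big1 // => b _; rewrite hcoef0 nm0.
by apply: (le_trans (hnD _ _)); rewrite lerD2l.
Qed.

Lemma hnX a : hn (H ^+ a) <= 1.
Proof.
rewrite /hn; have [aN|Na] := leqP a N.
  rewrite (bigD1 (Ordinal (aN : (a < N.+1)%N))) //= hcoef_Xn // eqxx nm1.
  rewrite big1 ?addr0 // => i; rewrite -(inj_eq val_inj) /= => /negbTE e.
  by rewrite hcoef_Xn ?e ?nm0 // -ltnS.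
rewrite big1 ?ler01 // => i _; rewrite hcoef_Xn; last by rewrite -ltnS.
by rewrite ltn_eqF ?nm0 //; apply: leq_trans Na; rewrite ltnS -ltnS.
Qed.

Lemma hn1 : hn 1 = 1.
Proof.
rewrite /hn big_ord_recl hcoef1 // nm1 big1 ?addr0 // => i _.
by rewrite hcoef1 ?nm0 // lift0.
Qed.

Lemma hnH p : hn (H * p) <= hn p.
Proof.
rewrite /hn big_ord_recl hcoefH // nm0 add0r big_ord_recr /= -[leLHS]addr0.
apply: lerD; last exact: nm_ge0.
apply: ler_sum => i _; have e : bump 0 i = i.+1 by [].
by rewrite e hcoefH.
Qed.

Lemma hnM p q : hn (p * q) <= hn p * hn q.
Proof.
rewrite {1}(hexpand p) mulr_suml; apply: (le_trans (hn_sum _ _ _)).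
rewrite {2}/hn mulr_suml; apply: ler_sum => i _.
rewrite -scalerAl hnZ; apply: ler_wpM2l; first exact: nm_ge0.
elim: (nat_of_ord i) => [|k IH]; first by rewrite expr0 mul1r.
by rewrite exprS -mulrA; apply: (le_trans (hnH _)).
Qed.

Lemma hn_exp p n : hn (p ^+ n) <= hn p ^+ n.
Proof.
elim: n => [|n IH]; first by rewrite !expr0 hn1.
rewrite !exprS; apply: (le_trans (hnM _ _)).
by apply: ler_wpM2l => //; exact: hn_ge0.
Qed.

Definition hlin (al be : C) : HP := al%:A + be *: H.
(** The finite geometric series for [(al + be H)^-1]. *)
Definition hinv (al be : C) : HP := \sum_(j < N.+1) (al^-1 * (- be / al) ^+ j) *: H ^+ j.

Lemma hlin_hinv al be : al != 0 -> hlin al be * hinv al be = 1.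
Proof.
move=> a0; have -> : hinv al be = al^-1 *: \sum_(j < N.+1) ((- be / al) *: H) ^+ j.
  rewrite /hinv scaler_sumr; apply: eq_bigr => j _.
  by rewrite (exprZn _ H) scalerA.
have -> : hlin al be = - al *: ((- be / al) *: H - 1).
  rewrite /hlin scalerBr scalerA scaleNr opprK addrC; congr (_ *: _ + _).
  by field.
rewrite -scalerAl -scalerAr scalerA -subrX1 (exprZn _ H) HclN scaler0 sub0r.
by rewrite scalerN -scaleNr mulNr opprK divff // scale1r.
Qed.

Lemma hn_hinv_le al be (A : R) : nm be <= 1 -> 1 <= A -> A <= nm al ->
  hn (hinv al be) <= N.+1%:R / A.
Proof.
move=> b1 A1 hA; have A0 : 0 < A by exact: lt_le_trans A1.
have al0 : 0 < nm al by exact: lt_le_trans hA.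
apply: (le_trans (hn_sum _ _ _)).
apply: (@le_trans _ _ (\sum_(j < N.+1) A^-1)); last first.
  by rewrite sumr_const card_ord mulr_natl.
apply: ler_sum => j _; rewrite hnZ nmM nmX nmM nmN !nmV.
have h1 : (nm al)^-1 <= A^-1 by rewrite lef_pV2 ?posrE.
have h2 : nm be / nm al <= 1 by rewrite ler_pdivrMr // mul1r (le_trans b1) // (le_trans A1).
have h3 : (nm be / nm al) ^+ j <= 1 by rewrite exprn_ile1 // divr_ge0 ?nm_ge0.
rewrite -[leRHS]mulr1; apply: ler_pM => //; rewrite ?hn_ge0 ?hnX //.
  by rewrite mulr_ge0 ?exprn_ge0 ?divr_ge0 ?invr_ge0 ?nm_ge0.
rewrite -[leRHS]mulr1; apply: ler_pM => //; first by rewrite invr_ge0 nm_ge0.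
by rewrite exprn_ge0 // divr_ge0 ?nm_ge0.
Qed.

Lemma hn_hinv_bd al be (c : R) : nm be <= 1 -> 0 < c <= 1 -> c <= nm al ->
  hn (hinv al be) <= N.+1%:R * c ^- N.+1.
Proof.
move=> b1 /andP[c0 c1] hc.
have al0 : 0 < nm al by exact: lt_le_trans hc.
have ic : 1 <= c^-1 by rewrite invf_ge1.
apply: (le_trans (hn_sum _ _ _)).
apply: (@le_trans _ _ (\sum_(j < N.+1) c ^- N.+1)); last first.
  by rewrite sumr_const card_ord mulr_natl.
apply: ler_sum => j _; rewrite hnZ nmM nmX nmM nmN !nmV.
have h1 : (nm al)^-1 <= c^-1 by rewrite lef_pV2 ?posrE.
have h2 : nm be / nm al <= c^-1.
  by rewrite -[leRHS]mul1r; apply: ler_pM; rewrite ?nm_ge0 ?invr_ge0 ?nm_ge0.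
rewrite -[leRHS]mulr1; apply: ler_pM => //; rewrite ?hn_ge0 ?hnX //.
  by rewrite mulr_ge0 ?exprn_ge0 ?divr_ge0 ?invr_ge0 ?nm_ge0.
rewrite -exprVn exprS; apply: ler_pM => //; rewrite ?invr_ge0 ?nm_ge0 //.
  by rewrite exprn_ge0 // divr_ge0 ?nm_ge0.
apply: (@le_trans _ _ (c^-1 ^+ j)).
  by apply: lerXn2r; rewrite ?nnegrE ?divr_ge0 ?nm_ge0 // ltW ?invr_gt0.
by apply: ler_weXn2l => //; rewrite -ltnS.
Qed.

Lemma hn_hinv_sum al be :
  hn (hinv al be) <= \sum_(j < N.+1) (nm al)^-1 * (nm be / nm al) ^+ j.
Proof.
apply: (le_trans (hn_sum _ _ _)); apply: ler_sum => j _.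
rewrite hnZ nmM nmX nmM nmN !nmV -[leRHS]mulr1; apply: ler_wpM2l; last exact: hnX.
by rewrite mulr_ge0 ?exprn_ge0 ?divr_ge0 ?invr_ge0 ?nm_ge0.
Qed.

Lemma hn_hlin al be : hn (hlin al be) <= nm al + nm be.
Proof.
apply: (le_trans (hnD _ _)); rewrite !hnZ hn1 mulr1 lerD2l ler_piMr ?nm_ge0 //.
exact: (hnX 1).
Qed.

(** [prod_(r<d) (al_r + be_r H)^-(N+1)].  The coefficients of [Q^d] in both
    J-functions have this form, once [1 - P^-1] is identified with [H]. *)
Definition hW (al be : nat -> C) (d : nat) : HP := \prod_(r < d) hinv (al r) (be r) ^+ N.+1.

Lemma hWS (al be : nat -> C) d : hW al be d.+1 = hinv (al d) (be d) ^+ N.+1 * hW al be d.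
Proof. by rewrite /hW big_ord_recr /= mulrC. Qed.

Lemma hW0 (al be : nat -> C) : hW al be 0 = 1. Proof. by rewrite /hW big_ord0. Qed.

Lemma hlin_hWS (al be : nat -> C) d : al d != 0 ->
  hlin (al d) (be d) ^+ N.+1 * hW al be d.+1 = hW al be d.
Proof. by move=> h; rewrite hWS mulrA -exprMn hlin_hinv // expr1n mul1r. Qed.

Lemma hW_inv (al be : nat -> C) d : (forall r, al r != 0) ->
  (\prod_(r < d) hlin (al r) (be r)) ^+ N.+1 * hW al be d = 1.
Proof.
move=> h; rewrite /hW -prodrXl -big_split /= big1 // => r _.
by rewrite -exprMn hlin_hinv // expr1n.
Qed.

Lemma hn_hWS (al be : nat -> C) d : hn (hW al be d.+1) <= hn (hinv (al d) (be d)) ^+ N.+1 * hn (hW al be d).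
Proof.
rewrite hWS; apply: (le_trans (hnM _ _)); apply: ler_wpM2r; first exact: hn_ge0.
exact: hn_exp.
Qed.

(** The analogue of [geob] for sequences in the ring; it gives the
    convergence of all coordinates and is stable under multiplication. *)
Definition hgeob (u : nat -> HP) :=
  exists (K r : R), 0 <= r < 1 /\ forall d, hn (u d) <= K * r ^+ d.

Lemma hgeob_coef (u : nat -> HP) b : hgeob u -> geob (fun d => hcoef b (u d)).
Proof.
move=> [K [r [hr hu]]]; exists K, r; split => // d.
exact: le_trans (hcoef_le _ _) (hu d).
Qed.

Lemma hgeob_le (c : R) (u v : nat -> HP) : 0 <= c -> hgeob u -> (forall d, hn (v d) <= c * hn (u d)) -> hgeob v.
Proof.
move=> c0 [K [r [hr hu]]] h; exists (c * K), r; split => // d.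
by apply: (le_trans (h d)); rewrite -mulrA; apply: ler_wpM2l.
Qed.

Lemma hcoef_hsum (u : nat -> HP) b : (b <= N)%N -> hcoef b (hsum u) = S (fun d => hcoef b (u d)).
Proof.
move=> bN; have bN' : (b < N.+1)%N by [].
by rewrite /hsum (@hcoef_expand (fun i => S (fun d => hcoef i (u d))) (Ordinal bN')).
Qed.

Lemma hsum_mul (p : HP) (u : nat -> HP) : hgeob u -> p * hsum u = hsum (fun d => p * u d).
Proof.
move=> hu; apply: hcoefP => b bN; rewrite hcoef_hsum // hcoefM //.
under [in RHS]eq_fun do rewrite hcoefM //.
rewrite S_sum => [|i _]; last by apply: geob_scale; exact: hgeob_coef.
apply: eq_bigr => i _; rewrite S_scale; last exact: hgeob_coef.
by rewrite hcoef_hsum // (leq_trans (leq_subr _ _)).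
Qed.

Lemma hsum_add (u v : nat -> HP) : hgeob u -> hgeob v -> hsum u + hsum v = hsum (fun d => u d + v d).
Proof.
move=> hu hv; apply: hcoefP => b bN; rewrite hcoefD !hcoef_hsum //.
under [in RHS]eq_fun do rewrite hcoefD.
by rewrite S_add //; exact: hgeob_coef.
Qed.

Lemma hsum_shift (u : nat -> HP) : hgeob u -> u 0%N = 0 -> hsum u = hsum (fun d => u d.+1).
Proof.
move=> hu u0; apply: hcoefP => b bN; rewrite !hcoef_hsum //.
rewrite S_shift; last exact: hgeob_coef.
by rewrite u0 hcoef0 add0r.
Qed.

End HRing.

(** * The q-difference equation of the K-theoretic J-function *)

Section QDiff.
Variables (R : realType) (N : nat).
Local Notation C := (Cplx R).
Local Notation KP := {poly %/ (relK R N)}.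
Local Notation HP := {poly %/ (relH R N)}.
Local Notation S u := (limn (series u)).
Local Notation H := (Hcl R N).
Local Notation gm := (@gamma R N).

Lemma gm_inj : injective gm. Proof. exact: bij_inj (gamma_bij R N). Qed.

Lemma gmZ c (p : KP) : gm (c *: p) = c *: gm p. Proof. exact: linearZ. Qed.
Lemma gmB (p r : KP) : gm (p - r) = gm p - gm r. Proof. exact: rmorphB. Qed.
Lemma gm1 : gm 1 = 1. Proof. exact: rmorph1. Qed.
Lemma gm0 : gm 0 = 0. Proof. exact: rmorph0. Qed.
Lemma gmM (p r : KP) : gm (p * r) = gm p * gm r. Proof. exact: rmorphM. Qed.

(** [gamma] matches the coordinates in the bases [(1 - P^-1)^b] and [H^b], so that
    K-theoretic computations can be carried out in the cohomology ring. *)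
Lemma kcoef_gamma b (p : KP) : kcoef b p = hcoef b (gm p).
Proof.
have [bN|Nb] := leqP b N; first by rewrite /gamma hcoef_in.
rewrite hcoef_big // /kcoef nth_default // size_comp_poly2.
  by apply: leq_trans Nb; rewrite -ltnS (leq_trans (size_mk_monic p)) // mk_monic_hK /relK -polyC1 size_exp_XsubC.
by rewrite -opprB size_polyN -polyC1 size_XsubC.
Qed.

Lemma gammaXn a : gm ((1 - Pinv R N) ^+ a) = H ^+ a.
Proof. by rewrite rmorphXn /= gamma_1subPinv. Qed.

Lemma gamma_ksum (u : nat -> KP) : gm (ksum u) = hsum (fun d => gm (u d)).
Proof.
rewrite /ksum /hsum raddf_sum /=; apply: eq_bigr => b _.
rewrite linearZ /= gammaXn; congr (_ *: _).
have -> // : (fun d => kcoef b (u d)) = (fun d => hcoef b (gm (u d))).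
by apply/funext => d; rewrite kcoef_gamma.
Qed.

Lemma gammaV (p : KP) (X : HP) : gm p * X = 1 -> gm p^-1 = X.
Proof.
have [g gK Kg] := gamma_bij R N => h.
have e : p * g X = 1 by apply: gm_inj; rewrite rmorphM rmorph1 /= Kg.
by rewrite (mulr1_eq e) Kg.
Qed.

Lemma gamma_Pinv : gm (Pinv R N) = 1 - H.
Proof. by rewrite -gamma_1subPinv rmorphB rmorph1 /= subKr. Qed.

Lemma subKr_lin (c : C) : 1 - c *: (1 - H) = hlin N (1 - c) c.
Proof.
by rewrite /hlin scalerBr scalerBl !scale1r opprB addrA addrAC.
Qed.

(** [1 - q^(r+1) P^-1] corresponds to [jal q r + jbe q r H]. *)
Definition jal (q : C) (r : nat) : C := 1 - q ^+ r.+1.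
Definition jbe (q : C) (r : nat) : C := q ^+ r.+1.
Local Notation W q := (hW N (jal q) (jbe q)).

Section FixQ.
Variable q : C.
Hypotheses (q0 : q != 0) (q1 : nm q < 1).

Lemma jal_neq0 r : jal q r != 0. Proof. exact: oneBq_neq0. Qed.

Lemma gamma_JKterm Q d : gm (JK_term N q Q d) = Q ^+ d *: W q d.
Proof.
rewrite linearZ /=; congr (_ *: _); apply: gammaV.
rewrite rmorphXn /= rmorph_prod /=.
rewrite (eq_bigr (fun r : 'I_d => hlin N (jal q r) (jbe q r))) ?hW_inv //.
  exact: jal_neq0.
move=> r _; rewrite scalerA -exprSr gmB gm1 gmZ gamma_Pinv.
exact: subKr_lin.
Qed.

(** The norm of the factor [(1 - q^r P^-1)^-(N+1)] tends to 1, so the ratio of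
    consecutive terms is eventually close to [nm x]. *)
Lemma hgeob_W x : nm x < 1 -> hgeob (fun d => x ^+ d *: W q d).
Proof.
move=> x1.
pose B r := \sum_(j < N.+1) (nm (1 - q ^+ r))^-1 * (nm (q ^+ r) / nm (1 - q ^+ r)) ^+ j.
have qc : q ^+ r @[r --> \oo] --> (0 : C) := cvg_qpow0 q1.
have hB : B r @[r --> \oo] --> (1 : R).
  have l1 : nm (1 - q ^+ r) @[r --> \oo] --> (1 : R).
    have h : nm (1 - q ^+ r) @[r --> \oo] --> nm (1 - 0 : C).
      by apply: cvg_nm; apply: cvgBC; [exact: cvg_cst|exact: qc].
    by rewrite subr0 nm1 in h; exact: h.
  have l2 : (nm (1 - q ^+ r))^-1 @[r --> \oo] --> (1 : R).
    rewrite -[X in _ --> X]invr1; apply: cvgV => //; exact: oner_neq0.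
  have l3 : nm (q ^+ r) / nm (1 - q ^+ r) @[r --> \oo] --> (0 : R).
    have h : nm (q ^+ r) @[r --> \oo] --> nm (0 : C) by apply: cvg_nm; exact: qc.
    rewrite nm0 in h; rewrite -[X in _ --> X](mul0r 1); exact: cvgM h l2.
  have -> : (1 : R) = \sum_(j < N.+1) 1 * (0 : R) ^+ j.
    rewrite big_ord_recl expr0 mulr1 big1 ?addr0 // => i _.
    by rewrite lift0 expr0n mulr0.
  rewrite /B; elim: (index_enum _) => [|j s IH].
    by under eq_fun do rewrite big_nil; rewrite big_nil; exact: cvg_cst.
  under eq_fun do rewrite big_cons /=; rewrite big_cons /=.
  apply: cvgD; last exact: IH.
  apply: cvgM; first exact: l2.
  elim: (nat_of_ord j) => [|k IHk].
    by under eq_fun do rewrite expr0; rewrite expr0; exact: cvg_cst.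
  under eq_fun do rewrite exprS; rewrite exprS; exact: cvgM l3 IHk.
pose rho := (nm x + 1) / 2.
have xr : nm x < rho by rewrite /rho; lra.
have r0 : 0 < rho by have := nm_ge0 x; rewrite /rho; lra.
have hBx : B r ^+ N.+1 * nm x @[r --> \oo] --> nm x.
  rewrite -[X in _ --> X](mul1r (nm x)); apply: cvgM; last exact: cvg_cst.
  rewrite -(expr1n _ N.+1); elim: (N.+1) => [|k IHk].
    by under eq_fun do rewrite expr0; rewrite expr0; exact: cvg_cst.
  under eq_fun do rewrite exprS; rewrite exprS; exact: cvgM hB IHk.
have [n0 _ hn0] := cvgr_lt _ hBx _ xr.
have [K hK] : exists K, forall d, hn (x ^+ d *: W q d) <= K * rho ^+ d.
  apply: (@ratio_ev _ (fun d => hn (x ^+ d *: W q d)) rho n0) => // [d|d hd].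
    exact: hn_ge0.
  rewrite !hnZ exprS nmM -mulrA mulrCA mulrA.
  have h1 := hn0 d.+1 (leq_trans hd (leqnSn d)); rewrite /= in h1.
  have h2 : hn (hinv N (jal q d) (jbe q d)) ^+ N.+1 <= B d.+1 ^+ N.+1.
    apply: lerXn2r; rewrite ?nnegrE ?hn_ge0 //; last exact: hn_hinv_sum.
    by apply: sumr_ge0 => j _; rewrite mulr_ge0 ?exprn_ge0 ?divr_ge0 ?invr_ge0 ?nm_ge0.
  rewrite -mulrA [leRHS]mulrCA; apply: ler_wpM2l; first exact: nm_ge0.
  apply: (le_trans (ler_wpM2l (nm_ge0 x) (hn_hWS N (jal q) (jbe q) d))).
  rewrite mulrA; apply: ler_wpM2r; first exact: hn_ge0.
  apply: le_trans (ltW h1); rewrite mulrC; apply: ler_wpM2r => //; exact: nm_ge0.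
by exists K, rho; split => //; rewrite (ltW r0) /= /rho; lra.
Qed.

Lemma cbinomS (l : C) k : cbinom (l + 1) k.+1 = cbinom l k.+1 + cbinom l k.
Proof.
have key : \prod_(r < k.+1) (l + 1 - r%:R) = (l + 1) * \prod_(r < k) (l - r%:R).
  rewrite big_ord_recl subr0; congr (_ * _); apply: eq_bigr => i _.
  by rewrite lift0 -natr1; ring.
rewrite /cbinom key big_ord_recr /= factS natrM.
have f0 : (k`!%:R : C) != 0 by rewrite pnatr_eq0 -lt0n fact_gt0.
have k0 : (k.+1%:R : C) != 0 by rewrite pnatr_eq0.
set P := \prod_(_ < k) _; rewrite -[k.+1%:R]natr1 in k0 *.
by field; rewrite f0.
Qed.

(** [P^(- l)], for a complex exponent [l], read in the cohomology ring. *)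
Definition Pell (l : C) : HP := \sum_(k < N.+1) ((-1) ^+ k * cbinom l k) *: H ^+ k.

Lemma hcoef_Pell l b : (b <= N)%N -> hcoef b (Pell l) = (-1) ^+ b * cbinom l b.
Proof.
move=> bN; have bN' : (b < N.+1)%N by [].
by rewrite /Pell (hcoef_expand (fun i => (-1) ^+ i * cbinom l i) (Ordinal bN')).
Qed.

(** [P^(- l - 1) = P^-1 P^(- l)], by Pascal's rule. *)
Lemma Pell_succ l : Pell (l + 1) = (1 - H) * Pell l.
Proof.
apply: hcoefP => b bN; rewrite mulrBl mul1r hcoefD hcoefN hcoefH // !hcoef_Pell //.
case: b bN => [|b] bN.
  by rewrite /cbinom !big_ord0 subr0.
by rewrite hcoef_Pell ?(ltnW bN) // cbinomS exprS; ring.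
Qed.

Lemma gamma_JK x : gm (JK N q x) = Pell (ellq q x) * hsum (fun d => x ^+ d *: W q d).
Proof.
rewrite /JK gmM gamma_ksum; congr (_ * hsum _).
  by rewrite raddf_sum; apply: eq_bigr => k _; rewrite -gammaXn -gmZ.
by apply/funext => d; exact: gamma_JKterm.
Qed.

Let D (x : C) := [/\ x != 0, nm x < 1 & theta q x != 0].

Lemma D_q x : D x -> D (q * x).
Proof.
move=> [x0 x1 t0]; split; first exact: mulf_neq0.
  by rewrite nmM; apply: le_lt_trans x1; rewrite ler_piMl ?nm_ge0 // ltW.
by have := theta_qn q0 q1 1 x0 t0; rewrite expr1.
Qed.

(** Coefficient of [Q^d] after [k] applications of [1 - q^(Q d_Q)]. *)
Definition qterm (k d : nat) : HP := hlin N (1 - q ^+ d) (q ^+ d) ^+ k * W q d.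

Lemma hgeob_qterm k x : nm x < 1 -> hgeob (fun d => x ^+ d *: qterm k d).
Proof.
move=> x1; apply: (@hgeob_le _ _ (3 ^+ k) (fun d => x ^+ d *: W q d)).
- by rewrite exprn_ge0.
- exact: hgeob_W.
move=> d; rewrite !hnZ mulrCA; apply: ler_wpM2l; first exact: nm_ge0.
apply: (le_trans (hnM _ _)); apply: ler_wpM2r; first exact: hn_ge0.
apply: (le_trans (hn_exp _ _)); apply: lerXn2r; rewrite ?nnegrE ?hn_ge0 //.
apply: (le_trans (hn_hlin _ _ _)).
have h1 : nm (1 - q ^+ d) <= 1 + nm (q ^+ d) by have := nmB 1 (q ^+ d); rewrite nm1.
have h2 : nm (q ^+ d) <= 1 by rewrite nmX exprn_ile1 ?nm_ge0 // ltW.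
lra.
Qed.

(** [q^(Q d_Q)] multiplies [P^(- ell_q) Q^d] by [q^d P^-1]. *)
Lemma qdiff_step k x : D x ->
  Pell (ellq q x) * hsum (fun d => x ^+ d *: qterm k d) -
  Pell (ellq q (q * x)) * hsum (fun d => (q * x) ^+ d *: qterm k d) =
  Pell (ellq q x) * hsum (fun d => x ^+ d *: qterm k.+1 d).
Proof.
move=> Dx; have [x0 x1 t0] := Dx; have [qx0 qx1 qt0] := D_q Dx.
rewrite ellq_q // Pell_succ [(1 - H) * _]mulrC -mulrA -mulrBr; congr (_ * _).
rewrite hsum_mul; last exact: hgeob_qterm.
have g1 := hgeob_qterm k x1; have g2 := hgeob_qterm k qx1.
have g3 : hgeob (fun d => - ((1 - H) * ((q * x) ^+ d *: qterm k d))).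
  apply: (@hgeob_le _ _ 2 (fun d => (q * x) ^+ d *: qterm k d)) => // d.
  rewrite -scaleN1r hnZ nmN nm1 mul1r; apply: (le_trans (hnM _ _)).
  apply: ler_wpM2r; first exact: hn_ge0.
  have -> : 1 - H = hlin N 1 (-1) by rewrite /hlin scale1r scaleN1r.
  by apply: (le_trans (hn_hlin _ _ _)); rewrite nmN nm1.
have -> : - hsum (fun d => (1 - H) * ((q * x) ^+ d *: qterm k d)) =
    hsum (fun d => - ((1 - H) * ((q * x) ^+ d *: qterm k d))).
  have := @hsum_mul _ N (-1) (fun d => (1 - H) * ((q * x) ^+ d *: qterm k d)).
  rewrite mulN1r => ->.
    by congr hsum; apply/funext => d; rewrite mulN1r.
  apply: (@hgeob_le _ _ 1 _ _ _ g3) => // d.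
  by rewrite mul1r -[in leLHS](opprK (_ * _)) -scaleN1r hnZ nmN nm1 mul1r.
rewrite hsum_add //; congr hsum; apply/funext => d.
have -> : qterm k.+1 d = qterm k d - q ^+ d *: ((1 - H) * qterm k d).
  have -> : qterm k.+1 d = hlin N (1 - q ^+ d) (q ^+ d) * qterm k d by rewrite /qterm exprS mulrA.
  by rewrite -subKr_lin mulrBl mul1r scalerAl.
by rewrite scalerBr scalerA -exprMn -scalerAr [x * q]mulrC.
Qed.

Lemma qterm0 : qterm 0 = W q. Proof. by apply/funext => d; rewrite /qterm expr0 mul1r. Qed.

Lemma qdiff_iter k x : D x ->
  gm (iter k (fun (g : C -> KP) x => g x - g (q * x)) (JK N q) x) =
  Pell (ellq q x) * hsum (fun d => x ^+ d *: qterm k d).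
Proof.
elim: k x => [|k IH] x Dx; first by rewrite /= gamma_JK qterm0.
rewrite iterS gmB (IH x Dx) (IH _ (D_q Dx)); exact: qdiff_step.
Qed.

(** After [N + 1] applications the term of degree 0 vanishes since
    [(1 - P^-1)^(N+1) = 0], and the others are those of the series multiplied by
    [x]. *)
Lemma qeq_JK x : x != 0 -> nm x < 1 -> theta q x != 0 -> qeq_at q (@JK R N q) x.
Proof.
move=> x0 x1 t0; have Dx : D x by [].
rewrite /qeq_at; apply: gm_inj; rewrite gmB gm0 gmZ qdiff_iter //.
rewrite gamma_JK scalerAr; apply/eqP; rewrite subr_eq0; apply/eqP; congr (_ * _).
rewrite hsum_shift; last first.
- by rewrite /qterm !expr0 subrr /hlin scale0r add0r !scale1r HclN mul0r.
- exact: hgeob_qterm.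
have -> : x *: hsum (fun d => x ^+ d *: W q d) = x%:A * hsum (fun d => x ^+ d *: W q d).
  by rewrite -scalerAl mul1r.
rewrite hsum_mul; last exact: hgeob_W.
congr hsum; apply/funext => d.
rewrite /qterm -[1 - q ^+ d.+1]/(jal q d) -[q ^+ d.+1]/(jbe q d).
by rewrite hlin_hWS ?jal_neq0 // -scalerAl mul1r exprS scalerA.
Qed.

End FixQ.
End QDiff.

(** * The differential equation of the cohomological J-function *)

Section Differential.
Variables (R : realType) (N : nat).
Local Notation C := (Cplx R).
Local Notation HP := {poly %/ (relH R N)}.
Local Notation S u := (limn (series u)).
Local Notation H := (Hcl R N).

(** Coordinatewise derivative of a function with values in the cohomology ring. *)
Definition hder (f : C -> HP) (x : C) (p : HP) :=
  forall b, is_derive x (1 : C) (fun y => hcoef b (f y)) (hcoef b p).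

Lemma hderP (f : C -> HP) x p :
  (forall b, (b <= N)%N -> is_derive x (1 : C) (fun y => hcoef b (f y)) (hcoef b p)) ->
  hder f x p.
Proof.
move=> h b; have [bN|Nb] := leqP b N; first exact: h.
have -> : (fun y => hcoef b (f y)) = cst 0 by apply/funext => y; rewrite hcoef_big.
rewrite hcoef_big //; exact: is_derive_cst.
Qed.

Lemma hderM (f g : C -> HP) x p r : hder f x p -> hder g x r ->
  hder (fun y => f y * g y) x (f x * r + g x * p).
Proof.
move=> hf hg; apply: hderP => b bN.
have -> : (fun y => hcoef b (f y * g y)) =
    \sum_(i < b.+1) ((fun y => hcoef i (f y)) * (fun y => hcoef (b - i) (g y))).
  by apply/funext => y; rewrite hcoefM // fct_sumE.
have -> : hcoef b (f x * r + g x * p) = \sum_(i < b.+1)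
   (hcoef i (f x) *: hcoef (b - i) r + hcoef (b - i) (g x) *: hcoef i p).
  rewrite hcoefD [g x * p]mulrC !hcoefM // -big_split /=; apply: eq_bigr => i _.
  by rewrite [hcoef i p * _]mulrC.
by apply: is_derive_sum => i; apply: is_deriveM.
Qed.

Lemma hder_near (f g : C -> HP) x p : (\forall y \near x, f y = g y) ->
  hder f x p -> hder g x p.
Proof.
move=> h hf b; apply: near_eq_is_derive (hf b).
by apply: filterS h => y ->.
Qed.

Lemma zQd_hder z f x p : hder f x p -> zQd z f x = (z * x) *: p.
Proof.
move=> hf; rewrite [p in RHS]hexpand scaler_sumr /zQd; apply: eq_bigr => b _.
by rewrite scalerA derive1E (derive_val (is_derive := hf b)).
Qed.

Lemma hder_derivable f x p b : hder f x p -> derivable (fun y => hcoef b (f y)) x 1.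
Proof. by move=> h; case: (h b). Qed.

Definition hentire (v : nat -> HP) :=
  forall rho : R, 0 < rho -> exists K, forall d, hn (v d) <= K * rho ^+ d.

Lemma hentire_coef v b : hentire v -> entire (fun d => hcoef b (v d)).
Proof.
move=> hv rho r0; have [K hK] := hv _ r0; exists K => d.
exact: le_trans (hcoef_le _ _) (hK d).
Qed.

Lemma hentire_geob v x : hentire v -> hgeob (fun d => x ^+ d *: v d).
Proof.
move=> hv; have a0 : 0 < nm x + 1 by have := nm_ge0 x; lra.
have a2 : 0 < (nm x + 1)^-1 / 2 by rewrite divr_gt0 ?invr_gt0.
have [K hK] := hv _ a2.
exists K, 2^-1; split; first by lra.
move=> d; have K0 : 0 <= K by have := hK 0%N; rewrite expr0 mulr1; apply: le_trans; exact: hn_ge0.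
rewrite hnZ nmX; apply: (le_trans (ler_wpM2l (exprn_ge0 _ (nm_ge0 _)) (hK d))).
rewrite mulrCA; apply: ler_wpM2l => //; rewrite -exprMn.
apply: lerXn2r; rewrite ?nnegrE ?mulr_ge0 ?invr_ge0 ?nm_ge0 ?(ltW a0) //.
rewrite mulrA -[leRHS]mul1r; apply: ler_wpM2r; first by lra.
by rewrite ler_pdivrMr // mul1r; lra.
Qed.

Lemma hder_hsum v x : hentire v -> x != 0 ->
  hder (fun y => hsum (fun d => y ^+ d *: v d)) x
       (x^-1 *: hsum (fun d => x ^+ d *: (d%:R *: v d))).
Proof.
move=> hv x0; apply: hderP => b bN.
have e := hentire_coef b hv.
have hd := hasd_is_derive (hasd_pseries x e).
have -> : (fun y => hcoef b (hsum (fun d => y ^+ d *: v d))) =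
   (fun y => S (fun d => hcoef b (v d) * y ^+ d)).
  apply/funext => y; rewrite hcoef_hsum //; congr (limn _); congr series.
  by apply/funext => d; rewrite hcoefZ mulrC.
have -> // : hcoef b (x^-1 *: hsum (fun d => x ^+ d *: (d%:R *: v d))) =
  S (fun d => hcoef b (v d) * (d%:R * x ^+ d.-1)).
rewrite hcoefZ hcoef_hsum // -[RHS](mulKf x0); congr (_ * _).
have -> : (fun d => hcoef b (x ^+ d *: (d%:R *: v d))) =
   (fun d => d%:R * hcoef b (v d) * x ^+ d).
  by apply/funext => d; rewrite !hcoefZ; ring.
by rewrite weight_pred.
Qed.

Section Log.
Variables (lam : C) (L : C -> C) (z : C).
Hypothesis lam0 : reC lam < 0.
Hypothesis hL : is_log_branch lam L.
Hypothesis z0 : z != 0.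
Local Notation dom := (log_domain lam).

(** [Q^(H/z)]. *)
Definition QHz (x : C) : HP := \sum_(k < N.+1) (k`!%:R)^-1 *: ((L x / z) *: H) ^+ k.

Lemma hcoef_QHz x b : (b <= N)%N -> hcoef b (QHz x) = (b`!%:R)^-1 * (L x / z) ^+ b.
Proof.
move=> bN; have bN' : (b < N.+1)%N by [].
rewrite /QHz (eq_bigr (fun k : 'I_N.+1 => ((k`!%:R)^-1 * (L x / z) ^+ k) *: H ^+ k)).
  by rewrite (hcoef_expand (fun i : 'I_N.+1 => (i`!%:R)^-1 * (L x / z) ^+ i) (Ordinal bN')).
by move=> k _; rewrite (exprZn _ H) scalerA.
Qed.

Lemma hder_QHz x : dom x -> hder QHz x ((z * x)^-1 *: (H * QHz x)).
Proof.
move=> dx; have x0 : x != 0 by case: dx.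
have hd := hasd_is_derive (hasd_L lam0 hL dx).
apply: hderP => b bN.
have -> : (fun y => hcoef b (QHz y)) = ((b`!%:R)^-1 * z ^- b) \*: (L ^+ b).
  apply/funext => y; rewrite hcoef_QHz //= expr_div_n.
  rewrite -[_ *: (_ y)]/(_ * (L ^+ b) y) fctE; ring.
have h := is_deriveZ ((b`!%:R)^-1 * z ^- b) (is_deriveX b hd).
have -> // : hcoef b ((z * x)^-1 *: (H * QHz x)) =
  ((b`!%:R)^-1 * z ^- b) *: ((b%:R * L x ^+ b.-1) *: x^-1).
rewrite hcoefZ hcoefH // -![_ *: _]/(_ * _).
case: b bN {h} => [|b] bN; first by rewrite mulr0 !mul0r mulr0.
rewrite hcoef_QHz ?(ltnW bN) // factS natrM expr_div_n exprS /=.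
have b0 : (b.+1%:R : C) != 0 by rewrite pnatr_eq0.
have f0 : (b`!%:R : C) != 0 by rewrite pnatr_eq0 -lt0n fact_gt0.
move: (b.+1%:R : C) b0 => c c0.
by field; rewrite f0 x0 z0 expf_neq0.
Qed.

(** [r z + H] is the factor of index [r] of the cohomological J-function; indices
    are shifted by one to start from 0. *)
Definition cal (r : nat) : C := r.+1%:R * z.
Local Notation W := (hW N cal (fun _ => 1)).

Lemma cal_neq0 r : cal r != 0.
Proof. by rewrite mulf_neq0 // pnatr_eq0. Qed.

Lemma Jcoh_termE x d : Jcoh_term N z x d = x ^+ d *: W d.
Proof.
rewrite /Jcoh_term; congr (_ *: _).
rewrite big_add1 /= big_mkord.
have -> : \prod_(i < d) (H + (i.+1%:R * z)%:A) ^+ N.+1 =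
   (\prod_(r < d) hlin N (cal r) 1) ^+ N.+1.
  rewrite -prodrXl; apply: eq_bigr => i _; congr (_ ^+ _).
  by rewrite /hlin scale1r addrC.
by apply: mulr1_eq; exact: (@hW_inv _ N cal (fun _ => 1) d cal_neq0).
Qed.

Lemma hentire_W : hentire W.
Proof.
move=> rho r0.
pose rho1 := Num.min rho 1.
have r10 : 0 < rho1 by rewrite lt_min r0 ltr01.
have nz : 0 < nm z by rewrite nm_gt0.
pose n0 := (Num.trunc (Num.max 1 (N.+1%:R / rho1) / nm z)).+1.
apply: (@ratio_ev _ (fun d => hn (W d)) rho n0) => // [d|d hd]; first exact: hn_ge0.
apply: (le_trans (hn_hWS _ _ _ _)); apply: ler_wpM2r; first exact: hn_ge0.
have hA : Num.max 1 (N.+1%:R / rho1) <= nm (cal d).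
  rewrite nmM nm_nat -ler_pdivrMr //.
  have t0 : 0 <= Num.max 1 (N.+1%:R / rho1) / nm z.
    by rewrite divr_ge0 ?nm_ge0 // le_max ler01.
  apply: (le_trans (ltW (truncnS_gt _))); rewrite ler_nat.
  exact: leq_trans hd (leqnSn d).
move: hA; rewrite ge_max => /andP[A1 A2].
have h1 : hn (hinv N (cal d) 1) <= rho1.
  apply: (le_trans (hn_hinv_le N (be := 1) _ A1 (lexx _))); first by rewrite nm1.
  have A0 : 0 < nm (cal d) by exact: lt_le_trans A1.
  by rewrite ler_pdivrMr // mulrC -ler_pdivrMr.
have h2 : rho1 <= 1 by rewrite ge_min lexx orbT.
apply: (@le_trans _ _ (rho1 ^+ N.+1)).
  by apply: lerXn2r; rewrite ?nnegrE ?hn_ge0 // ltW.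
rewrite exprS; apply: (@le_trans _ _ (rho1 * 1)).
  by apply: ler_wpM2l; [exact: ltW|rewrite exprn_ile1 // ltW].
by rewrite mulr1 ge_min lexx.
Qed.

(** Coefficient of [Q^d] after [k] applications of [z Q d_Q]. *)
Definition dterm (k d : nat) : HP := hlin N (d%:R * z) 1 ^+ k * W d.

Lemma hentire_dterm k : hentire (dterm k).
Proof.
elim: k => [|k IH].
  by have := hentire_W; congr hentire; apply/funext => d; rewrite /dterm expr0 mul1r.
move=> rho r0; have r2 : 0 < rho / 2 by rewrite divr_gt0.
have [K hK] := IH _ r2; exists ((nm z + 1) * K) => d.
have K0 : 0 <= K by have := hK 0%N; rewrite expr0 mulr1; apply: le_trans; exact: hn_ge0.
rewrite /dterm exprS -mulrA; apply: (le_trans (hnM _ _)).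
have h1 : hn (hlin N (d%:R * z) 1) <= (nm z + 1) * 2 ^+ d.
  apply: (le_trans (hn_hlin _ _ _)); rewrite nm1 nmM nm_nat mulrDl mul1r; apply: lerD.
    by rewrite mulrC; apply: ler_wpM2l; [exact: nm_ge0|exact: natX2].
  by rewrite exprn_ege1 // ler1n.
apply: (le_trans (ler_pM (hn_ge0 _) (hn_ge0 _) h1 (hK d))).
rewrite expr_div_n le_eqVlt; apply/orP; left; apply/eqP.
by field; rewrite expf_neq0 // pnatr_eq0.
Qed.

Lemma dtermS k d : dterm k.+1 d = H * dterm k d + z *: (d%:R *: dterm k d).
Proof.
rewrite /dterm exprS -mulrA -[in RHS]/(dterm k d); set V := _ * W d.
rewrite /hlin mulrDl scale1r addrC; congr (_ + _).
by rewrite -scalerAl mul1r scalerA mulrC.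
Qed.

Definition Jcoh_iter k (x : C) : HP := QHz x * hsum (fun d => x ^+ d *: dterm k d).

(** [z Q d_Q] multiplies [Q^(H/z)] by [H] and [Q^d] by [d z]. *)
Lemma hder_Jcoh_iter k x : dom x -> hder (Jcoh_iter k) x ((z * x)^-1 *: Jcoh_iter k.+1 x).
Proof.
move=> dx; have x0 : x != 0 by case: dx.
have := hderM (hder_QHz dx) (hder_hsum (hentire_dterm k) x0).
congr hder; rewrite /Jcoh_iter.
have g := hentire_geob x (hentire_dterm k).
have g1 : hgeob (fun d => x ^+ d *: (d%:R *: dterm k d)).
  apply: hentire_geob => rho r0; have r2 : 0 < rho / 2 by rewrite divr_gt0.
  have [K hK] := hentire_dterm k r2; exists K => d.
  have K0 : 0 <= K by have := hK 0%N; rewrite expr0 mulr1; apply: le_trans; exact: hn_ge0.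
  rewrite hnZ nm_nat; apply: (le_trans (ler_pM (ler0n _ _) (hn_ge0 _) (natX2 R d) (hK d))).
  rewrite expr_div_n le_eqVlt; apply/orP; left; apply/eqP.
  by field; rewrite expf_neq0 // pnatr_eq0.
have -> : hsum (fun d => x ^+ d *: dterm k.+1 d) =
  H * hsum (fun d => x ^+ d *: dterm k d) + z *: hsum (fun d => x ^+ d *: (d%:R *: dterm k d)).
  have -> : z *: hsum (fun d => x ^+ d *: (d%:R *: dterm k d)) =
     z%:A * hsum (fun d => x ^+ d *: (d%:R *: dterm k d)) by rewrite -scalerAl mul1r.
  rewrite !hsum_mul // hsum_add.
  - congr hsum; apply/funext => d; rewrite dtermS scalerDr; congr (_ + _).
      by rewrite scalerAr.
    by rewrite -scalerAl mul1r !scalerA; congr (_ *: _); ring.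
  - by apply: (@hgeob_le _ _ 1 _ _ ler01 g) => d; rewrite mul1r hnH.
  - apply: (@hgeob_le _ _ (nm z) _ _ (nm_ge0 z) g1) => d.
    by rewrite -scalerAl mul1r hnZ.
rewrite mulrDr scalerDr addrC; congr (_ + _).
  move: (QHz x) (hsum _) => E F; rewrite -scalerAr.
  by have -> : F * (H * E) = E * (H * F) by rewrite mulrC [RHS]mulrCA mulrA.
by rewrite -!scalerAr scalerA; congr (_ *: _); field; rewrite x0 z0.
Qed.

Lemma Jcoh_iter0 x : Jcoh N L z x = Jcoh_iter 0 x.
Proof.
rewrite /Jcoh /Jcoh_iter; congr (_ * hsum _); apply/funext => d.
by rewrite Jcoh_termE /dterm expr0 mul1r.
Qed.

(** The induction needs the identity near [x], not only at [x]: the domain of the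
    logarithm is open. *)
Lemma zQd_iter k x : dom x -> iter k (zQd z) (@Jcoh R N L z) x = Jcoh_iter k x.
Proof.
elim: k x => [|k IH] x dx; first exact: Jcoh_iter0.
have x0 : x != 0 by case: dx.
rewrite iterS (@zQd_hder _ _ _ ((z * x)^-1 *: Jcoh_iter k.+1 x)).
  by rewrite scalerA divff ?scale1r // mulf_neq0.
apply: hder_near (hder_Jcoh_iter k dx).
have ho : \forall y \near x, dom y by exact: (open_nbhs_nbhs (conj (log_domain_open lam0) dx)).
by apply: filterS ho => y dy; rewrite IH.
Qed.

Lemma deq_Jcoh x : dom x -> deq_at z (@Jcoh R N L z) x.
Proof.
move=> dx; have ho : \forall y \near x, dom y.
  by exact: (open_nbhs_nbhs (conj (log_domain_open lam0) dx)).
split.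
  move=> k b kN; apply: (@hder_derivable _ _ ((z * x)^-1 *: Jcoh_iter k.+1 x)).
  apply: hder_near (hder_Jcoh_iter k dx).
  by apply: filterS ho => y dy; rewrite zQd_iter.
rewrite zQd_iter // Jcoh_iter0 /Jcoh_iter scalerAr; apply/eqP; rewrite subr_eq0; apply/eqP.
congr (_ * _); rewrite hsum_shift; last first.
- by rewrite /dterm mul0r /hlin scale0r add0r !scale1r HclN mul0r ?scaler0.
- exact: hentire_geob (hentire_dterm _).
have -> : x *: hsum (fun d => x ^+ d *: dterm 0 d) = x%:A * hsum (fun d => x ^+ d *: dterm 0 d).
  by rewrite -scalerAl mul1r.
rewrite hsum_mul; last exact: hentire_geob (hentire_dterm _).
congr hsum; apply/funext => d; rewrite -scalerAl mul1r scalerA -exprS; congr (_ *: _).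
rewrite /dterm expr0 mul1r -[d.+1%:R * z]/(cal d).
by rewrite (hlin_hWS N (fun _ => 1) (cal_neq0 d)).
Qed.

End Log.
End Differential.

(** * Confluence of the systems *)

Section PolynomialEntries.
Variable R : realType.
Local Notation C := (Cplx R).
Local Notation CQ := {fraction {poly C}}.
Local Notation pmx P := (map_mx (@FracField.tofrac {poly C}) P).

(** The representative chosen for the fraction [p / 1] is some [b p / b]; dividing
    by the gcd leaves a nonzero constant in both places. *)
Lemma rnum_rden (p : {poly C}) : exists2 c : C, c != 0 &
  rnum (tofrac p) = c *: p /\ rden (tofrac p) = c%:P.
Proof.
have e : (frac (repr (tofrac p))).1 = (frac (repr (tofrac p))).2 * p.
  have := FracField.equivf_l (Ratio p 1).
  by rewrite !numden_Ratio ?oner_neq0 // mulr1; unlock tofrac.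
have d0 := denom_ratioP (repr (tofrac p)).
rewrite /rnum /rden.
move: e d0; move: (frac _) => [a b] /= e d0.
have gb : gcdp a b %= b by rewrite e; exact: eqp_trans (gcdpC _ _) (gcdp_mulr _ _).
have [c c0 gE] : exists2 c : C, c != 0 & gcdp a b = c *: b.
  have /eqpfP h := gb; exists (lead_coef (gcdp a b) / lead_coef b); last exact: h.
  rewrite mulf_neq0 ?invr_neq0 ?lead_coef_eq0 //.
  by rewrite gcdp_eq0 negb_and d0 orbT.
exists c^-1; first by rewrite invr_neq0.
split; rewrite gE divpZr ?c0 //.
  by rewrite e mulrC mulpK.
by rewrite divpp // -[RHS]mulr1 mul_polyC.
Qed.

Lemma reval_tofrac (p : {poly C}) x : reval (tofrac p) x = p.[x].
Proof.
rewrite /reval; have [c c0 [-> ->]] := rnum_rden p.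
by rewrite hornerZ hornerC mulrAC divff // mul1r.
Qed.

Lemma is_pole_tofrac (p : {poly C}) x : ~ is_pole (tofrac p) x.
Proof.
rewrite /is_pole; have [c c0 [_ ->]] := rnum_rden p.
by rewrite rootC (negbTE c0).
Qed.

Lemma rcomp_tofrac (p g : {poly C}) : rcomp (tofrac p) g = tofrac (p \Po g).
Proof.
rewrite /rcomp; have [c c0 [-> ->]] := rnum_rden p.
rewrite comp_polyZ comp_polyC -mul_polyC tofracM mulrAC divff ?mul1r //.
by rewrite tofrac_eq0 polyC_eq0.
Qed.

Lemma mxeval_pmx n (P : 'M[{poly C}]_n) x :
  mxeval (pmx P) x = map_mx (fun p : {poly C} => p.[x]) P.
Proof. by apply/matrixP => i j; rewrite !mxE reval_tofrac. Qed.

Lemma mx_pole_pmx n (P : 'M[{poly C}]_n) x : ~ mx_pole (pmx P) x.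
Proof. by move=> [i [j]]; rewrite mxE; exact: is_pole_tofrac. Qed.

Lemma qpullback_pmx n (P : 'M[{poly C}]_n) (f : {poly C}) :
  qpullback f (pmx P) = pmx (map_mx (comp_poly (affine_inv f)) P).
Proof. by apply/matrixP => i j; rewrite !mxE rcomp_tofrac. Qed.

Lemma cvg_mxC (T : Type) (F : set_system T) {FF : Filter F} m n
  (f : T -> 'M[C]_(m, n)) (M : 'M[C]_(m, n)) :
  (forall i j, f x i j @[x --> F] --> M i j) -> f x @[x --> F] --> M.
Proof.
move=> h A [P hP sA].
have : \forall x \near F, forall i j, P i j (f x i j).
  by apply: filter_forall => i; apply: filter_forall => j; exact: h (hP i j).
by apply: filterS => x hx; exact: sA.
Qed.

Lemma horner_cvg (p : {poly C}) x : p.[y] @[y --> x] --> p.[x].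
Proof.
elim/poly_ind: p => [|p c IH].
  under eq_fun do rewrite horner0; rewrite horner0; exact: (@cvg_cstC _ _ (nbhs x)).
under eq_fun do rewrite hornerMXaddC; rewrite hornerMXaddC.
apply: (@cvgDC _ _ (nbhs x)); last exact: (@cvg_cstC _ _ (nbhs x)).
by apply: (@cvgMC _ _ (nbhs x)); [exact: IH|exact: cvg_id].
Qed.

Lemma cvg_dnbhs (T : topologicalType) (f : C -> T) (x : C) (l : T) : f y @[y --> x] --> l -> f y @[y --> x^'] --> l.
Proof. by move=> h; apply: cvg_trans h; apply: cvg_app; exact: cvg_within. Qed.

Lemma gauge1 n : gauge (fun _ : C => 1%:M : 'M[C]_n).
Proof.
exists 1, 0%N, (fun k => if k == 0%N then 1%:M else 0); split => // Q _.
split; first exact: unitmx1.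
move=> i j; rewrite expr0 mul1r.
apply: (@cvg_near_cst _ _ _ _ _ _); exists 1%N => // m /= m1.
rewrite /series /= big_ltn // big_nat big1 ?addr0 ?expr0 ?mulr1 //.
by move=> k /andP[k1 _]; rewrite gtn_eqF // mxE mul0r.
Qed.

Lemma q_regular_singular_pmx n (q : C) (P : 'M[{poly C}]_n) :
  map_mx (fun p : {poly C} => p.[0]) P \in unitmx -> q_regular_singular q (pmx P).
Proof.
move=> h; exists (fun _ => 1%:M); split; first exact: gauge1.
exists (map_mx (fun p : {poly C} => p.[0]) P) => //.
apply: cvg_dnbhs; apply: (@cvg_mxC _ (nbhs 0)) => i j.
under eq_fun do rewrite mul1mx invmx1 mulmx1 mxeval_pmx mxE.
by rewrite mxE; exact: horner_cvg.
Qed.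

Lemma d_regular_singular_pmx n (P : 'M[{poly C}]_n) : d_regular_singular (pmx P).
Proof.
exists (fun _ => 1%:M); split; first exact: gauge1.
exists (map_mx (fun p : {poly C} => p.[0]) P).
apply: cvg_dnbhs; apply: (@cvg_mxC _ (nbhs 0)) => i j.
have e Q : (1%:M *m mxeval (pmx P) Q + Q *: \matrix_(i, j) derive1 (fun x : C => (1%:M : 'M[C]_n) i j) Q)
   *m invmx 1%:M = map_mx (fun p : {poly C} => p.[Q]) P.
  rewrite mul1mx invmx1 mulmx1 mxeval_pmx -[RHS]addr0; congr (_ + _).
  by apply/matrixP => k l; rewrite !mxE derive1_cst mulr0.
under eq_fun do rewrite e mxE.
by rewrite mxE; exact: horner_cvg.
Qed.

Section Companion.
Variable N : nat.

Definition cmx (c : {poly C}) : 'M[{poly C}]_N.+1 :=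
  \matrix_(i, j) if (j == i.+1 :> nat) then 1
                 else if (i == ord_max) && (j == ord0) then c else 0.

Lemma companion_pmx c : companion_mx N (tofrac c) = pmx (cmx c).
Proof.
apply/matrixP => i j; rewrite !mxE.
by case: ifP => _; [rewrite tofrac1|case: ifP => _; rewrite ?tofrac0].
Qed.

Definition shiftmx : 'M[C]_N.+1 := \matrix_(i, j) (j == i.+1 :> nat)%:R.

Lemma cmx_eval0 c : c.[0] = 0 -> map_mx (fun p : {poly C} => p.[0]) (cmx c) = shiftmx.
Proof.
move=> h; apply/matrixP => i j; rewrite !mxE.
case: ifP => _; first by rewrite -polyC1 hornerC.
by case: ifP => _; rewrite ?horner0.
Qed.

(** An eigenvector for [l <> a] has all its coordinates equal to 0, one after the
    other. *)
Lemma eigenvalue_shift (a b l : C) : eigenvalue (a%:M + b *: shiftmx) l -> l = a.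
Proof.
move=> /eigenvalueP[v hv v0]; apply/eqP; apply: contraNT v0 => la.
have key (j : 'I_N.+1) : b * (v *m shiftmx) 0 j = (l - a) * v 0 j.
  have := congr1 (fun M : 'rV[C]_N.+1 => M 0 j) hv.
  rewrite mulmxDr mul_mx_scalar -scalemxAr; move: (v *m shiftmx) => w.
  by rewrite !mxE mulrBl => <-; rewrite addrAC subrr add0r.
have la0 : l - a != 0 by rewrite subr_eq0.
have vz k (hk : (k < N.+1)%N) : v 0 (Ordinal hk) = 0.
  elim: k hk => [|k IH] hk; apply: (mulfI la0); rewrite -key mulr0 mxE.
    by rewrite big1 ?mulr0 // => i _; rewrite mxE mulr0.
  have hk' := ltnW hk; rewrite (bigD1 (Ordinal hk')) //= mxE eqxx IH mul0r add0r.
  rewrite big1 ?mulr0 // => i ne; rewrite mxE /= eqSS.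
  by rewrite -(inj_eq val_inj) /= eq_sym in ne; rewrite (negbTE ne) mulr0.
by apply/eqP/rowP => j; rewrite mxE; case: j => k hk; exact: vz.
Qed.

Lemma unit_shift (b : C) : 1%:M + b *: shiftmx \in unitmx.
Proof.
rewrite unitmxE -det_tr det_trig.
  rewrite big1 ?unitr1 // => i _; rewrite !mxE eqxx.
  by rewrite ltn_eqF // mulr0 addr0.
apply/is_trig_mxP => i j ij; rewrite !mxE.
have -> : (j == i) = false by apply/eqP => e; rewrite e ltnn in ij.
have -> : (i == j.+1 :> nat) = false by rewrite ltn_eqF // ltnS ltnW.
by rewrite mulr0 addr0.
Qed.

Lemma companion_unit (c : CQ) : c != 0 -> companion_mx N c \in unitmx.
Proof.
move=> c0.
pose M' : 'M[CQ]_N.+1 := \matrix_(k, j)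
  if (k == j.+1 :> nat) then 1 else if (k == ord0) && (j == ord_max) then c^-1 else 0.
suff h : companion_mx N c *m M' = 1%:M by exact: (mulmx1_unit h).1.
apply/matrixP => i j; rewrite !mxE.
have [iN|Ni] := ltnP i N.
  have iN' : (i.+1 < N.+1)%N by [].
  rewrite (bigD1 (Ordinal iN')) //= !mxE eqxx mul1r /= eqSS.
  rewrite big1 ?addr0 => [|k ne].
    by rewrite (inj_eq val_inj); case: (i == j).
  rewrite !mxE.
  have -> : (k == i.+1 :> nat) = false by apply: contraNF ne => /eqP e; apply/eqP/val_inj.
  have -> : (i == ord_max) = false by rewrite -(inj_eq val_inj) /= ltn_eqF.
  by rewrite mul0r.
have ei : i = ord_max by apply/val_inj/eqP; rewrite eqn_leq Ni -ltnS ltn_ord.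
rewrite (bigD1 ord0) //= !mxE ei eqxx /= mulrC big1 ?addr0 => [|k ne].
  rewrite [ord_max == j]eq_sym; case: ifP => _; first by rewrite mulVf.
  by rewrite mul0r.
rewrite !mxE /= eqxx /= (negbTE ne).
by rewrite ltn_eqF ?mul0r.
Qed.

Lemma jordan_shift : is_jordan shiftmx.
Proof.
have E k l : shiftmx k l = (l == k.+1 :> nat)%:R by rewrite mxE.
move=> i j _; case: ifP => e; rewrite !E e //.
by right; rewrite !ltn_eqF.
Qed.

Section Confluent.
Variables (z lam : C).
Hypotheses (z0 : z != 0) (lam0 : reC lam < 0).

Let cz : {poly C} := (z ^+ N.+1)^-1 *: 'X.

Lemma dsys_pmx : dsys N z = pmx (cmx cz).
Proof. exact: companion_pmx. Qed.

Lemma cz0 : cz.[0] = 0. Proof. by rewrite hornerZ hornerX mulr0. Qed.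

Lemma pullback_pmx q : q != 1 -> qpullback (phi N z q) (qsys N q) =
  pmx (1%:M + (q - 1)%:P *: cmx cz).
Proof.
move=> q1; have q1' : 1 - q != 0 by rewrite subr_eq0 eq_sym.
have -> : qsys N q = pmx (1%:M + (q - 1)%:P *: cmx (((1 - q) ^+ N.+1)^-1 *: 'X)).
  by rewrite /qsys companion_pmx map_mxD map_mx1 map_mxZ.
rewrite qpullback_pmx; congr (map_mx _ _); apply/matrixP => i j.
rewrite mxE mxE mxE mxE !mxE.
rewrite comp_polyD comp_polyM comp_polyC rmorph_nat; congr (_ + _ * _).
case: ifP => _; first by rewrite -polyC1 comp_polyC.
case: ifP => _; last by rewrite comp_poly0.
rewrite comp_polyZ comp_polyX /affine_inv /phi !coefZ !coefX /= mulr1 mulr0 subr0.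
rewrite scalerA /cz; congr (_ *: _); rewrite expr_div_n invf_div.
by field; rewrite !expf_neq0.
Qed.

(** The factor [(z / (1 - q))^(N+1)] of the pullback turns [Q / (1 - q)^(N+1)]
    into [Q / z^(N+1)]. *)
Lemma delta_pullback q : q != 1 ->
  delta_mx_of q (qpullback (phi N z q) (qsys N q)) = dsys N z.
Proof.
move=> q1; rewrite pullback_pmx // /delta_mx_of dsys_pmx map_mxD map_mx1 map_mxZ.
rewrite addrAC subrr add0r scalerA mulVf ?scale1r //.
by rewrite tofrac_eq0 polyC_eq0 subr_eq0.
Qed.

Lemma qpow_neq1 t : 0 < t <= 1 -> qpow lam t != 1.
Proof.
move=> /andP[t0 _]; have : nm (qpow lam t) < 1 by exact: nm_q1.
by apply: contraTneq => ->; rewrite nm1 ltxx.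
Qed.

(** By [delta_pullback] the matrices [B_q] of the family do not depend on [q] and
    coincide with that of the differential system.  They have polynomial
    entries, hence no pole, and their value at 0 is a single nilpotent Jordan
    block, so that the gauge transformations and the matrices of the Jordan
    decompositions are identities. *)
Lemma confluent_dsys :
  confluent_with_limit lam (fun q => qpullback (phi N z q) (qsys N q)) (dsys N z).
Proof.
have ev0 q : map_mx (fun p : {poly C} => p.[0]) (1%:M + (q - 1)%:P *: cmx cz) =
    1%:M + (q - 1) *: shiftmx.
  apply/matrixP => i j; rewrite !mxE hornerD hornerM hornerC.
  have := congr1 (fun M : 'M[C]_N.+1 => M i j) (cmx_eval0 cz0); rewrite !mxE => ->.
  by congr (_ + _); case: (_ == _); rewrite ?horner0 -?polyC1 ?hornerC.
have dB t : 0 < t <= 1 -> delta_mx_of (qpow lam t)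
    (qpullback (phi N z (qpow lam t)) (qsys N (qpow lam t))) = dsys N z.
  by move=> ht; rewrite delta_pullback // qpow_neq1.
have dnear : \forall t \near (0 : R)^'+, 0 < t <= 1.
  near=> t; apply/andP; split; first by near: t; exact: nbhs_right_gt.
  by near: t; exact: nbhs_right_le.
have d0 : mxeval (dsys N z) 0 = shiftmx by rewrite dsys_pmx mxeval_pmx cmx_eval0 ?cz0.
have jd : jordan_decomposition (mxeval (dsys N z) 0) 1%:M shiftmx.
  split; [exact: unitmx1|exact: jordan_shift|].
  by rewrite d0 invmx1 mul1mx mulmx1.
split.
  move=> t ht; rewrite pullback_pmx ?qpow_neq1 //; split.
    by apply: q_regular_singular_pmx; rewrite ev0 unit_shift.
  split; first exact: mx_pole_pmx.
  by move=> l1 l2; rewrite mxeval_pmx ev0 => /eigenvalue_shift -> /eigenvalue_shift ->; rewrite eqxx.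
exists 0%N, (fun _ _ => 0); split.
  move=> t ht x; rewrite dB // dsys_pmx; split; first by move=> /mx_pole_pmx.
  by move=> [[]].
split.
- by move=> [].
- split.
    by apply: companion_unit; rewrite tofrac_eq0 scaler_eq0 invr_eq0 negb_or expf_neq0 //= polyX_eq0.
  move=> K cK _ A hA; apply: filterS dnear => t ht /=.
  by rewrite (dB t ht); exact: nbhs_singleton hA.
- split.
  + by rewrite dsys_pmx; exact: d_regular_singular_pmx.
  + split; first by rewrite dsys_pmx; exact: mx_pole_pmx.
    have e : mxeval (dsys N z) 0 = 0%:M + 1 *: shiftmx.
      by rewrite d0 scale1r -[LHS]add0r; congr (_ + _); apply/matrixP => i j; rewrite !mxE mul0rn.
    by move=> l1 l2; rewrite e => /eigenvalue_shift -> /eigenvalue_shift ->; rewrite eqxx.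
  + exists (fun _ => 0); split; [by move=> []|by move=> []|].
    move=> x; rewrite dsys_pmx; split; first by move=> /mx_pole_pmx.
    by move=> [[]].
- exists (fun _ => 1%:M), (fun _ => shiftmx), 1%:M, shiftmx; split => //.
    by move=> t ht; rewrite dB.
  exact: cvg_cst.
Unshelve. all: by end_near. Qed.

End Confluent.
End Companion.
End PolynomialEntries.

(** * Confluence of the solutions *)

Section Scaling.
Variables (R : realType) (N : nat).
Local Notation C := (Cplx R).
Local Notation HP := {poly %/ (relH R N)}.
Local Notation H := (Hcl R N).

(** The ring endomorphism [H |-> s H]. *)
Definition rescale (s : C) (p : HP) : HP := \sum_(b < N.+1) (s ^+ b * hcoef b p) *: H ^+ b.

Lemma hcoef_rescale s p b : (b <= N)%N -> hcoef b (rescale s p) = s ^+ b * hcoef b p.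
Proof.
move=> bN; have bN' : (b < N.+1)%N by [].
exact: (hcoef_expand (fun i : 'I_N.+1 => s ^+ i * hcoef i p) (Ordinal bN')).
Qed.

Lemma rescaleM s p r : rescale s (p * r) = rescale s p * rescale s r.
Proof.
apply: hcoefP => b bN; rewrite hcoef_rescale // !hcoefM // mulr_sumr.
apply: eq_bigr => i _; have ib : (i <= b)%N by rewrite -ltnS.
rewrite !hcoef_rescale ?(leq_trans ib) ?(leq_trans (leq_subr _ _)) //.
by rewrite -{1}(subnKC ib) exprD; ring.
Qed.

Lemma rescale1 s : rescale s 1 = 1.
Proof.
apply: hcoefP => b bN; rewrite hcoef_rescale // hcoef1 //.
by case: b bN => [|b] _; rewrite ?mulr1 ?mulr0.
Qed.

Lemma rescaleX s p n : rescale s (p ^+ n) = rescale s p ^+ n.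
Proof. by elim: n => [|n IH]; rewrite ?expr0 ?rescale1 // !exprS rescaleM IH. Qed.

Lemma hcoef_hinv (al be : C) b : (b <= N)%N ->
  hcoef b (hinv N al be) = al^-1 * (- be / al) ^+ b.
Proof.
move=> bN; have bN' : (b < N.+1)%N by [].
exact: (hcoef_expand (fun i : 'I_N.+1 => al^-1 * (- be / al) ^+ i) (Ordinal bN')).
Qed.

Lemma rescale_hinv (s al be : C) : s != 0 -> rescale s (hinv N al be) = s^-1 *: hinv N (al / s) be.
Proof.
move=> s0; apply: hcoefP => b bN; rewrite hcoef_rescale // hcoefZ !hcoef_hinv //.
rewrite invfM invrK; move: (al^-1) => ia; rewrite !exprMn.
by field.
Qed.

Lemma rescale_hW (s : C) (al be : nat -> C) d : s != 0 ->
  rescale s (hW N al be d) = (s^-1) ^+ (N.+1 * d) *: hW N (fun r => al r / s) be d.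
Proof.
move=> s0; elim: d => [|d IH]; first by rewrite !hW0 muln0 expr0 scale1r rescale1.
rewrite !hWS rescaleM rescaleX rescale_hinv // IH (exprZn _ (hinv N (al d / s) (be d))).
by rewrite -scalerAl -scalerAr scalerA -exprD mulnS.
Qed.

(** The powers of [s] that multiply the coordinates and [Q] amount to dividing
    each [al r] by [s]. *)
Lemma scaled_term (s Q : C) (al be : nat -> C) d b : s != 0 -> (b <= N)%N ->
  s ^+ b * ((s ^+ N.+1 * Q) ^+ d * hcoef b (hW N al be d)) =
  Q ^+ d * hcoef b (hW N (fun r => al r / s) be d).
Proof.
move=> s0 bN; have e := hcoef_rescale s (hW N al be d) bN.
rewrite (rescale_hW al be d s0) hcoefZ in e.
rewrite mulrCA -e exprMn -exprM exprVn.
by move: e => _; move: (hcoef b _) => h; field; rewrite expf_neq0.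
Qed.

End Scaling.

Section Confluence.
Variables (R : realType) (N : nat).
Local Notation C := (Cplx R).
Local Notation HP := {poly %/ (relH R N)}.
Local Notation H := (Hcl R N).
Local Notation S u := (limn (series u)).
Variables (lam z Q : C) (L : C -> C).
Hypotheses (lam0 : reC lam < 0) (z0 : z != 0).
Hypothesis hL : is_log_branch lam L.
Hypothesis hQ : log_domain lam Q.
Let q (t : R) : C := qpow lam t.
Let sg (t : R) : C := (1 - q t) / z.

Lemma q_near1 : q t @[t --> 0^'+] --> (1 : C). Proof. exact: cvg_qpow1. Qed.

Lemma sg_near0 : sg t @[t --> 0^'+] --> (0 : C).
Proof.
rewrite -[X in _ --> X](mul0r z^-1); apply: cvgMrC; rewrite -[X in _ --> X](subrr 1).
by apply: cvgBC; [exact: cvg_cst|exact: q_near1].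
Qed.

(** Every point of the domain is [exp x] with [x = s lam + i u] and [|u| < pi], and
    [L] takes the value [x] there. *)
Lemma ell_limit_L : (q t - 1) * ellq (q t) Q @[t --> 0^'+] --> L Q.
Proof.
have [s [u [hu eQ]]] := polar lam0 hQ.
have := ell_limit lam0 (erefl (rc s * lam + iang u)) hu.
by rewrite -eQ -(L_polar lam0 hL (erefl _) hu) -eQ.
Qed.

(** [z [r + 1]_q], with the q-integer written [(1 - q^(r+1)) / (1 - q)]. *)
Definition zqint (t : R) (r : nat) : C := jal (q t) r / sg t.

Lemma q_facts t : 0 < t -> [/\ q t != 0, nm (q t) < 1, 1 - q t != 0 & sg t != 0].
Proof.
move=> t0; have q1 : nm (q t) < 1 by exact: nm_q1.
have q0 : q t != 0 by exact: cexp_neq0.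
have h : 1 - q t != 0 by rewrite -[q t]expr1; exact: oneBq_neq0.
by split => //; rewrite /sg mulf_neq0 // invr_neq0.
Qed.

Lemma zqintE t r : 0 < t -> zqint t r = z * \sum_(j < r.+1) q t ^+ j.
Proof.
move=> /q_facts[q0 q1 h s0]; rewrite /zqint /jal /sg.
have -> : 1 - q t ^+ r.+1 = (1 - q t) * \sum_(j < r.+1) q t ^+ j.
  by rewrite -[LHS]opprB subrX1 -mulNr opprB.
by field; rewrite z0 h.
Qed.

Lemma cvg_zqint r : zqint t r @[t --> 0^'+] --> cal z r.
Proof.
have h : z * \sum_(j < r.+1) q t ^+ j @[t --> 0^'+] --> z * \sum_(j < r.+1) (1 : C) ^+ j.
  apply: cvgMlC; apply: cvg_sumC => j _; apply: cvg_exprC; exact: q_near1.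
have e : z * \sum_(j < r.+1) (1 : C) ^+ j = cal z r.
  rewrite (eq_bigr (fun _ => 1)); last by move=> i _; rewrite expr1n.
  by rewrite sumr_const card_ord mulrC.
rewrite -e; apply: cvg_trans h; apply: near_eq_cvg.
near=> t; rewrite zqintE //; near: t; exact: nbhs_right_gt.
Unshelve. all: by end_near. Qed.

(** [|[n]_q|] is at least a constant times [1 + |q| + ... + |q|^(n-1)], which is
    at least [n0 / 2] for [n >= n0] as soon as [|q|^n0 >= 1/2]. *)
Lemma zqint_lower (A : R) : exists n0 : nat, exists2 c : R, 0 < c <= 1 &
  \forall t \near (0 : R)^'+, (forall r, c <= nm (zqint t r)) /\
    (forall r, (n0 <= r)%N -> A <= nm (zqint t r)).
Proof.
have [K K0 hK] := q_ratio lam0.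
have nz : 0 < nm z by rewrite nm_gt0.
pose n0 := (Num.trunc (Num.max 0 (A * 2 * K / nm z))).+1.
exists n0, (Num.min 1 (nm z / K)).
  by rewrite lt_min ltr01 divr_gt0 //= ge_min lexx.
have hpow : \forall t \near (0 : R)^'+, 2^-1 < nm (q t) ^+ n0.
  have h : nm (q t ^+ n0) @[t --> 0^'+] --> nm ((1 : C) ^+ n0).
    by apply: cvg_nm; apply: cvg_exprC; exact: q_near1.
  rewrite expr1n nm1 in h.
  have h2 : 2^-1 < 1 :> R by lra.
  by apply: filterS (cvgr_gt _ h _ h2) => t; rewrite nmX.
near=> t.
have t0 : 0 < t by near: t; exact: nbhs_right_gt.
have [q0 q1 h s0] := q_facts t0.
have hKt : nm (1 - q t) <= K * (1 - nm (q t)) by near: t; exact: hK.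
have hp : 2^-1 < nm (q t) ^+ n0 by near: t; exact: hpow.
have p1 : 0 < 1 - nm (q t) by rewrite subr_gt0.
have qp := nm_ge0 (q t).
have key r : nm z / K * (\sum_(j < r.+1) nm (q t) ^+ j) <= nm (zqint t r).
  rewrite /zqint /jal /sg nmM nmV nmM nmV invfM invrK.
  have h1 : 1 - nm (q t) ^+ r.+1 <= nm (1 - q t ^+ r.+1).
    by have := nmDB 1 (- q t ^+ r.+1); rewrite nm1 nmN nmX.
  have e : 1 - nm (q t) ^+ r.+1 = (1 - nm (q t)) * \sum_(j < r.+1) nm (q t) ^+ j.
    by rewrite -[LHS]opprB subrX1 -mulNr opprB.
  have s1 : 0 <= \sum_(j < r.+1) nm (q t) ^+ j by apply: sumr_ge0 => j _; exact: exprn_ge0.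
  have p2 : 0 < nm (1 - q t) by rewrite nm_gt0.
  have -> : nm (1 - q t ^+ r.+1) * ((nm (1 - q t))^-1 * nm z) =
     nm z * (nm (1 - q t ^+ r.+1) / nm (1 - q t)) by ring.
  rewrite -mulrA; apply: ler_wpM2l; first exact: nm_ge0.
  rewrite ler_pdivlMr // mulrC mulrA.
  apply: (@le_trans _ _ ((1 - nm (q t)) * \sum_(j < r.+1) nm (q t) ^+ j)); last by rewrite -e.
  apply: ler_wpM2r => //; rewrite ler_pdivrMr // mulrC; exact: hKt.
split=> r.
  apply: le_trans (key r); rewrite ge_min; apply/orP; right.
  rewrite ler_peMr ?divr_ge0 ?nm_ge0 ?(ltW K0) // big_ord_recl expr0 lerDl.
  by apply: sumr_ge0 => j _; exact: exprn_ge0.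
move=> nr; apply: le_trans (key r).
apply: (@le_trans _ _ (nm z / K * (n0%:R * 2^-1))).
  have hn : A * 2 * K / nm z <= n0%:R.
    have m0 : 0 <= Num.max 0 (A * 2 * K / nm z) by rewrite le_max lexx.
    by apply: le_trans (ltW (truncnS_gt _)); rewrite le_max lexx orbT.
  rewrite ler_pdivrMr // in hn.
  rewrite mulrAC ler_pdivlMr //; lra.
apply: ler_wpM2l; first by rewrite divr_ge0 ?nm_ge0 // ltW.
rewrite -(subnKC (leqW nr)) big_split_ord /= -[leLHS]addr0; apply: lerD; last first.
  by apply: sumr_ge0 => j _; exact: exprn_ge0.
have -> : n0%:R * 2^-1 = \sum_(j < n0) 2^-1 :> R by rewrite sumr_const card_ord mulr_natl.
apply: ler_sum => j _; apply: (le_trans (ltW hp)).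
exact: (ler_wiXn2l qp (ltW q1) (ltnW (ltn_ord j))).
Unshelve. all: by end_near. Qed.

(** From some index on, uniformly in [t], the ratio of consecutive terms is at
    most 1/2. *)
Lemma hW_bound : exists K : R, \forall t \near (0 : R)^'+,
  forall d, hn (Q ^+ d *: hW N (zqint t) (jbe (q t)) d) <= K * 2^-1 ^+ d.
Proof.
(* A factor of norm at most 1/y has its power N + 1 at most 1/y, and nm Q / y <= 1/2. *)
pose y := Num.max 1 (2 * nm Q).
have y1 : 1 <= y by rewrite le_max lexx.
have y2 : 2 * nm Q <= y by rewrite le_max lexx orbT.
have y0 : 0 < y by exact: lt_le_trans y1.
have [n0 [c hc hnear]] := zqint_lower (N.+1%:R * y).
pose Bd := (N.+1%:R * c ^- N.+1) ^+ N.+1 * nm Q.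
pose B := Num.max 2^-1 Bd.
exists ((B / 2^-1) ^+ n0).
near=> t.
have t0 : 0 < t by near: t; exact: nbhs_right_gt.
have [q0 q1 h s0] := q_facts t0.
have [h1 h2] : (forall r, c <= nm (zqint t r)) /\
    (forall r, (n0 <= r)%N -> N.+1%:R * y <= nm (zqint t r)) by near: t; exact: hnear.
have be1 r : nm (jbe (q t) r) <= 1 by rewrite nmX exprn_ile1 ?nm_ge0 // ltW.
pose a d := hn (Q ^+ d *: hW N (zqint t) (jbe (q t)) d).
have aS d : a d.+1 <= (hn (hinv N (zqint t d) (jbe (q t) d)) ^+ N.+1 * nm Q) * a d.
  rewrite /a !hnZ exprS nmM.
  have -> : hn (hinv N (zqint t d) (jbe (q t) d)) ^+ N.+1 * nm Q * (nm (Q ^+ d) * hn (hW N (zqint t) (jbe (q t)) d))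
    = nm Q * nm (Q ^+ d) * (hn (hinv N (zqint t d) (jbe (q t) d)) ^+ N.+1 * hn (hW N (zqint t) (jbe (q t)) d)) by ring.
  by apply: ler_wpM2l; [rewrite mulr_ge0 ?nm_ge0|exact: hn_hWS].
have a0 d : 0 <= a d by exact: hn_ge0.
have bnd := @ratio_bound _ a B 2^-1 n0.
have a00 : a 0%N = 1 by rewrite /a expr0 scale1r hW0 hn1.
rewrite a00 mul1r in bnd.
apply: bnd => //.
- by rewrite invr_gt0 ltr0n le_max lexx.
- move=> d; apply: (le_trans (aS d)); apply: ler_wpM2r => //.
  rewrite le_max; apply/orP; right; apply: ler_wpM2r; first exact: nm_ge0.
  apply: lerXn2r; rewrite ?nnegrE ?hn_ge0 //; last exact: hn_hinv_bd.
  by case/andP: hc => c0 _; rewrite mulr_ge0 // invr_ge0 exprn_ge0 // ltW.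
- move=> d nd; apply: (le_trans (aS d)); apply: ler_wpM2r => //.
  have N1 : 1 <= N.+1%:R * y by apply: mulr_ege1; rewrite ?ler1n.
  have e1 : hn (hinv N (zqint t d) (jbe (q t) d)) <= y^-1.
    apply: (le_trans (hn_hinv_le N (be1 d) N1 (h2 d nd))).
    by rewrite invfM mulrA divff ?mul1r // pnatr_eq0.
  have e2 : hn (hinv N (zqint t d) (jbe (q t) d)) ^+ N.+1 <= y^-1.
    apply: (@le_trans _ _ (y^-1 ^+ N.+1)).
      by apply: lerXn2r; rewrite ?nnegrE ?hn_ge0 // invr_ge0 ltW.
    rewrite exprS -[leRHS]mulr1; apply: ler_wpM2l; first by rewrite invr_ge0 ltW.
    by rewrite exprn_ile1 ?invr_ge0 ?(ltW y0) // invf_le1.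
  apply: (le_trans (ler_wpM2r (nm_ge0 Q) e2)).
  by rewrite mulrC ler_pdivrMr //; lra.
Unshelve. all: by end_near. Qed.

Definition hcvg (f : R -> HP) (p : HP) :=
  forall b, (b <= N)%N -> hcoef b (f t) @[t --> 0^'+] --> hcoef b p.

Lemma hcvgM f g p r : hcvg f p -> hcvg g r -> hcvg (fun t => f t * g t) (p * r).
Proof.
move=> hf hg b bN; rewrite hcoefM //; under eq_fun do rewrite hcoefM //.
apply: cvg_sumC => i _; have ib : (i <= b)%N by rewrite -ltnS.
apply: cvgMC; first by apply: hf; exact: leq_trans ib bN.
by apply: hg; exact: leq_trans (leq_subr _ _) bN.
Qed.

Lemma hcvg_exp f p n : hcvg f p -> hcvg (fun t => f t ^+ n) (p ^+ n).
Proof.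
move=> h; elim: n => [|n IH].
  by move=> b bN; under eq_fun do rewrite expr0; rewrite expr0; exact: cvg_cst.
have -> : (fun t => f t ^+ n.+1) = (fun t => f t * f t ^+ n).
  by apply/funext => t; rewrite exprS.
by rewrite exprS; exact: hcvgM.
Qed.

Lemma hcvg_hW d : hcvg (fun t => hW N (zqint t) (jbe (q t)) d) (hW N (cal z) (fun _ => 1) d).
Proof.
elim: d => [|d IH].
  by move=> b bN; under eq_fun do rewrite hW0; rewrite hW0; exact: cvg_cst.
have -> : (fun t => hW N (zqint t) (jbe (q t)) d.+1) =
  (fun t => hinv N (zqint t d) (jbe (q t) d) ^+ N.+1 * hW N (zqint t) (jbe (q t)) d).
  by apply/funext => t; rewrite hWS.
rewrite hWS; apply: hcvgM; last exact: IH.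
apply: hcvg_exp => b bN.
under eq_fun do rewrite hcoef_hinv //; rewrite hcoef_hinv //.
have hV : (zqint t d)^-1 @[t --> 0^'+] --> (cal z d)^-1.
  by apply: cvgVC; [exact: cal_neq0|exact: cvg_zqint].
apply: cvgMC; first exact: hV.
apply: cvg_exprC; apply: cvgMC; last exact: hV.
apply: cvgNC; rewrite -[X in _ --> X](expr1n C d.+1).
by apply: cvg_exprC; exact: q_near1.
Qed.

Definition Jcoh_coef (b : nat) : C := hcoef b (hsum (@Jcoh_term R N z Q)).

(** After rescaling, the term of degree [d] is a product of factors [z [r]_q + q^r H],
    which tend to [r z + H]; [hW_bound] dominates the series. *)
Lemma cvg_Jb b : (b <= N)%N ->
  ((1 - q t) / z) ^+ b * Jb N b (q t) (((1 - q t) / z) ^+ N.+1 * Q) @[t --> 0^'+] --> Jcoh_coef b.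
Proof.
move=> bN.
have x0 : \forall t \near (0 : R)^'+, nm (sg t ^+ N.+1 * Q) < 1.
  have h : nm (sg t ^+ N.+1 * Q) @[t --> 0^'+] --> nm ((0 : C) ^+ N.+1 * Q).
    by apply: cvg_nm; apply: cvgMrC; apply: cvg_exprC; exact: sg_near0.
  rewrite expr0n mul0r nm0 in h; exact: (cvgr_lt _ h _ ltr01).
have e : \forall t \near (0 : R)^'+,
   S (fun d => Q ^+ d * hcoef b (hW N (zqint t) (jbe (q t)) d)) =
   sg t ^+ b * Jb N b (q t) (sg t ^+ N.+1 * Q).
  near=> t.
  have t0 : 0 < t by near: t; exact: nbhs_right_gt.
  have [q0 q1 h s0] := q_facts t0.
  have xt : nm (sg t ^+ N.+1 * Q) < 1 by near: t.
  rewrite /Jb kcoef_gamma gamma_ksum hcoef_hsum //.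
  have gb : geob (fun d => (sg t ^+ N.+1 * Q) ^+ d * hcoef b (hW N (jal (q t)) (jbe (q t)) d)).
    apply: (geob_le (hgeob_coef b (hgeob_W N q1 xt))) => d.
    by rewrite hcoefZ.
  have -> : (fun d => hcoef b (gamma (JK_term N (q t) (sg t ^+ N.+1 * Q) d))) =
     (fun d => (sg t ^+ N.+1 * Q) ^+ d * hcoef b (hW N (jal (q t)) (jbe (q t)) d)).
    by apply/funext => d; rewrite (gamma_JKterm N q1) hcoefZ.
  rewrite -S_scale //.
  congr (limn _); congr series; apply/funext => d.
  exact: esym (scaled_term _ _ _ _ s0 bN).
apply: cvg_trans (near_eq_cvg e) _.
rewrite /Jcoh_coef hcoef_hsum //.
have [K hK] := hW_bound.
apply: (@tannery _ _ _ _ _ _ K 2^-1).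
- by lra.
- move=> d; rewrite (@Jcoh_termE _ _ _ z0) hcoefZ.
  by apply: cvgMlC; exact: hcvg_hW.
apply: filterS hK => t ht d; apply: le_trans (ht d).
by rewrite hnZ nmM; apply: ler_wpM2l; [exact: nm_ge0|exact: hcoef_le].
Unshelve. all: by end_near. Qed.

Definition exp_coef (a : nat) : C := (a`!%:R)^-1 * (L Q / z) ^+ a.

(** Distributing the powers of [(q - 1) / z] over the [a] factors leaves
    [(q - 1) ellq / z] in each, up to a term that tends to 0. *)
Lemma cvg_cbinom a : ((q t - 1) / z) ^+ a * cbinom (ellq (q t) Q) a @[t --> 0^'+] --> exp_coef a.
Proof.
have hf r : ((q t - 1) * ellq (q t) Q) / z - r%:R * ((q t - 1) / z) @[t --> 0^'+] --> L Q / z - r%:R * (0 / z).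
  apply: cvgBC; first by apply: cvgMrC; exact: ell_limit_L.
  apply: cvgMlC; apply: cvgMrC; rewrite -[X in _ --> X](subrr 1).
  by apply: cvgBC; [exact: q_near1|exact: cvg_cst].
apply: (@cvg_eqC _ _ _ _
  (fun t => (a`!%:R)^-1 * \prod_(r < a) (((q t - 1) * ellq (q t) Q) / z - r%:R * ((q t - 1) / z))) _
  ((a`!%:R)^-1 * \prod_(r < a) (L Q / z - r%:R * (0 / z)))).
- move=> t; rewrite /cbinom mulrA [LHS]mulrC; congr (_ * _).
  have -> : ((q t - 1) / z) ^+ a = \prod_(r < a) ((q t - 1) / z).
    by rewrite prodr_const card_ord.
  rewrite -big_split /=.
  by apply: eq_bigr => r _; ring.
- rewrite /exp_coef; congr (_ * _); rewrite (eq_bigr (fun _ => L Q / z)).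
    by rewrite prodr_const card_ord.
  by move=> r _; rewrite mul0r mulr0 subr0.
by apply: cvgMlC; apply: cvg_prodC => r _; exact: hf.
Qed.

(** Coordinate of [Q^(H/z)] times the cohomological series. *)
Definition conv_coef (i : nat) : C := \sum_(a < N.+1) \sum_(b < N.+1 | (a + b == i)%N) exp_coef a * Jcoh_coef b.

Lemma cvg_kcoef i : kcoef i (JK_mod N z (q t) Q) @[t --> 0^'+] --> (if (i <= N)%N then conv_coef i else 0).
Proof.
have e t : gamma (JK_mod N z (q t) Q) = \sum_(i < N.+1)
    (\sum_(a < N.+1) \sum_(b < N.+1 | (a + b == i)%N)
       ((q t - 1) / z) ^+ a * cbinom (ellq (q t) Q) a *
       (((1 - q t) / z) ^+ b * Jb N b (q t) (((1 - q t) / z) ^+ N.+1 * Q))) *: H ^+ i.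
  by rewrite /JK_mod raddf_sum; apply: eq_bigr => j _; rewrite -gammaXn -gmZ.
under eq_fun do rewrite kcoef_gamma e.
case: leqP => iN; last by under eq_fun do rewrite hcoef_big //; exact: cvg_cst.
have iN' : (i < N.+1)%N by [].
under eq_fun do rewrite (hcoef_expand (fun j : 'I_N.+1 => \sum_(a < N.+1) \sum_(b < N.+1 | (a + b == j)%N)
       ((q _ - 1) / z) ^+ a * cbinom (ellq (q _) Q) a *
       (((1 - q _) / z) ^+ b * Jb N b (q _) (((1 - q _) / z) ^+ N.+1 * Q))) (Ordinal iN')) /=.
apply: cvg_sumC => a _; apply: cvg_sumC => b _.
apply: cvgMC; first exact: cvg_cbinom.
by apply: cvg_Jb; rewrite -ltnS.
Qed.

Lemma conv_coefE i : (i <= N)%N -> conv_coef i = \sum_(a < i.+1) exp_coef a * Jcoh_coef (i - a).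
Proof.
move=> iN; rewrite /conv_coef.
rewrite (big_ord_widen N.+1 (fun a => exp_coef a * Jcoh_coef (i - a))) ?ltnS //.
rewrite big_mkcond [RHS]big_mkcond /=; apply: eq_bigr => a _; rewrite ltnS.
case: leqP => ai.
  have hb : (i - a < N.+1)%N by rewrite ltnS (leq_trans (leq_subr _ _)).
  rewrite (bigD1 (Ordinal hb)) /=; last by rewrite subnKC.
  rewrite big1 ?addr0 // => b /andP[/eqP e ne].
  by move: ne; rewrite -(inj_eq val_inj) /= -e addKn eqxx.
rewrite big1 // => b /eqP e; exfalso.
by move: ai; rewrite -e ltnNge leq_addr.
Qed.

Lemma confluence_all :
  [/\ \forall t \near (0 : R)^'+, forall b : nat,
          cvgn (series (fun d => kcoef b
            (JK_term N (qpow lam t) (((1 - qpow lam t) / z) ^+ N.+1 * Q) d))),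
      confluence_exists N lam z Q &
      gamma (confluence N lam z Q) = Jcoh N L z Q].
Proof.
split.
- have h : nm (sg t ^+ N.+1 * Q) @[t --> 0^'+] --> nm ((0 : C) ^+ N.+1 * Q).
    by apply: cvg_nm; apply: cvgMrC; apply: cvg_exprC; exact: sg_near0.
  rewrite expr0n mul0r nm0 in h; have x0 := cvgr_lt _ h _ ltr01.
  near=> t => b.
  have t0 : 0 < t by near: t; exact: nbhs_right_gt.
  have [q0 q1 _ s0] := q_facts t0.
  have xt : nm (sg t ^+ N.+1 * Q) < 1 by near: t; exact: x0.
  apply: geob_cvg.
  apply: (geob_le (hgeob_coef b (hgeob_W N q1 xt))) => d.
  by rewrite kcoef_gamma (gamma_JKterm N q1).
- by move=> i; apply/cvg_ex; eexists; exact: cvg_kcoef.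
- apply: hcoefP => b bN.
  have -> : gamma (confluence N lam z Q) = \sum_(i < N.+1) conv_coef i *: H ^+ i.
    rewrite /confluence raddf_sum; apply: eq_bigr => i _.
    rewrite -gammaXn -gmZ; congr (gamma (_ *: _)); apply: limC.
    have h : kcoef i (JK_mod N z (q t) Q) @[t --> 0^'+] -->
        (if (i <= N)%N then conv_coef i else 0) by exact: (@cvg_kcoef i).
    by rewrite -ltnS ltn_ord in h; exact: h.
  have bN' : (b < N.+1)%N by [].
  rewrite (hcoef_expand (fun i : 'I_N.+1 => conv_coef i) (Ordinal bN')) /= conv_coefE //.
  rewrite /Jcoh hcoefM //; apply: eq_bigr => a _.
  congr (_ * _); rewrite -[RHS]/(hcoef a (QHz N L z Q)) hcoef_QHz //.
  by apply: leq_trans bN; rewrite -ltnS.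
Unshelve. all: by end_near. Qed.

End Confluence.

Theorem mainTheorem1 (R : realType) (N : nat) (z q0 lq0 : Cplx R)
    (L : Cplx R -> Cplx R) :
  (1 <= N)%N -> z != 0 -> q0 != 0 -> `|q0| < 1 -> cexp lq0 = q0 ->
  is_log_branch lq0 L ->
  [/\ forall t : R, 0 < t <= 1 ->
        forall Q : Cplx R, Q != 0 -> `|Q| < 1 -> theta (qpow lq0 t) Q != 0 ->
        qeq_at (qpow lq0 t) (@JK R N (qpow lq0 t)) Q,
      forall Q : Cplx R, log_domain lq0 Q -> deq_at z (@Jcoh R N L z) Q &
      confluent_with_limit lq0 (fun q => qpullback (phi N z q) (qsys N q))
        (dsys N z)] /\
  (forall Q : Cplx R, log_domain lq0 Q ->
    [/\ \forall t \near (0 : R)^'+, forall b : nat,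
          cvgn (series (fun d => kcoef b
            (JK_term N (qpow lq0 t) (((1 - qpow lq0 t) / z) ^+ N.+1 * Q) d))),
        confluence_exists N lq0 z Q &
        gamma (confluence N lq0 z Q) = Jcoh N L z Q]).
Proof.
move=> _ z0 q00 q01 eq0 hL.
have lam0 : reC lq0 < 0.
  by rewrite -expR_lt1 -nm_cexp eq0 -rc_lt -nmE.
split; last by move=> Q hQ; exact: confluence_all.
split.
- move=> t /andP[t0 _] Q Q0 Q1 th0; apply: qeq_JK => //.
  + exact: cexp_neq0.
  + exact: nm_q1.
  + by rewrite -rc_lt -nmE.
- by move=> Q hQ; exact: deq_Jcoh hQ.
- exact: confluent_dsys.
Qed.
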